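(* Let $(\sigma,u,\gamma,z,p)$ be an exact solution of the variational problem (W) and assume that numerical initial data $\sigma_h(0),p_h(0),z_h(0)$ are given to satisfy $$\|\sigma(0)-\sigma_h(0),\ p(0)-p_h(0),\ z(0)-z_h(0)\|_0\lesssim h^m,\qquad 1\le m\le r .$$ Let $(\sigma_h,u_h,\gamma_h,z_h,p_h)$ be the solution of the semidiscrete problem (D) with these numerical initial data. Set $e_\sigma^h=I_h^\Sigma\sigma-\sigma_h$, $e_u^h=P_h^Vu-u_h$, $e_\gamma^h=P_h^\Gamma\gamma-\gamma_h$, $e_z^h=I_h^Wz-z_h$, $e_p^h=P_h^Qp-p_h$. Then, for $1\le m\le r$, the following estimates hold: \begin{align*} \|e_\sigma^h+\alpha e_p^h\,\mathbb I\|_{L^\infty L^2_{\mathcal A}}&\lesssim h^m\max\{\|\sigma,p,\gamma\|_{W^{1,1}H^m},\ \|z\|_{L^2H^m}\},\\ \|e_\sigma^h\|_{L^\infty L^2}&\lesssim h^m\big(\|\sigma,p,\gamma\|_{W^{1,2}H^m}+\|z\|_{W^{1,1}H^m}\big),\\ \|e_u^h,e_\gamma^h\|_{L^\infty L^2}&\lesssim h^m\max\{\|\sigma,p,\gamma\|_{W^{1,1}H^m},\ \|z\|_{L^2H^m}\},\\ \|e_z^h\|_{L^\infty L^2}&\lesssim h^m\big(\|\sigma,p,\gamma\|_{W^{1,2}H^m}+\|z\|_{W^{1,1}H^m}\big),\\ \|e_p^h\|_{L^\infty L^2}&\lesssim h^m\big(\|\sigma,p,\gamma\|_{W^{1,2}H^m}+\|z\|_{W^{1,1}H^m}\big).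 \end{align*} Note that, for sufficiently regular solutions, $\|e_u^h\|_{L^\infty L^2}\lesssim h^r$ holds even though $r'=\mathcal O(V_h)$ may be less than $r$.
   Context: Notation. $\Omega\subset\mathbb R^n$ ($n=2,3$) is a bounded Lipschitz domain, $J=[0,T]$, $T>0$. $\mathbb M,\mathbb S,\mathbb K$ are the spaces of all, symmetric, skew-symmetric $n\times n$ matrices, $\mathbb V=\mathbb R^n$, $\mathbb I$ is the identity matrix. $(\cdot,\cdot)$, $\|\cdot\|_0$ are the $L^2(\Omega)$ inner product and norm (also for vector- or matrix-valued functions, with the Frobenius inner product), $\|\cdot\|_m$ is the $H^m$ norm. $\operatorname{div}$ of a matrix field is row-wise. For a Banach space $\mathcal X$, $L^r\mathcal X=L^r(J;\mathcal X)$, and $W^{k,r}\mathcal X=W^{k,r}(J;\mathcal X)$ has norm $\sum_{i=0}^k\|\partial_t^if\|_{L^r\mathcal X}$; $\|f,g\|_{\mathcal X}=\|f\|_{\mathcal X}+\|g\|_{\mathcal X}$ (similarly for more entries). A dot denotes $\partial/\partial t$. $X\lesssim Y$ means $X\le cY$ with a generic constant $c>0$ independent of mesh sizes. Coefficients (functions of $x\in\Omega$). $\mathcal A^s=\mathcal C^{-1}$, where the elastic stiffness tensor $\mathcal C$ gives a symmetric positive definite linear map from $L^2(\Omega;\mathbb S)$ into itself; $\mathcal A$ is the extension of $\mathcal A^s$ to $L^2(\Omega;\mathbb M)$ which is a positive constant multiple of the identity on $L^2(\Omega;\mathbb K)$. $\alpha>0$ is scalar, $s_0\ge0$ is scalar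 (not assumed strictly positive), $\kappa$ is a positive definite matrix (hydraulic conductivity tensor). $\|\tau\|_{\mathcal A}=(\mathcal A\tau,\tau)^{1/2}$, and $L^2_{\mathcal A}$ is $L^2$ with norm $\|\cdot\|_{\mathcal A}$. Spaces: $\Sigma=H(\operatorname{div},\Omega;\mathbb M)$, $V=L^2(\Omega;\mathbb V)$, $\Gamma=L^2(\Omega;\mathbb K)$, $W=H(\operatorname{div},\Omega)$, $Q=L^2(\Omega)$; $\|\cdot\|_{\operatorname{div}}=(\|\cdot\|_0^2+\|\operatorname{div}\cdot\|_0^2)^{1/2}$. Problem (W) (vanishing boundary conditions $u=0$, $p=0$ on $\partial\Omega$): find $(\sigma,p)\in C^1(J;\Sigma\times Q)$, $(u,\gamma,z)\in C^0(J;V\times\Gamma\times W)$ with, for given $f,g$, \begin{align*} (\mathcal A(\sigma+\alpha p\mathbb I),\tau)+(u,\operatorname{div}\tau)+(\gamma,\tau)&=0 &&\forall\tau\in\Sigma,\\ (\operatorname{div}\sigma,v)+(\sigma,\eta)&=-(f,v) &&\forall(v,\eta)\in V\times\Gamma,\\ (\kappa^{-1}z,w)+(p,\operatorname{div}w)&=0 &&\forall w\in W,\\ (s_0\dot p,q)+(\mathcal A(\dot\sigma+\alpha\dot p\mathbb I),\alpha q\mathbb I)-(\operatorname{div}z,q)&=(g,q) &&\forall q\in Q. \end{align*} Problem (D): find $(\sigma_h,p_h)\in C^1(J;\Sigma_h\times Q_h)$, $(u_h,\gamma_h,z_h)\in C^0(J;V_h\times\Gamma_h\times W_h)$ satisfying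 the same four equations with $(\sigma,u,\gamma,z,p)$ replaced by $(\sigma_h,u_h,\gamma_h,z_h,p_h)$ and test functions in $\Sigma_h,V_h\times\Gamma_h,W_h,Q_h$. Finite elements. $\Sigma_h\subset\Sigma$, $V_h\subset V$, $\Gamma_h\subset\Gamma$, $W_h\subset W$, $Q_h\subset Q$ are finite element spaces on shape-regular meshes of $\Omega$ with mesh size $h$. $\mathcal O(\Xi_h)$ denotes the best order of approximation of $\Xi_h$ in the $L^2$ norm (e.g. it is $k+1$ for discontinuous piecewise polynomials of degree $\le k$). Assume $\min\{\mathcal O(\Sigma_h),\mathcal O(\Gamma_h)\}=\mathcal O(W_h)=\mathcal O(Q_h)=r\ge1$ and $\mathcal O(V_h)=r'\ge1$ with $r'=r$ or $r'=r-1$. $(W_h,Q_h)$ is the Raviart–Thomas pair ($n=2$) or the Nédélec first kind $H(\operatorname{div})$ pair ($n=3$). Further assume: (S1) $\operatorname{div}\Sigma_h=V_h$ and $\operatorname{div}W_h=Q_h$. (S2) There are bounded maps $\Pi_h^\Sigma:H^1(\Omega;\mathbb M)\to\Sigma_h$, $\Pi_h^W:H^1(\Omega;\mathbb V)\to W_h$ with $\operatorname{div}\Pi_h^\Sigma\tau=P_h^V\operatorname{div}\tau$, $\operatorname{div}\Pi_h^Ww=P_h^Q\operatorname{div}w$, $\|\tau-\Pi_h^\Sigma\tau\|_0\lesssim h^m\|\tau\|_m$, $\|w-\Pi_h^Ww\|_0\lesssim h^m\|w\|_m$ for $1\le m\le r$. (S3) For every $q\in Q_h$ there is $w\in W_h$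 with $\operatorname{div}w=q$, $\|w\|_{\operatorname{div}}\lesssim\|q\|_0$. (S4) For every $(v,\eta)\in V_h\times\Gamma_h$ there is $\tau\in\Sigma_h$ with $\operatorname{div}\tau=v$, $(\tau,\eta')=(\eta,\eta')$ for all $\eta'\in\Gamma_h$, and $\|\tau\|_{\operatorname{div}}\lesssim\|v\|_0+\|\eta\|_0$. Interpolations. $P_h^V,P_h^Q,P_h^\Gamma$ are the $L^2$ projections onto $V_h,Q_h,\Gamma_h$. $I_h^W$ is the canonical Raviart–Thomas–Nédélec interpolation into $W_h$; it satisfies $\operatorname{div}I_h^Ww=P_h^Q\operatorname{div}w$ and $\|w-I_h^Ww\|_0\lesssim h^m\|w\|_m$, $1\le m\le r$. $I_h^\Sigma:\Sigma\to\Sigma_h$ is defined by $I_h^\Sigma\sigma=\tilde\sigma_h$, where $(\tilde\sigma_h,\tilde u_h,\tilde\gamma_h)\in\Sigma_h\times V_h\times\Gamma_h$ solves $(\tilde\sigma_h,\tau)+(\tilde u_h,\operatorname{div}\tau)+(\tilde\gamma_h,\tau)=(\sigma,\tau)$, $(\operatorname{div}\tilde\sigma_h,v)=(\operatorname{div}\sigma,v)$, $(\tilde\sigma_h,\eta)=(\sigma,\eta)$ for all $(\tau,v,\eta)\in\Sigma_h\times V_h\times\Gamma_h$; it is known that $\|I_h^\Sigma\tau-\tau\|_0\lesssim h^m\|\tau\|_m$, $1\le m\le r$.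
   Formalization: The initial errors are assumed ≤ c₀h^m times the theorem's right-hand sides (the max bound for σ, p; the sum bound for z), not just ≲ h^m: for the zero exact solution the literal claim fails, as a nonzero initial error of size h^m gives nonzero errors while all bounds vanish. *)

(* Defs.v *)
From HB Require Import structures.
From mathcomp Require Import all_boot all_order all_algebra.
From mathcomp Require Import all_classical all_reals all_analysis.
Set Implicit Arguments.
Unset Strict Implicit.
Unset Printing Implicit Defensive.
Import Order.TTheory GRing.Theory Num.Theory.
Import numFieldNormedType.Exports.
Local Open Scope classical_set_scope.
Local Open Scope ring_scope.

Section lebesgue_rV.
Context {R : realType}.

(** Row vectors carry the product sigma-algebra generated by the coordinates. *)
Definition coord n (i : 'I_n) (x : 'rV[R]_n) : R := x ord0 i.

Let rV_set0 n : g_sigma_preimage (@coord n) set0.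
Proof. exact: sigma_algebra0. Qed.

Let rV_setC n A : g_sigma_preimage (@coord n) A ->
  g_sigma_preimage (@coord n) (~` A).
Proof. exact: sigma_algebraC. Qed.

Let rV_bigcup n (F : _^nat) : (forall i, g_sigma_preimage (@coord n) (F i)) ->
  g_sigma_preimage (@coord n) (\bigcup_i (F i)).
Proof. exact: sigma_algebra_bigcup. Qed.

HB.instance Definition _ n := @isMeasurable.Build default_measure_display
  'rV[R]_n (g_sigma_preimage (@coord n)) (@rV_set0 n) (@rV_setC n)
  (@rV_bigcup n).

Definition rV_cons n (xt : 'rV[R]_n * measurableTypeR R) : 'rV[R]_n.+1 :=
  \row_i (if unlift ord0 i is Some j then xt.1 ord0 j else xt.2).

Lemma measurable_coord n (i : 'I_n) : measurable_fun setT (@coord n i).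
Proof.
move=> _ Y mY; rewrite setTI; apply: sub_sigma_algebra => /=.
rewrite -bigcup_seq/=; exists i => /=; first by rewrite mem_index_enum.
by exists Y => //; rewrite setTI.
Qed.

Lemma measurable_rV_cons n : measurable_fun setT (@rV_cons n).
Proof.
suff mf : g_sigma_preimage (fun i => @coord n.+1 i \o @rV_cons n) `<=` measurable.
  move=> _ A mA; apply: mf; rewrite g_sigma_preimage_comp.
  by exists A.
apply: smallest_sub; first exact: sigma_algebra_measurable.
rewrite -bigcup_mkord_ord; apply: bigcup_sub => i _ A [B mB <-].
have : measurable_fun setT (@coord n.+1 (inord i) \o @rV_cons n); last exact.
rewrite (_ : _ \o _ = fun xt : 'rV[R]_n * measurableTypeR R =>
  if unlift ord0 (inord i : 'I_n.+1) is Some j then coord j xt.1 else xt.2).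
  by case: unliftP => [j _|_]; [apply: measurableT_comp;
    [exact: measurable_coord|exact: measurable_fst]|exact: measurable_snd].
by apply/funext => -[x t]; rewrite /coord /rV_cons /= mxE.
Qed.

(** The explicit constant is the measure structure that the library puts on a
    pushforward along a measurable map. *)
Fixpoint leb n : {measure set 'rV[R]_n -> \bar R} :=
  match n with
  | 0 => \d_ (0 : 'rV[R]_0)
  | n'.+1 => measure_function_pushforward__canonical__measure_function_Measure
      (leb n' \x lebesgue_measure)%E (@measurable_rV_cons n')
  end.

End lebesgue_rV.

(** * Domains and fields

    All fields are matrix-valued functions on R^n: scalar fields take values in
    ['M_1], vector fields that have a divergence in ['rV_n], and row-wise
    divergences of ['M_n]-valued fields in ['cV_n]. Fields are functions, not
    classes; sets of fields used as subspaces of L^2 are closed under equality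
    almost everywhere on the domain. *)

Section fields.
Context {R : realType} {n : nat}.
Local Notation pt := 'rV[R]_n.
Local Notation fld a b := (pt -> 'M[R]_(a, b)).

Definition frob a b (A B : 'M[R]_(a, b)) : R := \sum_i \sum_j A i j * B i j.

Definition enorm (v : pt) : R := Num.sqrt (frob v v).

(** Near each boundary point the domain is, in the direction [e], the strict
    epigraph of a Lipschitz function of the coordinates orthogonal to [e]. *)
Definition lipschitz_domain (Om : set pt) : Prop :=
  [/\ open Om, Om !=set0, connected Om, bounded_set Om &
    forall x0, closure Om x0 -> ~ Om x0 ->
    exists (e : pt) (psi : pt -> R) (L rho : R),
      [/\ enorm e = 1, 0 < rho,
          forall x y, `|psi x - psi y| <= L * enorm (x - y),
          forall x t, psi (x + t *: e) = psi x &
          forall x, enorm (x - x0) < rho -> (Om x <-> psi x < frob x e)]].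

(** Iterated partial derivatives along a list of directions. *)
Definition partial (s : seq 'I_n) (phi : pt -> R) : pt -> R :=
  foldr (fun i g x => 'D_((delta_mx ord0 i)) g x) phi s.

Definition smooth (phi : pt -> R) : Prop := forall s,
  continuous (partial s phi) /\ forall i x, derivable (partial s phi) x (delta_mx ord0 i).

Definition test_function (Om : set pt) (phi : pt -> R) : Prop :=
  smooth phi /\
  exists K, [/\ compact K, K `<=` Om & forall x, ~ K x -> phi x = 0].

Section on_domain.
Variable Om : set pt.

Definition L2 a b : set (fld a b) := [set f : fld a b |
  (forall i j, measurable_fun Om (fun x => f x i j)) /\
  (\int[leb n]_(x in Om) (frob (f x) (f x))%:E < +oo)%E].

Definition ip a b (f g : fld a b) : R :=
  \int[leb n]_(x in Om) frob (f x) (g x).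

Definition nrm a b (f : fld a b) : R := Num.sqrt (ip f f).

(** [d] is a weak row-wise divergence of [tau]; it is unique up to null sets. *)
Definition wdiv a (tau : fld a n) (d : fld a 1) : Prop :=
  L2 d /\ forall phi, test_function Om phi -> forall i,
    \int[leb n]_(x in Om) (\sum_j tau x i j * partial [:: j] phi x) =
    - \int[leb n]_(x in Om) (d x i ord0 * phi x).

Definition Hdiv a : set (fld a n) := [set tau : fld a n | L2 tau /\ exists d, wdiv tau d].

Definition nrmdiv a (tau : fld a n) (d : fld a 1) : R :=
  Num.sqrt (nrm tau ^+ 2 + nrm d ^+ 2).

Definition skewL2 : set (fld n n) := [set eta : fld n n | L2 eta /\
  {ae leb n, forall x, Om x -> (eta x)^T = - eta x}].

(** ** Sobolev norms *)

Definition mindex m := {ffun 'I_n -> 'I_m.+1}.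

Definition mlength m (a : mindex m) : nat := (\sum_i a i)%N.

Definition mdirs m (a : mindex m) : seq 'I_n :=
  flatten [seq nseq (a i) i | i <- enum 'I_n].

Definition weak_partial a b m (al : mindex m) (f g : fld a b) : Prop :=
  L2 g /\ forall phi, test_function Om phi -> forall i j,
    \int[leb n]_(x in Om) (f x i j * partial (mdirs al) phi x) =
    (-1) ^+ mlength al * \int[leb n]_(x in Om) (g x i j * phi x).

(** The H^m norm, with value [+oo] outside H^m: the infimum is over the
    (unique up to null sets) families of weak derivatives of order at most m. *)
Definition Hnorm m a b (f : fld a b) : \bar R :=
  ereal_inf [set y | L2 f /\ exists g : mindex m -> fld a b,
    (forall al, (mlength al <= m)%N -> weak_partial al f (g al)) /\
    y = (Num.sqrt (\sum_(al | (mlength al <= m)%N) nrm (g al) ^+ 2))%:E].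

Definition L2norm a b (f : fld a b) : \bar R :=
  if `[< L2 f >] then (nrm f)%:E else +oo%E.

(** ** Coefficients *)

(** [A] is the compliance tensor: the pointwise inverse of the stiffness tensor
    [C] on symmetric matrices and a positive multiple of the identity on skew
    ones. *)
Definition compliance (C A : pt -> 'M[R]_n -> 'M[R]_n) : Prop :=
  exists (As : pt -> 'M[R]_n -> 'M[R]_n) (a cmin cmax : R),
  [/\ 0 < a, 0 < cmin &
  [/\ (forall E, E^T = E -> forall i j,
         measurable_fun Om (fun x => C x E i j) /\
         measurable_fun Om (fun x => As x E i j)),
      (forall x, Om x -> forall k E F, E^T = E -> F^T = F ->
         [/\ C x (k *: E + F) = k *: C x E + C x F, (C x E)^T = C x E,
             frob (C x E) F = frob E (C x F) &
             cmin * frob E E <= frob (C x E) E <= cmax * frob E E]),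
      (forall x, Om x -> forall E, E^T = E ->
         [/\ (As x E)^T = As x E, As x (C x E) = E & C x (As x E) = E]) &
      (forall x, Om x -> forall X,
         A x X = As x (2^-1 *: (X + X^T)) + a *: (2^-1 *: (X - X^T)))]].

Definition conductivity (kappa : pt -> 'M[R]_n) : Prop :=
  exists cmin cmax : R, 0 < cmin /\
  forall i j, measurable_fun Om (fun x => kappa x i j) /\
  forall x, Om x -> (kappa x)^T = kappa x /\
    forall v : 'rV[R]_n,
      cmin * frob v v <= frob (v *m kappa x) v <= cmax * frob v v.

Definition bounded_coef (s : pt -> R) : Prop :=
  measurable_fun Om s /\ exists c, forall x, Om x -> `|s x| <= c.

Definition L2Anorm (A : pt -> 'M[R]_n -> 'M[R]_n) (f : fld n n) : \bar R :=
  if `[< L2 f >] then (Num.sqrt (ip (fun x => A x (f x)) f))%:E else +oo%E.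

Definition mulI (al : pt -> R) (p : fld 1 1) : fld n n :=
  fun x => (al x * p x ord0 ord0)%:M.

(** ** Time-dependent fields on J = [0, T] *)

Section in_time.
Variable T : R.

Definition C0 a b (X : set (fld a b)) (f : R -> fld a b) : Prop :=
  forall t, t \in `[0, T] -> X (f t) /\
  forall eps, 0 < eps -> exists2 del, 0 < del &
    forall s, s \in `[0, T] -> `|s - t| < del ->
      nrm (fun x => f s x - f t x) < eps.

Definition C1 a b (X : set (fld a b)) (f f' : R -> fld a b) : Prop :=
  [/\ C0 X f, C0 X f' & forall t, t \in `[0, T] ->
  forall eps, 0 < eps -> exists2 del, 0 < del &
    forall s, s \in `[0, T] -> 0 < `|s - t| < del ->
      nrm (fun x => (s - t)^-1 *: (f s x - f t x) - f' t x) < eps].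

Definition C0div a (X : set (fld a n)) (f : R -> fld a n) : Prop :=
  C0 X f /\ exists d, (forall t, t \in `[0, T] -> wdiv (f t) (d t)) /\
    C0 (@L2 a 1) d.

Definition C1div a (X : set (fld a n)) (f f' : R -> fld a n) : Prop :=
  C1 X f f' /\ exists d d',
    (forall t, t \in `[0, T] -> wdiv (f t) (d t) /\ wdiv (f' t) (d' t)) /\
    C1 (@L2 a 1) d d'.

(** The same equations give the variational problem, for the full spaces, and
    the semidiscrete problem, for the finite element spaces. *)
Definition biot_solution (A : pt -> 'M[R]_n -> 'M[R]_n) (al s0 : pt -> R)
    (kappa : pt -> 'M[R]_n)
    (Sg : set (fld n n)) (V : set (fld n 1)) (G : set (fld n n))
    (W : set (fld 1 n)) (Q : set (fld 1 1))
    (f : R -> fld n 1) (g : R -> fld 1 1)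
    (sg : R -> fld n n) (u : R -> fld n 1) (gm : R -> fld n n)
    (z : R -> fld 1 n) (p : R -> fld 1 1) : Prop :=
  exists (sg' : R -> fld n n) (p' : R -> fld 1 1),
  [/\ C1div Sg sg sg', C1 Q p p', C0 V u & C0 G gm] /\ C0div W z /\
  forall t, t \in `[0, T] ->
  [/\ (forall tau d, Sg tau -> wdiv tau d ->
         ip (fun x => A x (sg t x + mulI al (p t) x)) tau + ip (u t) d
           + ip (gm t) tau = 0),
      (forall v eta d, V v -> G eta -> wdiv (sg t) d ->
         ip d v + ip (sg t) eta = - ip (f t) v),
      (forall w d, W w -> wdiv w d ->
         ip (fun x => z t x *m (invmx (kappa x))^T) w + ip (p t) d = 0) &
      (forall q d, Q q -> wdiv (z t) d ->
         ip (fun x => s0 x *: p' t x) q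
           + ip (fun x => A x (sg' t x + mulI al (p' t) x)) (mulI al q)
           - ip d q = ip (g t) q)].

(** *** Bochner spaces

    [N] is the norm, with values in [\bar R], of a space X = {N < +oo} of
    fields. *)

Record step a b := Step {
  step_size : nat ;
  step_set : 'I_step_size -> set R ;
  step_val : 'I_step_size -> fld a b }.
Arguments step_set {a b} s k.
Arguments step_val {a b} s k.

Definition step_in a b (N : fld a b -> \bar R) (s : step a b) : Prop :=
  forall k, measurable (step_set s k) /\ (N (step_val s k) < +oo)%E.

Definition step_fun a b (s : step a b) (t : R) : fld a b :=
  fun x => \sum_k \1_(step_set s k) t *: step_val s k x.

Definition step_int a b (s : step a b) (D : set R) : fld a b :=
  fun x => \sum_k
    fine ((lebesgue_measure : set R -> \bar R) (D `&` step_set s k))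
      *: step_val s k x.

Definition strongly_measurable a b (N : fld a b -> \bar R) (D : set R)
    (f : R -> fld a b) : Prop :=
  exists s : nat -> step a b, (forall k, step_in N (s k)) /\
    {ae (@lebesgue_measure R), forall t, D t ->
       N (fun x => f t x - step_fun (s k) t x)%R @[k --> \oo] --> 0%E}.

Definition bochner_integral a b (N : fld a b -> \bar R) (D : set R)
    (f : R -> fld a b) (y : fld a b) : Prop :=
  strongly_measurable N D f /\
  exists s : nat -> step a b, [/\ forall k, step_in N (s k),
    (\int[lebesgue_measure]_(t in D)
       N (fun x => f t x - step_fun (s k) t x)%R)%E @[k --> \oo] --> 0%E &
    N (fun x => y x - step_int (s k) D x)%R @[k --> \oo] --> 0%E].

(** The norm of L^r(J; X), [+oo] for functions that are not in that space. *)
Definition Lr_norm a b (N : fld a b -> \bar R) (r : \bar R)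
    (f : R -> fld a b) : \bar R :=
  if `[< strongly_measurable N `[0, T] f >] then
    Lnorm (mrestr lebesgue_measure (measurable_itv `[0, T])) r (N \o f)
  else +oo%E.

(** [f'] is the weak time derivative of [f] in X; [f] is its own continuous
    representative. *)
Definition primitive a b (N : fld a b -> \bar R) (f f' : R -> fld a b) : Prop :=
  forall t, t \in `[0, T] ->
    bochner_integral N `[0, t] f' (fun x => f t x - f 0 x).

(** The norm of W^{1,r}(J; X). *)
Definition W1r_norm a b (N : fld a b -> \bar R) (r : \bar R)
    (f : R -> fld a b) : \bar R :=
  (Lr_norm N r f +
   ereal_inf [set y | exists2 f', primitive N f f' & y = Lr_norm N r f'])%E.

End in_time.

(** ** Meshes and finite element spaces *)

(** A simplex is given by its vertices, the rows of [K]. *)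
Definition face (K : 'M[R]_(n.+1, n)) (I : {set 'I_n.+1}) : set pt :=
  [set x | exists lam : 'rV[R]_n.+1,
    [/\ forall i, 0 <= lam ord0 i, forall i, i \notin I -> lam ord0 i = 0,
        \sum_i lam ord0 i = 1 & x = lam *m K]].

Definition simplex K : set pt := face K [set: 'I_n.+1]%SET.

Definition nondegenerate (K : 'M[R]_(n.+1, n)) : Prop :=
  forall (lam : 'rV[R]_n.+1), lam *m K = 0 -> \sum_i lam ord0 i = 0 -> lam = 0.

Definition diam (K : 'M[R]_(n.+1, n)) : R :=
  \big[Num.max/0]_i \big[Num.max/0]_j enorm (row i K - row j K).

(** Conforming simplicial meshes: two distinct simplices meet in a common proper
    (possibly empty) face. *)
Definition is_mesh (M : seq 'M[R]_(n.+1, n)) : Prop :=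
  [/\ forall K, K \in M -> nondegenerate K,
      closure Om = [set x | exists2 K, K \in M & simplex K x] &
      forall k l, (k < size M)%N -> (l < size M)%N -> k <> l ->
        exists I I' : {set 'I_n.+1},
        [/\ I != finset.setT, I' != finset.setT,
            simplex (nth 0 M k) `&` simplex (nth 0 M l) = face (nth 0 M k) I &
            face (nth 0 M k) I = face (nth 0 M l) I']].

Definition mesh_size (M : seq 'M[R]_(n.+1, n)) : R :=
  \big[Num.max/0]_(K <- M) diam K.

(** Every simplex contains a ball of diameter comparable with its own. *)
Definition regular_mesh (c : R) (M : seq 'M[R]_(n.+1, n)) : Prop :=
  forall K, K \in M -> exists (x0 : pt) (rho : R),
    [/\ 0 < rho, forall x, enorm (x - x0) <= rho -> simplex K x &
        diam K <= c * rho].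

End on_domain.
End fields.

(** Polynomials of degree at most [k] in [n] variables. *)
Definition polyfun {R : realType} n (k : nat) (f : 'rV[R]_n -> R) : Prop :=
  exists c : {ffun 'I_n -> 'I_k.+1} -> R,
    f = fun x => \sum_(a : {ffun 'I_n -> 'I_k.+1} | (\sum_i a i <= k)%N)
                   c a * \prod_i x ord0 i ^+ a i.

Definition polyfield {R : realType} n a b (k : nat)
    (f : 'rV[R]_n -> 'M[R]_(a, b)) : Prop :=
  forall i j, polyfun k (fun x => f x i j).

Section discretization.
Context {R : realType} {n : nat}.
Variable Om : set 'rV[R]_n.
Local Notation pt := 'rV[R]_n.
Local Notation fld a b := (pt -> 'M[R]_(a, b)).

Definition subspaceL2 a b (X : set (fld a b)) : Prop :=
  [/\ X `<=` @L2 _ _ Om a b, X (fun=> 0),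
      forall k f g, X f -> X g -> X (fun x => k *: f x + g x) &
      forall f g, X f -> L2 Om g -> f = g %[ae leb n in Om] -> X g].

(** Finite-dimensional spaces of piecewise polynomials of degree at most
    [deg]. *)
Definition fe_space (deg : nat) (M : seq 'M[R]_(n.+1, n)) a b
    (X : set (fld a b)) : Prop :=
  [/\ subspaceL2 X,
      (exists (N : nat) (B : 'I_N -> fld a b), (forall k, X (B k)) /\
         forall f, X f -> exists c : 'I_N -> R,
           f = (fun x => \sum_k c k *: B k x) %[ae leb n in Om]) &
      forall f, X f -> forall K, K \in M ->
        exists2 pol, polyfield deg pol &
          f = pol %[ae leb n in Om `&` simplex K]].

(** The local space of index [k] is [P_k^n + x P_k], for Raviart-Thomas in two
    dimensions and for the first kind Nedelec H(div) elements in three. *)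
Definition RT_local (k : nat) (w : fld 1 n) : Prop :=
  exists (v : fld 1 n) (s : pt -> R),
    [/\ polyfield k v, polyfun k s & w = fun x => v x + s x *: x].

Definition RT_space (k : nat) (M : seq 'M[R]_(n.+1, n)) : set (fld 1 n) :=
  [set w : fld 1 n | Hdiv Om w /\ forall K, K \in M ->
    exists2 rho, RT_local k rho & w = rho %[ae leb n in Om `&` simplex K]].

Definition DG_space (k : nat) (M : seq 'M[R]_(n.+1, n)) : set (fld 1 1) :=
  [set q : fld 1 1 | L2 Om q /\ forall K, K \in M ->
    exists2 pol, polyfield k pol & q = pol %[ae leb n in Om `&` simplex K]].

Definition ref_simplex d : set 'rV[R]_d :=
  [set s | (forall i, 0 <= s ord0 i) /\ \sum_i s ord0 i <= 1].

(** Affine parametrization, by the reference simplex of R^(n-1), of the face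
    opposite to vertex [j]; moments over faces are taken in this parameter,
    which only rescales them. *)
Definition face_point (K : 'M[R]_(n.+1, n)) (j : 'I_n.+1) (s : 'rV[R]_n.-1) : pt :=
  (\row_(i < n) (if i == 0%N :> nat then 1 - \sum_k s ord0 k
                 else \sum_(k < n.-1 | k.+1 == i) s ord0 k)) *m row' j K.

Definition face_normal (K : 'M[R]_(n.+1, n)) (j : 'I_n.+1) (nu : pt) : Prop :=
  forall i i', i != j -> i' != j -> frob (row i K - row i' K) nu = 0.

(** The canonical interpolation of a smooth field: normal face moments against
    P_k and interior moments against P_(k-1) are preserved. *)
Definition canonical_moments (k : nat) (M : seq 'M[R]_(n.+1, n))
    (w Iw : fld 1 n) : Prop :=
  forall K, K \in M -> exists rho : fld 1 n,
  [/\ RT_local k rho, Iw = rho %[ae leb n in Om `&` simplex K],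
      (forall j nu q, face_normal K j nu -> polyfun k q ->
         \int[leb n.-1]_(s in @ref_simplex n.-1)
            (frob (rho (face_point K j s) - w (face_point K j s)) nu * q s) = 0) &
      (forall l (v : fld 1 n), (l < k)%N -> polyfield l v ->
         \int[leb n]_(x in simplex K) frob (rho x - w x) (v x) = 0)].

Record discretization := Discretization {
  mesh : seq 'M[R]_(n.+1, n) ;
  Sigmah : set (fld n n) ;
  Vh : set (fld n 1) ;
  Gammah : set (fld n n) ;
  Wh : set (fld 1 n) ;
  Qh : set (fld 1 1) ;
  PV : fld n 1 -> fld n 1 ;
  PGamma : fld n n -> fld n n ;
  PQ : fld 1 1 -> fld 1 1 ;
  ISigma : fld n n -> fld n n ;
  IW : fld 1 n -> fld 1 n }.

Definition meshwidth (D : discretization) : R := mesh_size (mesh D).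

(** [P] is the L^2 projection onto [X]. *)
Definition L2_projection a b (X : set (fld a b)) (P : fld a b -> fld a b) : Prop :=
  forall f, L2 Om f -> X (P f) /\
    forall xi, X xi -> ip Om (fun x => f x - P f x) xi = 0.

(** The mixed elliptic projection defining [ISigma]. *)
Definition mixed_projection (D : discretization) : Prop :=
  forall sg d, Hdiv Om sg -> wdiv Om sg d ->
  Sigmah D (ISigma D sg) /\
  exists u gm, [/\ Vh D u, Gammah D gm,
    (forall tau dtau, Sigmah D tau -> wdiv Om tau dtau ->
       ip Om (ISigma D sg) tau + ip Om u dtau + ip Om gm tau = ip Om sg tau),
    (forall v dh, Vh D v -> wdiv Om (ISigma D sg) dh ->
       ip Om dh v = ip Om d v) &
    (forall eta, Gammah D eta -> ip Om (ISigma D sg) eta = ip Om sg eta)].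

(** The bounded map [Pi], defined on H^1, commutes with the divergence and has
    approximation errors at most [c h^m |.|_m] for [1 <= m <= r]. *)
Definition good_interpolation a (r : nat) (c h : R) (X : set (fld a n))
    (P : fld a 1 -> fld a 1) (Pi : fld a n -> fld a n) : Prop :=
  (forall k f g, (Hnorm Om 1 f < +oo)%E -> (Hnorm Om 1 g < +oo)%E ->
     Pi (fun x => k *: f x + g x) = (fun x => k *: Pi f x + Pi g x)
       %[ae leb n in Om]) /\
  forall f, (Hnorm Om 1 f < +oo)%E ->
  [/\ X (Pi f),
      (forall d, wdiv Om f d -> wdiv Om (Pi f) (P d)),
      (forall d, wdiv Om (Pi f) d ->
         ((nrmdiv Om (Pi f) d)%:E <= c%:E * Hnorm Om 1 f)%E) &
      forall m, (1 <= m <= r)%N ->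
        ((nrm Om (fun x => f x - Pi f x)%R)%:E <= (c * h ^+ m)%:E * Hnorm Om m f)%E].

End discretization.

(** * Families of discretizations *)

Section families.
Context {R : realType} {n : nat}.
Variable Om : set 'rV[R]_n.
Local Notation fld a b := ('rV[R]_n -> 'M[R]_(a, b)).
Variables (I : Type) (D : I -> @discretization R n).
Local Notation h i := (meshwidth (D i)).

(** The spaces [Xi i] approximate elements of [X] to order [k] in L^2. *)
Definition approximates a b (X : set (fld a b)) (Xi : I -> set (fld a b))
    (k : nat) : Prop :=
  exists2 c : R, 0 < c & forall i m f, (1 <= m <= k)%N -> X f ->
    (Hnorm Om m f < +oo)%E ->
    exists2 xi, Xi i xi &
      ((nrm Om (fun x => f x - xi x)%R)%:E <= (c * h i ^+ m)%:E * Hnorm Om m f)%E.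

Definition best_order a b (X : set (fld a b)) (Xi : I -> set (fld a b))
    (k : nat) : Prop :=
  approximates X Xi k /\ forall l, approximates X Xi l -> (l <= k)%N.

Definition S1 : Prop := forall i,
  [set d | exists2 tau, Sigmah (D i) tau & wdiv Om tau d] = Vh (D i) /\
  [set d | exists2 w, Wh (D i) w & wdiv Om w d] = Qh (D i).

Definition S2 (r : nat) : Prop :=
  exists2 c : R, 0 < c & forall i,
    (exists Pi, good_interpolation Om r c (h i) (Sigmah (D i)) (PV (D i)) Pi) /\
    (exists Pi, good_interpolation Om r c (h i) (Wh (D i)) (PQ (D i)) Pi).

Definition S3 : Prop :=
  exists2 c : R, 0 < c & forall i q, Qh (D i) q ->
    exists w, [/\ Wh (D i) w, wdiv Om w q & nrmdiv Om w q <= c * nrm Om q].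

Definition S4 : Prop :=
  exists2 c : R, 0 < c & forall i v eta, Vh (D i) v -> Gammah (D i) eta ->
    exists tau, [/\ Sigmah (D i) tau, wdiv Om tau v,
      forall eta', Gammah (D i) eta' -> ip Om tau eta' = ip Om eta eta' &
      nrmdiv Om tau v <= c * (nrm Om v + nrm Om eta)].

Definition finite_elements (r r' : nat) : Prop :=
  [/\ (exists c : R, forall i, is_mesh Om (mesh (D i)) /\ regular_mesh c (mesh (D i))),
      (exists deg, forall i,
         [/\ Sigmah (D i) `<=` @Hdiv _ _ Om n,
             Gammah (D i) `<=` skewL2 Om,
             fe_space Om deg (mesh (D i)) (Sigmah (D i)),
             fe_space Om deg (mesh (D i)) (Vh (D i)) &
             fe_space Om deg (mesh (D i)) (Gammah (D i))]),
      (forall i, Wh (D i) = RT_space Om r.-1 (mesh (D i)) /\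
                 Qh (D i) = DG_space Om r.-1 (mesh (D i))) &
      exists rS rG, [/\ best_order (@L2 _ _ Om n n) (fun i => Sigmah (D i)) rS,
        best_order (skewL2 Om) (fun i => Gammah (D i)) rG,
        minn rS rG = r &
        [/\ best_order (@L2 _ _ Om 1 n) (fun i => Wh (D i)) r,
            best_order (@L2 _ _ Om 1 1) (fun i => Qh (D i)) r &
            best_order (@L2 _ _ Om n 1) (fun i => Vh (D i)) r']]].

(** The canonical interpolation is determined by its moments on smooth fields
    and by its continuity on H^1, in which such fields are dense. *)
Definition interpolations (r : nat) : Prop :=
  (forall i, [/\ L2_projection Om (Vh (D i)) (PV (D i)),
     L2_projection Om (Gammah (D i)) (PGamma (D i)),
     L2_projection Om (Qh (D i)) (PQ (D i)),
     mixed_projection Om (D i) &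
     forall w : fld 1 n, (forall j, smooth (fun x => w x ord0 j)) ->
       canonical_moments Om r.-1 (mesh (D i)) w (IW (D i) w)]) /\
  exists2 c : R, 0 < c & forall i,
    good_interpolation Om r c (h i) (Wh (D i)) (PQ (D i)) (IW (D i)).

End families.

(** * Right-hand sides of the estimates

    The initial errors are also measured relative to them: an absolute bound by
    [h^m] cannot yield estimates that vanish with the exact solution. *)

Section bounds.
Context {R : realType} {n : nat}.
Variables (Om : set 'rV[R]_n) (T : R) (m : nat).
Local Notation fld a b := ('rV[R]_n -> 'M[R]_(a, b)).
Local Open Scope ereal_scope.

Definition W1r_norm3 (r : \bar R) (sg : R -> fld n n) (p : R -> fld 1 1)
    (gm : R -> fld n n) : \bar R :=
  W1r_norm T (@Hnorm _ _ Om m n n) r sg + W1r_norm T (@Hnorm _ _ Om m 1 1) r p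
    + W1r_norm T (@Hnorm _ _ Om m n n) r gm.

Definition bound_max (sg : R -> fld n n) (p : R -> fld 1 1)
    (gm : R -> fld n n) (z : R -> fld 1 n) : \bar R :=
  Order.max (W1r_norm3 1 sg p gm) (Lr_norm T (@Hnorm _ _ Om m 1 n) 2%:E z).

Definition bound_sum (sg : R -> fld n n) (p : R -> fld 1 1)
    (gm : R -> fld n n) (z : R -> fld 1 n) : \bar R :=
  W1r_norm3 2%:E sg p gm + W1r_norm T (@Hnorm _ _ Om m 1 n) 1 z.

End bounds.

(* Main.v *)
From HB Require Import structures.
From mathcomp Require Import all_boot all_order all_algebra.
From mathcomp Require Import all_classical all_reals all_analysis.
From mathcomp Require Import measurable_realfun ess_sup_inf.
From mathcomp Require Import ring lra.
Require Import Defs.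
Set Implicit Arguments.
Unset Strict Implicit.
Unset Printing Implicit Defensive.
Import Order.TTheory GRing.Theory Num.Theory.
Import numFieldNormedType.Exports.
Local Open Scope classical_set_scope.
Local Open Scope ring_scope.

(** Let e = (e_sigma, e_p) and B(e, e) = |e_sigma + alpha e_p I|_A^2 + (s_0 e_p, e_p).
    Subtract the error equations at two times t < s, take the mass balance at
    s only, and test with a discrete pair x = (tau, q) such that div tau = 0
    and tau is orthogonal to Gamma_h: up to o(s - t),

      B(e(s) - e(t), x) = (s - t) (D(s), q) + O(|delta|) B(x, x)^(1/2),

    where D is the divergence of the flux error and delta the increment of the
    interpolation errors, at most h^m times the integral of the H^m norms of
    the time derivatives over [t, s].
    For x = e(s), Darcy's law bounds (D, e_p) by the square of the
    interpolation error of z, which gives the bound of e in the norm B.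
    For x = e(s) - e(t), Young's inequality bounds - (D(s), e_p(s) - e_p(t)),
    hence the growth of |e_z|^2, by |delta|^2 / (s - t), that is by h^(2m) times
    the integral of the squares of the same norms.
    The condition (S4) then yields e_u and e_gamma, and (S3) yields e_p without
    using s_0 > 0; e_sigma is the difference of e_sigma + alpha e_p I and
    alpha e_p I. *)

(** * Positive semidefinite forms *)

Section forms.
Context {R : realType}.

(** The fluxes are only assumed continuous in time, so Darcy's law is not differentiated: all
    estimates compare two times, and derivatives of interpolation errors are replaced by increments
    of nondecreasing functions such as [Phi]. Classical time derivatives enter only through the mass
    balance at the later time. Since s_0 may vanish, B does not control e_p. The interpolation error
    of gamma is therefore paired with tau + alpha q I, whose norm B controls, and not with tau
    alone; this is allowed because skew matrices are orthogonal to multiples of the identity. No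
    Gronwall inequality is used: where a bound contains the square root of the energy, this root is
    replaced by its maximum over J, and the resulting quadratic inequality for the maximum is
    solved. Fields are functions and not classes, so inner products are only semidefinite, and
    projections are determined up to null sets; relations stable under differences replace their
    linearity. The infima defining the norms need not be attained: bounds are first proved up to an
    arbitrary [e > 0]. *)

Record form (V : lmodType R) := Form {
  form_fun :> V -> V -> R ;
  formC : forall x y, form_fun x y = form_fun y x ;
  form_linear : forall k x y z,
    form_fun (k *: x + y) z = k * form_fun x z + form_fun y z ;
  form_ge0 : forall x, 0 <= form_fun x x }.

Section theory.
Context {V : lmodType R} (B : form V).
Implicit Types x y z : V.

Lemma formDl x y z : B (x + y) z = B x z + B y z.
Proof. by rewrite -{1}[x]scale1r form_linear mul1r. Qed.

Lemma form0l z : B 0 z = 0.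
Proof. by apply: (addrI (B 0 z)); rewrite addr0 -formDl addr0. Qed.

Lemma formZl k x z : B (k *: x) z = k * B x z.
Proof. by rewrite -[k *: x]addr0 form_linear form0l addr0. Qed.

Lemma formNl x z : B (- x) z = - B x z.
Proof. by rewrite -scaleN1r formZl mulN1r. Qed.

Lemma formBl x y z : B (x - y) z = B x z - B y z.
Proof. by rewrite formDl formNl. Qed.

Lemma formDr x y z : B z (x + y) = B z x + B z y.
Proof. by rewrite !(formC B z) formDl. Qed.

Lemma form0r z : B z 0 = 0.
Proof. by rewrite formC form0l. Qed.

Lemma formZr k x z : B z (k *: x) = k * B z x.
Proof. by rewrite !(formC B z) formZl. Qed.

Lemma formNr x z : B z (- x) = - B z x.
Proof. by rewrite !(formC B z) formNl. Qed.

Lemma formBr x y z : B z (x - y) = B z x - B z y.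
Proof. by rewrite formDr formNr. Qed.

Definition formE := (formDl, formDr, formBl, formBr, formNl, formNr, formZl,
  formZr, form0l, form0r).

Lemma form_CS2 x y : B x y ^+ 2 <= B x x * B y y.
Proof.
have h k : 0 <= B x x + 2 * k * B x y + k ^+ 2 * B y y.
  have := form_ge0 B (x + k *: y); rewrite !formE (formC B y x) => /le_trans; apply.
  by lra.
have [y0|] := eqVneq (B y y) 0.
  (* The form may be degenerate. The polynomial in [h] is then affine in [k], and the value chosen
     below would make it equal to -1. *)
  have [->|xy0] := eqVneq (B x y) 0; first by rewrite y0 mulr0 expr0n.
  have := h (- (B x x + 1) / (2 * B x y)); rewrite y0 mulr0 addr0.
  rewrite (_ : 2 * _ * _ = - (B x x + 1)); first lra.
  by field.
move=> y0; have yp : 0 < B y y by rewrite lt_def y0 form_ge0.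
have := h (- B x y / B y y).
rewrite (_ : _ + _ = (B x x * B y y - B x y ^+ 2) / B y y); last by field.
by rewrite pmulr_lge0 ?invr_gt0// subr_ge0.
Qed.

Definition fnorm x := Num.sqrt (B x x).

Lemma fnorm_ge0 x : 0 <= fnorm x. Proof. exact: sqrtr_ge0. Qed.

Lemma sqr_fnorm x : fnorm x ^+ 2 = B x x.
Proof. by rewrite sqr_sqrtr// form_ge0. Qed.

Lemma form_CS x y : `|B x y| <= fnorm x * fnorm y.
Proof.
rewrite -(ler_pXn2r (n := 2))// ?nnegrE ?mulr_ge0 ?fnorm_ge0//.
by rewrite exprMn !sqr_fnorm -normrX ger0_norm ?sqr_ge0// form_CS2.
Qed.

Lemma form_leCS x y : B x y <= fnorm x * fnorm y.
Proof. exact: le_trans (ler_norm _) (form_CS x y). Qed.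

Lemma form_geCS x y : - (fnorm x * fnorm y) <= B x y.
Proof. by rewrite lerNl; apply: le_trans (form_CS x y); rewrite -normrN ler_norm. Qed.

Lemma fnormZ k x : fnorm (k *: x) = `|k| * fnorm x.
Proof.
by rewrite /fnorm !formE mulrA -expr2 sqrtrM ?sqr_ge0// sqrtr_sqr.
Qed.

Lemma fnormN x : fnorm (- x) = fnorm x.
Proof. by rewrite /fnorm !formE opprK. Qed.

Lemma fnorm0 : fnorm 0 = 0.
Proof. by rewrite /fnorm form0l sqrtr0. Qed.

Lemma ler_fnormD x y : fnorm (x + y) <= fnorm x + fnorm y.
Proof.
rewrite -(ler_pXn2r (n := 2))// ?nnegrE ?addr_ge0 ?fnorm_ge0//.
rewrite sqrrD !sqr_fnorm !formE (formC B y x).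
by have := form_leCS x y; lra.
Qed.

Lemma ler_fnormB x y : fnorm (x - y) <= fnorm x + fnorm y.
Proof. by rewrite -(fnormN y) ler_fnormD. Qed.

Lemma fnorm_eq0_form x y : fnorm x = 0 -> B x y = 0.
Proof. by move=> x0; have := form_CS x y; rewrite x0 mul0r normr_le0 => /eqP. Qed.

(** One half of Pythagoras' theorem, with which the best approximation arguments below end. *)
Lemma fnorm_orth x y : B x y = 0 -> fnorm x <= fnorm (x + y).
Proof.
by move=> o; rewrite ler_wsqrtr// !formE (formC B y) o addr0 add0r lerDl form_ge0.
Qed.

(* Convexity: the second-order term is dropped by testing at the later point. *)
Lemma form_diff_le x y : B x x - B y y <= 2 * B (x - y) x.
Proof. by have := form_ge0 B (x - y); rewrite !formE (formC B y x); lra. Qed.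

End theory.

End forms.

(** * Lebesgue measure on R^n *)

Section lebesgue_space.
Context {R : realType}.

Definition cube n (q : 'I_n -> R) (e : R) : set 'rV[R]_n :=
  [set x | forall i, `|q i - coord i x| < e].

Lemma measurable_cube n (q : 'I_n -> R) e : measurable (cube q e).
Proof.
have -> : cube q e =
    \bigcap_(i in [set: 'I_n]) (@coord R n i @^-1` `]q i - e, q i + e[).
  apply/seteqP; split => x /= h.
    by move=> i _; have := h i; rewrite /= in_itv/= ltr_norml; lra.
  by move=> i; have := h i Logic.I; rewrite /= in_itv/= ltr_norml; lra.
apply: fin_bigcap_measurable; first exact: finite_finset.
by move=> i _; rewrite -[_ @^-1` _]setTI; exact: measurable_coord.
Qed.

Lemma bigcup_countType_measurable d (T : measurableType d) (I : countType)
    (F : I -> set T) : (forall i, measurable (F i)) ->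
  measurable (\bigcup_i F i).
Proof.
move=> mF.
have -> : \bigcup_i F i = \bigcup_k (if unpickle k is Some i then F i else set0).
  apply/seteqP; split => x /=.
    by move=> [i _ Fi]; exists (pickle i) => //; rewrite pickleK.
  by move=> [k _]; case: unpickle => // i Fi; exists i.
by apply: bigcupT_measurable => k; case: unpickle.
Qed.

(** The sigma-algebra is generated by the coordinates and not by the open sets. Balls of the maximum
    norm are cubes, and the countably many cubes with rational data that lie in [U] cover it. *)
Lemma open_measurable_rV n (U : set 'rV[R]_n) : open U -> measurable U.
Proof.
move=> oU.
pose F (q : {ffun 'I_n -> rat} * rat) : set 'rV[R]_n :=
  if `[< cube (fun i => ratr (q.1 i)) (ratr q.2) `<=` U >]
  then cube (fun i => ratr (q.1 i)) (ratr q.2) else set0.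
have -> : U = \bigcup_q F q.
  apply/seteqP; split => x; last first.
    by move=> [q _]; rewrite /F; case: asboolP => // + h; apply.
  move=> Ux; move: oU; rewrite openE => /(_ _ Ux)/nbhs_ballP[e /= e0 eU].
  (* Two steps shorter than [ratr r], from [x] to the rational center and from there to [y], stay
     below [e]. *)
  have [r] := @rat_in_itvoo R (e / 4) (e / 2) ltac:(lra).
  rewrite in_itv /= => /andP[er re].
  have hq i : {q : rat | `|ratr q - coord i x| < ratr r}.
    apply: cid; have [q] := @rat_in_itvoo R (coord i x) (coord i x + ratr r) ltac:(lra).
    rewrite in_itv /= => /andP[h1 h2]; exists q; rewrite ger0_norm; lra.
  exists ([ffun i => projT1 (hq i)], r) => //; rewrite /F; case: asboolP => /=.
    by move=> _ i; rewrite ffunE; case: (hq i).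
  case=> y hy; apply: eU; split => // i j.
  rewrite -ball_normE /= ord1.
  have := hy j; rewrite ffunE; case: (hq j) => /= q.
  rewrite /coord => h1 h2.
  have := ler_distD (ratr q) (x ord0 j) (y ord0 j).
  rewrite (distrC (x ord0 j) (ratr q)); lra.
apply: bigcup_countType_measurable => q; rewrite /F; case: asboolP => _ //.
exact: measurable_cube.
Qed.

Lemma continuous_measurable_rV n (f : 'rV[R]_n -> R) (D : set 'rV[R]_n) :
  measurable D -> continuous f -> measurable_fun D f.
Proof.
move=> mD /continuousP cf.
apply: (measurability _ (RGenOpens.measurableE R)) => //.
move=> _ [_ [a [b ->] <-]]; apply: measurableI => //.
by apply: open_measurable_rV; apply: cf; exact: interval_open.
Qed.

Definition box n (M : R) : set 'rV[R]_n := [set x | forall i, `|coord i x| <= M].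

Lemma measurable_box n M : measurable (@box n M).
Proof.
have -> : @box n M = \bigcap_(i in [set: 'I_n]) (@coord R n i @^-1` `[- M, M]).
  apply/seteqP; split => x /= h.
    by move=> i _; rewrite /= in_itv/= -ler_norml; exact: h.
  by move=> i; have := h i Logic.I; rewrite /= in_itv/= -ler_norml.
apply: fin_bigcap_measurable; first exact: finite_finset.
move=> i _; rewrite -[_ @^-1` _]setTI; apply: measurable_coord => //.
Qed.

Lemma leb_box n M : (leb n (@box n M) < +oo)%E.
Proof.
elim: n => [|n IH].
  by rewrite /= /dirac /= indicE; case: (_ \in _); rewrite ltry.
rewrite /= /pushforward.
rewrite (_ : _ @^-1` _ = @box n M `*` `[- M, M]).
  rewrite product_measure1E//; last exact: measurable_box.
  have h : (@lebesgue_measure R `[(- M)%R, M] < +oo)%E.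
    by rewrite lebesgue_measure_itv; case: ifP => _; rewrite ltry.
  by apply: lte_mul_pinfty => //=; rewrite ge0_fin_numE.
apply/seteqP; split => -[x t] /=.
  move=> h; split.
    move=> i; have := h (lift ord0 i).
    by rewrite /coord mxE liftK.
  by have := h ord0; rewrite /coord mxE unlift_none /= in_itv/= -ler_norml.
move=> [h1 h2] i; rewrite /coord mxE; case: unliftP => [j _|_] /=.
  exact: h1.
by rewrite ler_norml; move: h2; rewrite in_itv.
Qed.

Lemma leb_bounded n (A : set 'rV[R]_n) : measurable A -> bounded_set A ->
  (leb n A < +oo)%E.
Proof.
move=> mA [M [_ hM]]; apply: le_lt_trans (@leb_box n (M + 1)).
apply: le_measure; rewrite ?inE//; first exact: measurable_box.
move=> x Ax i; have := hM (M + 1) ltac:(lra) x Ax; apply: le_trans.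
by rewrite /coord [leRHS]/Num.norm /= mx_normrE; apply/bigmax_geP; right => /=;
  exists (ord0, i).
Qed.

End lebesgue_space.

(** * The space of square-integrable fields *)

Section frobenius.
Context {R : realType} {a b : nat}.
Implicit Types X Y Z : 'M[R]_(a, b).

Lemma frobC X Y : frob X Y = frob Y X.
Proof. by apply: eq_bigr => i _; apply: eq_bigr => j _; rewrite mulrC. Qed.

Lemma frob_linear k X Y Z : frob (k *: X + Y) Z = k * frob X Z + frob Y Z.
Proof.
rewrite /frob mulr_sumr -big_split /=; apply: eq_bigr => i _.
rewrite mulr_sumr -big_split /=; apply: eq_bigr => j _.
by rewrite !mxE mulrDl mulrA.
Qed.

Lemma frob_ge0 X : 0 <= frob X X.
Proof. by apply: sumr_ge0 => i _; apply: sumr_ge0 => j _; rewrite -expr2 sqr_ge0. Qed.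

Definition frobF : form 'M[R]_(a, b) := Form frobC frob_linear frob_ge0.

Lemma frobE X Y : frob X Y = frobF X Y. Proof. by []. Qed.

Lemma frob_sqr_entry X i j : X i j ^+ 2 <= frob X X.
Proof.
rewrite /frob (bigD1 i)//= (bigD1 j)//= -expr2 -addrA lerDl.
by apply: addr_ge0; apply: sumr_ge0 => k _; rewrite -?expr2 ?sqr_ge0//;
  apply: sumr_ge0 => l _; rewrite -expr2 sqr_ge0.
Qed.

Lemma frob_eq0 X : frob X X = 0 -> X = 0.
Proof.
move=> X0; apply/matrixP => i j; rewrite mxE; apply/eqP.
by rewrite -sqrf_eq0 eq_le sqr_ge0 -X0 frob_sqr_entry.
Qed.

End frobenius.
Arguments frobF {R a b}.

Structure domain {R : realType} n := Domain {
  dom :> set 'rV[R]_n ;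
  dom_measurable : measurable dom ;
  dom_finite : (leb n dom < +oo)%E ;
  dom_bounded : bounded_set dom }.

Section L2_space.
Context {R : realType} {n : nat} (Om : @domain R n).
Local Notation fld a b := ('rV[R]_n -> 'M[R]_(a, b)).
Local Notation mu := (leb n).
Let mOm : measurable Om := dom_measurable Om.

Definition mentries a b (f : fld a b) : Prop :=
  forall i j, measurable_fun Om (fun x => f x i j).

Lemma mentries_linear a b (f g : fld a b) k :
  mentries f -> mentries g -> mentries (k *: f + g).
Proof.
move=> mf mg i j.
rewrite (_ : (fun _ => _) = (fun x => k * f x i j + g x i j)); last first.
  by apply/funext => x; rewrite !mxE.
by apply: measurable_funD => //; apply: measurable_funM.
Qed.

Lemma measurable_frob a b (f g : fld a b) : mentries f -> mentries g ->
  measurable_fun Om (fun x => frob (f x) (g x)).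
Proof.
move=> mf mg; apply: measurable_sum => i; apply: measurable_sum => j.
exact: measurable_funM.
Qed.

Lemma L2P a b (f : fld a b) : L2 Om f <->
  mentries f /\ mu.-integrable Om (fun x => (frob (f x) (f x))%:E).
Proof.
have e : (\int[mu]_(x in Om) `|(frob (f x) (f x))%:E| =
    \int[mu]_(x in Om) (frob (f x) (f x))%:E)%E.
  by apply: eq_integral => x _; rewrite gee0_abs// lee_fin frob_ge0.
split=> -[mf h]; split => //.
  apply/integrableP; split; last by rewrite e.
  by apply/measurable_EFinP; exact: measurable_frob.
by move/integrableP : h => [_]; rewrite e.
Qed.

Lemma integrable_frob a b (f g : fld a b) : L2 Om f -> L2 Om g ->
  mu.-integrable Om (fun x => (frob (f x) (g x))%:E).
Proof.
move=> /L2P[mf if_] /L2P[mg ig].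
apply: (le_integrable mOm _ _ (integrableD mOm if_ ig)).
  by apply/measurable_EFinP; exact: measurable_frob.
move=> x _ /=; rewrite lee_fin ler_norml.
have := frob_ge0 (f x - g x); have := frob_ge0 (f x + g x).
rewrite !frobE !formE (formC frobF (g x)) ger0_norm; last first.
  by rewrite addr_ge0// form_ge0.
have := form_ge0 frobF (f x); have := form_ge0 frobF (g x); lra.
Qed.

Lemma L2_dominated a b (f : fld a b) c d (g : fld c d) k : mentries f ->
  (forall x, dom Om x -> frob (f x) (f x) <= k * frob (g x) (g x)) ->
  L2 Om g -> L2 Om f.
Proof.
move=> mf h Lg; apply/L2P; split => //.
have /L2P[mg ig] := Lg.
have := integrableZl mOm k ig; apply: le_integrable => //.
  by apply/measurable_EFinP; exact: measurable_frob.
move=> x Ox /=; rewrite lee_fin ger0_norm ?frob_ge0//.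
by rewrite (le_trans (h x Ox))// ler_norm.
Qed.

Lemma L2_submod a b :
  submod_closed (fun f : fld a b => `[< L2 Om f >] : bool).
Proof.
split=> [|k f g /asboolP Lf /asboolP Lg].
  apply/asboolP/L2P; split.
    by move=> i j; rewrite (_ : (fun _ => _) = cst 0)//; apply/funext => x; rewrite !mxE.
  rewrite (_ : (fun _ => _) = cst 0%E); first exact: integrable0.
  by apply/funext => x; rewrite frobE formE.
apply/asboolP/L2P; have /L2P[mf if_] := Lf; have /L2P[mg ig] := Lg.
have mfg := mentries_linear k mf mg.
split => //.
have iZ := integrableZl mOm (2 * k ^+ 2) if_.
have := integrableD mOm iZ (integrableZl mOm 2 ig).
apply: le_integrable => //.
  by apply/measurable_EFinP; exact: measurable_frob.
move=> x _ /=; rewrite lee_fin ger0_norm ?frob_ge0//; apply: le_trans (ler_norm _).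
have := frob_ge0 (k *: f x - g x).
rewrite !frobE !formE (formC frobF (g x)); lra.
Qed.

Definition l2_pred a b : {pred fld a b} := fun f => `[< L2 Om f >].
HB.instance Definition _ a b :=
  GRing.isSubmodClosed.Build R (fld a b) (@l2_pred a b) (@L2_submod a b).

(** Functions rather than classes: the [L^2] product is only semidefinite on this module, which is
    why [form] does not ask for definiteness. *)
Record l2 a b := L2Field { l2_fun :> fld a b ; l2P : l2_fun \in @l2_pred a b }.
HB.instance Definition _ a b := [isSub of l2 a b for @l2_fun a b].
HB.instance Definition _ a b := [Choice of l2 a b by <:].
HB.instance Definition _ a b := [SubChoice_isSubLmodule of l2 a b by <:].

Lemma l2_L2 a b (f : l2 a b) : L2 Om f.
Proof. by case: f => f /= /asboolP. Qed.

(* Junk value [0] outside L^2. *)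
Definition tol2 a b (f : fld a b) : l2 a b := insubd (0 : l2 a b) f.

Lemma tol2E a b (f : fld a b) : L2 Om f -> tol2 f = f :> fld a b.
Proof. by move=> Lf; rewrite /tol2 insubdK//; apply/asboolP. Qed.

Lemma tol2_linear a b (f g : fld a b) k : L2 Om f -> L2 Om g ->
  tol2 (k *: f + g) = k *: tol2 f + tol2 g.
Proof.
move=> Lf Lg; apply: val_inj; rewrite /= !tol2E//.
exact/asboolP/(L2_submod a b).2/asboolP/Lg/asboolP.
Qed.

Lemma L2_linear a b (f g : fld a b) k : L2 Om f -> L2 Om g -> L2 Om (k *: f + g).
Proof. by move=> /asboolP Lf /asboolP Lg; apply/asboolP/(L2_submod a b).2. Qed.

Lemma L2_0 a b : L2 Om (0 : fld a b).
Proof. exact/asboolP/(L2_submod a b).1. Qed.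

Lemma tol20 a b : tol2 (0 : fld a b) = 0.
Proof. by apply: val_inj; rewrite /= tol2E//; exact: L2_0. Qed.

Lemma L2B a b (f g : fld a b) : L2 Om f -> L2 Om g -> L2 Om (f - g).
Proof. by move=> Lf Lg; rewrite addrC -scaleN1r; exact: L2_linear. Qed.

Lemma tol2B a b (f g : fld a b) : L2 Om f -> L2 Om g ->
  tol2 (f - g) = tol2 f - tol2 g.
Proof.
by move=> Lf Lg; rewrite addrC -scaleN1r tol2_linear// scaleN1r addrC.
Qed.

Lemma tol2D a b (f g : fld a b) : L2 Om f -> L2 Om g ->
  tol2 (f + g) = tol2 f + tol2 g.
Proof. by move=> Lf Lg; rewrite -(scale1r f) tol2_linear// !scale1r. Qed.

Lemma tol2_fun a b (f : l2 a b) : tol2 f = f.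
Proof. by apply: val_inj; rewrite /= tol2E//; exact: l2_L2. Qed.

Lemma RintegralE_lin (f g : 'rV[R]_n -> R) k :
  mu.-integrable Om (EFin \o f) -> mu.-integrable Om (EFin \o g) ->
  \int[mu]_(x in Om) (k * f x + g x) =
    k * \int[mu]_(x in Om) f x + \int[mu]_(x in Om) g x.
Proof.
move=> if_ ig; rewrite RintegralD//; first by rewrite RintegralZl.
exact: (integrableZl mOm k if_).
Qed.

Lemma ip_linear a b (f g h : fld a b) k : L2 Om f -> L2 Om g -> L2 Om h ->
  ip Om (k *: f + g) h = k * ip Om f h + ip Om g h.
Proof.
move=> Lf Lg Lh; rewrite -RintegralE_lin; try exact: integrable_frob.
by apply: eq_Rintegral => x _; rewrite frob_linear.
Qed.

Lemma l2_ipC a b (f g : l2 a b) : ip Om f g = ip Om g f.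
Proof. by apply: eq_Rintegral => x _; rewrite frobC. Qed.

Lemma l2_ip_linear a b k (f g h : l2 a b) :
  ip Om (k *: f + g) h = k * ip Om f h + ip Om g h.
Proof. by apply: ip_linear; exact: l2_L2. Qed.

Lemma l2_ip_ge0 a b (f : l2 a b) : 0 <= ip Om f f.
Proof. by apply: Rintegral_ge0 => x _; exact: frob_ge0. Qed.

Definition ipF {a b} : form (l2 a b) :=
  Form (@l2_ipC a b) (@l2_ip_linear a b) (@l2_ip_ge0 a b).

(* [coef] is only linear on [Om]: hence a form, and not an operator on fields. *)
Structure coefficient a b := Coefficient {
  coef :> 'rV[R]_n -> 'M[R]_(a, b) -> 'M[R]_(a, b) ;
  coef_hi : R ;
  coef_hi0 : 0 <= coef_hi ;
  coef_measurable : forall X, mentries (fun x => coef x X) ;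
  coef_linear : forall x k X Y, dom Om x ->
    coef x (k *: X + Y) = k *: coef x X + coef x Y ;
  coef_sym : forall x X Y, dom Om x -> frob (coef x X) Y = frob X (coef x Y) ;
  coef_ge0 : forall x X, dom Om x -> 0 <= frob (coef x X) X ;
  coef_le : forall x X, dom Om x -> frob (coef x X) X <= coef_hi * frob X X }.

Section coef_form.
Context {a b : nat} (A : coefficient a b).

(** Symmetry turns the bound on the quadratic form into one on the operator: Cauchy-Schwarz for the
    form of [A x], at the pair [X], [A x X], bounds the fourth power of the norm of [A x X]. *)
Lemma coef_sqr_le x X : dom Om x ->
  frob (A x X) (A x X) <= coef_hi A ^+ 2 * frob X X.
Proof.
move=> Ox.
have sy Y Z : frob (A x Y) Z = frob (A x Z) Y by rewrite coef_sym// frobC.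
have li k Y Z W : frob (A x (k *: Y + Z)) W = k * frob (A x Y) W + frob (A x Z) W.
  by rewrite coef_linear// frob_linear.
pose F := Form sy li (fun Y => coef_ge0 A Y Ox).
have h1 : frob (A x X) (A x X) ^+ 2 <= frob (A x X) X * frob (A x (A x X)) (A x X).
  exact: (form_CS2 F X (A x X)).
have h2 := coef_le A (A x X) Ox; have h3 := coef_le A X Ox.
have h4 := frob_ge0 (A x X); have h5 := coef_hi0 A; have h6 := frob_ge0 X.
have h7 := coef_ge0 A X Ox; have h8 := coef_ge0 A (A x X) Ox.
set q := frob (A x X) (A x X) in h1 h2 h4 *.
have [->|q0] := eqVneq q 0; first by rewrite mulr_ge0 ?sqr_ge0.
have qp : 0 < q by rewrite lt_def q0.
rewrite -(ler_pM2r qp) -expr2 (le_trans h1)//.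
by apply: le_trans (ler_pM h7 h8 h3 h2) _; rewrite expr2 mulrACA mulrA.
Qed.

Lemma mentries_coef (f : fld a b) : mentries f -> mentries (fun x => A x (f x)).
Proof.
move=> mf i j.
(* Measurability is assumed for constant arguments only; expanding the argument in the matrix basis
   reduces to this case. *)
have eA x X : dom Om x -> A x X = \sum_k \sum_l X k l *: A x (delta_mx k l).
  move=> Ox.
  have A0 : A x 0 = 0.
    by have := coef_linear A 1 0 0 Ox; rewrite !scale1r addr0 => /eqP;
      rewrite -subr_eq0 opprD addrA subrr sub0r oppr_eq0 => /eqP.
  have AD : {morph A x : Y Z / Y + Z >-> Y + Z}.
    by move=> Y Z; have := coef_linear A 1 Y Z Ox; rewrite !scale1r.
  have AZ k : {morph A x : Y / k *: Y >-> k *: Y}.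
    by move=> Y; have := coef_linear A k Y 0 Ox; rewrite A0 !addr0.
  rewrite {1}[X]matrix_sum_delta (big_morph _ AD A0); apply: eq_bigr => k _.
  by rewrite (big_morph _ AD A0); apply: eq_bigr => l _; rewrite AZ.
apply: (@eq_measurable_fun _ _ _ _ _
  (fun x => \sum_k \sum_l f x k l * A x (delta_mx k l) i j)).
  move=> x; rewrite inE => Ox; rewrite eA// summxE; apply: eq_bigr => k _.
  by rewrite summxE; apply: eq_bigr => l _; rewrite mxE.
apply: measurable_sum => k; apply: measurable_sum => l.
by apply: measurable_funM => //; exact: coef_measurable.
Qed.

Lemma L2_coef (f : fld a b) : L2 Om f -> L2 Om (fun x => A x (f x)).
Proof.
move=> Lf; apply: (L2_dominated _ _ Lf).
  by apply: mentries_coef; case/L2P: Lf.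
by move=> x Ox; exact: coef_sqr_le.
Qed.

Definition coef_ip (f g : l2 a b) : R := ip Om (fun x => A x (f x)) g.

Lemma coef_ipC f g : coef_ip f g = coef_ip g f.
Proof.
by apply: eq_Rintegral => x; rewrite inE => Ox; rewrite coef_sym// frobC.
Qed.

Lemma coef_ip_linear k f g h :
  coef_ip (k *: f + g) h = k * coef_ip f h + coef_ip g h.
Proof.
have L := fun f : l2 a b => L2_coef (l2_L2 f).
have := ip_linear k (L f) (L g) (l2_L2 h); rewrite /coef_ip => <-.
by apply: eq_Rintegral => x; rewrite inE => Ox; rewrite coef_linear.
Qed.

Lemma coef_ip_ge0 f : 0 <= coef_ip f f.
Proof. by apply: Rintegral_ge0 => x Ox; exact: coef_ge0. Qed.

Definition coefF : form (l2 a b) := Form coef_ipC coef_ip_linear coef_ip_ge0.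

Lemma coefF_le f : coefF f f <= coef_hi A * ipF f f.
Proof.
rewrite -RintegralZl//; last by apply: integrable_frob; exact: l2_L2.
apply: le_Rintegral => //.
- by apply: integrable_frob; [apply: L2_coef|]; exact: l2_L2.
- exact: (integrableZl mOm (coef_hi A) (integrable_frob (l2_L2 f) (l2_L2 f))).
- by move=> x Ox; exact: coef_le.
Qed.

Lemma coefF_ge lo f : (forall x X, dom Om x -> lo * frob X X <= frob (A x X) X) ->
  lo * ipF f f <= coefF f f.
Proof.
move=> hlo; rewrite -RintegralZl//; last by apply: integrable_frob; exact: l2_L2.
apply: le_Rintegral => //.
- exact: (integrableZl mOm lo (integrable_frob (l2_L2 f) (l2_L2 f))).
- by apply: integrable_frob; [apply: L2_coef|]; exact: l2_L2.
- by move=> x Ox; exact: hlo.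
Qed.

End coef_form.

End L2_space.
Arguments ipF {R n Om a b}.
Arguments tol2 {R n} Om {a b}.

(** * Weak derivatives and Sobolev norms *)

Section eseminorm.
Context {R : realType} {V : lmodType R}.

Record eseminorm (N : V -> \bar R) : Prop := Eseminorm {
  eseminorm0 : N 0 = 0%E ;
  eseminorm_ge0 : forall f, (0 <= N f)%E ;
  eseminorm_linear : forall k f g, (N f < +oo)%E -> (N g < +oo)%E ->
    (N (k *: f + g)%R <= `|k|%:E * N f + N g)%E }.

Context {N : V -> \bar R} (sN : eseminorm N).

Lemma eseminormD f g : (N (f + g)%R <= N f + N g)%E.
Proof.
have [foo|] := ltP (N f) +oo%E; last first.
  by rewrite leye_eq => /eqP ->; rewrite addye ?leey// gt_eqF// (lt_le_trans _ (eseminorm_ge0 sN _)).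
have [goo|] := ltP (N g) +oo%E; last first.
  by rewrite leye_eq => /eqP ->; rewrite addey ?leey// gt_eqF// (lt_le_trans _ (eseminorm_ge0 sN _)).
by have := eseminorm_linear sN 1 foo goo; rewrite scale1r normr1 mul1e.
Qed.

Lemma eseminormZ k f : (N f < +oo)%E -> (N (k *: f)%R <= `|k|%:E * N f)%E.
Proof.
move=> foo; have := eseminorm_linear sN k foo (g := 0).
by rewrite (eseminorm0 sN) addr0 adde0; apply; rewrite ltry.
Qed.

Lemma eseminormN f : N (- f)%R = N f.
Proof.
have h g : (N (- g)%R <= N g)%E.
  have [goo|] := ltP (N g) +oo%E; last by rewrite leye_eq => /eqP ->; rewrite leey.
  by have := eseminormZ (-1) goo; rewrite scaleN1r normrN normr1 mul1e.
by apply/eqP; rewrite eq_le h/= -{1}[f]opprK h.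
Qed.

Lemma eseminormB f g : (N (f - g)%R <= N f + N g)%E.
Proof. by rewrite -[in leRHS](eseminormN g) eseminormD. Qed.

Lemma eseminormBC f g : N (f - g)%R = N (g - f)%R.
Proof. by rewrite -opprB eseminormN. Qed.

Lemma eseminorm_sum (I : Type) (s : seq I) (P : pred I) (F : I -> V) :
  (N (\sum_(i <- s | P i) F i)%R <= \sum_(i <- s | P i) N (F i))%E.
Proof.
elim/big_ind2 : _ => [|x y z t h1 h2|//]; first by rewrite (eseminorm0 sN).
by apply: le_trans (eseminormD _ _) _; exact: leeD.
Qed.

End eseminorm.

Section weak_derivatives.
Context {R : realType} {n : nat} (Om : @domain R n).
Local Notation fld a b := ('rV[R]_n -> 'M[R]_(a, b)).
Local Notation mu := (leb n).
Let mOm : measurable Om := dom_measurable Om.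

Lemma continuous_bounded_dom (psi : 'rV[R]_n -> R) : continuous psi ->
  exists M, forall x, dom Om x -> `|psi x| <= M.
Proof.
move=> cpsi.
have [M [_ hM]] := dom_bounded Om.
pose K := [set v : 'rV[R]_n | forall i, v ord0 i \in `[(- (M + 1)), (M + 1)]].
have cK : compact K.
  apply: (@rV_compact _  _ (fun=> `[(- (M + 1)), (M + 1)]%classic)).
  by move=> _; exact: segment_compact.
have /compact_bounded[M' [_ hM']] : compact (psi @` K).
  by apply: continuous_compact => //; exact: continuous_subspaceT.
exists (M' + 1) => x Ox; apply: (hM' (M' + 1)); first lra.
exists x => // i.
suff : `|x ord0 i| <= M + 1 by rewrite ler_norml in_itv.
apply: le_trans (hM (M + 1) _ x Ox); last lra.
by rewrite [leRHS]/Num.norm /= mx_normrE; apply/bigmax_geP; right => /=;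
  exists (ord0, i).
Qed.

(** The identities that define weak derivatives are between integrals, which are additive only on
    integrable functions. On a bounded domain [psi] is bounded, and the product is dominated by
    [|f|^2 + M^2]. *)
Lemma integrable_test a b (f : fld a b) psi i j : L2 Om f -> continuous psi ->
  mu.-integrable Om (EFin \o (fun x => f x i j * psi x)).
Proof.
move=> Lf cpsi; have [M hM] := continuous_bounded_dom cpsi.
have mpsi : measurable_fun Om psi by exact: continuous_measurable_rV.
have icst : mu.-integrable Om (EFin \o cst (M ^+ 2)).
  apply/integrableP; split; first exact/measurable_EFinP.
  rewrite /= (integral_cst _ mOm `|(M ^+ 2)%:E|%E).
  by apply: lte_mul_pinfty; rewrite ?abse_ge0//; exact: dom_finite.
have := integrableD mOm (integrable_frob Lf Lf) icst.
apply: le_integrable => //.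
  by apply/measurable_EFinP; apply: measurable_funM => //; case/L2P: Lf.
move=> x Ox /=; rewrite lee_fin normrM [leRHS]ger0_norm; last first.
  by rewrite addr_ge0 ?frob_ge0 ?sqr_ge0.
have := frob_sqr_entry (f x) i j.
rewrite -(real_normK (num_real (f x i j))).
have p0 := normr_ge0 (psi x); have := ler_pM p0 p0 (hM x Ox) (hM x Ox).
by have := sqr_ge0 (`|f x i j| - `|psi x|); rewrite sqrrB -expr2;
  have := sqr_ge0 `|f x i j|; have := sqr_ge0 `|psi x|; lra.
Qed.

Lemma wdiv_linear a k (t1 t2 : fld a n) (d1 d2 : fld a 1) :
  L2 Om t1 -> L2 Om t2 -> wdiv Om t1 d1 -> wdiv Om t2 d2 ->
  wdiv Om (k *: t1 + t2) (k *: d1 + d2).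
Proof.
move=> L1 L2' [Ld1 h1] [Ld2 h2]; split; first exact: L2_linear.
move=> phi tphi i; have [sphi _] := tphi.
have cphi s : continuous (partial s phi) by case: (sphi s).
have isum t : L2 Om t -> mu.-integrable Om
    (EFin \o (fun x => \sum_j (t : fld a n) x i j * partial [:: j] phi x)).
  move=> Lt; rewrite (_ : _ \o _ = fun x =>
    (\sum_j (t x i j * partial [:: j] phi x)%:E)%E); last first.
    by apply/funext => x /=; rewrite sumEFin.
  by apply: integrable_sum => // j _; exact: integrable_test.
transitivity (\int[mu]_(x in Om) (k * (\sum_j t1 x i j * partial [:: j] phi x)
   + \sum_j t2 x i j * partial [:: j] phi x)).
  apply: eq_Rintegral => x _; rewrite mulr_sumr -big_split /=.
  by apply: eq_bigr => j _; rewrite !mxE mulrDl mulrA.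
rewrite RintegralE_lin ?isum// h1// h2//.
transitivity (- \int[mu]_(x in Om) (k * (d1 x i ord0 * phi x) + d2 x i ord0 * phi x)).
  rewrite RintegralE_lin; try exact: (integrable_test _ _ _ (cphi [::])).
  by rewrite opprD mulrN.
by congr (- _); apply: eq_Rintegral => x _; rewrite !mxE mulrDl mulrA.
Qed.

Lemma wdivB a (t1 t2 : fld a n) (d1 d2 : fld a 1) :
  L2 Om t1 -> L2 Om t2 -> wdiv Om t1 d1 -> wdiv Om t2 d2 ->
  wdiv Om (t1 - t2) (d1 - d2).
Proof.
move=> L1 L2' h1 h2.
rewrite [t1 - _]addrC -(scaleN1r t2) [d1 - _]addrC -(scaleN1r d2).
exact: wdiv_linear.
Qed.

Lemma weak_partial_linear a b m (al : @mindex n m) k (f1 f2 g1 g2 : fld a b) :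
  L2 Om f1 -> L2 Om f2 -> weak_partial Om al f1 g1 -> weak_partial Om al f2 g2 ->
  weak_partial Om al (k *: f1 + f2) (k *: g1 + g2).
Proof.
move=> L1 L2' [Ld1 h1] [Ld2 h2]; split; first exact: L2_linear.
move=> phi tphi i j; have [sphi _] := tphi.
have cphi s : continuous (partial s phi) by case: (sphi s).
transitivity (\int[mu]_(x in Om) (k * (f1 x i j * partial (mdirs al) phi x)
   + f2 x i j * partial (mdirs al) phi x)).
  by apply: eq_Rintegral => x _; rewrite !mxE mulrDl mulrA.
rewrite RintegralE_lin; try exact: integrable_test.
rewrite h1// h2// mulrCA -mulrDr; congr (_ * _).
rewrite -RintegralE_lin; try exact: (integrable_test _ _ _ (cphi [::])).
by apply: eq_Rintegral => x _; rewrite !mxE mulrDl mulrA.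
Qed.

Lemma nrmE a b (f : fld a b) : L2 Om f -> nrm Om f = fnorm ipF (tol2 Om f).
Proof. by move=> Lf; rewrite /fnorm /= tol2E. Qed.

Lemma ipE a b (f g : fld a b) : L2 Om f -> L2 Om g ->
  ip Om f g = ipF (tol2 Om f) (tol2 Om g).
Proof. by move=> Lf Lg; rewrite /= !tol2E. Qed.

Lemma nrm_orth a b (f g : fld a b) : L2 Om f -> L2 Om g -> ip Om f g = 0 ->
  nrm Om f <= nrm Om (f + g).
Proof.
move=> Lf Lg; rewrite (ipE Lf Lg) => o.
have Lfg : L2 Om (f + g) by rewrite -(scale1r f); exact: L2_linear.
by rewrite (nrmE Lf) (nrmE Lfg) (tol2D Lf Lg); exact: fnorm_orth.
Qed.

Lemma nrm_fun a b (f : l2 Om a b) : nrm Om f = fnorm ipF f.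
Proof. by []. Qed.

Section sobolev.
Variables (m a b : nat).
Implicit Types (f : fld a b) (g : @mindex n m -> fld a b).

Definition weak_family f g : Prop :=
  forall al, (mlength al <= m)%N -> weak_partial Om al f (g al).

Definition family_norm g : R :=
  Num.sqrt (\sum_(al | (mlength al <= m)%N) nrm Om (g al) ^+ 2).

Let SF (G H : @mindex n m -> l2 Om a b) : R :=
  \sum_(al | (mlength al <= m)%N) ipF (G al) (H al).

Let SFC G H : SF G H = SF H G.
Proof. by apply: eq_bigr => al _; rewrite formC. Qed.

Let SF_linear k G H K : SF (k *: G + H) K = k * SF G K + SF H K.
Proof.
by rewrite mulr_sumr -big_split; apply: eq_bigr => al _; rewrite form_linear.
Qed.

Let SF_ge0 G : 0 <= SF G G.
Proof. by apply: sumr_ge0 => al _; exact: form_ge0. Qed.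

(** The Euclidean combination of the [L^2] seminorms is itself the seminorm of a semidefinite form,
    on families of fields; its triangle inequality is that of forms. *)
Lemma family_norm_linear k g1 g2 :
  (forall al, (mlength al <= m)%N -> L2 Om (g1 al)) ->
  (forall al, (mlength al <= m)%N -> L2 Om (g2 al)) ->
  family_norm (fun al => k *: g1 al + g2 al) <=
    `|k| * family_norm g1 + family_norm g2.
Proof.
move=> L1 L2'; pose F := Form SFC SF_linear SF_ge0.
have e (g : @mindex n m -> fld a b) :
    (forall al, (mlength al <= m)%N -> L2 Om (g al)) ->
    family_norm g = fnorm F (fun al => tol2 Om (g al)).
  move=> Lg; congr Num.sqrt; apply: eq_bigr => al mal.
  by rewrite nrmE ?sqr_fnorm//; exact: Lg.
rewrite !e//; last by move=> al mal; apply: L2_linear; [exact: L1|exact: L2'].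
rewrite -fnormZ; apply: le_trans (ler_fnormD _ _ _).
rewrite le_eqVlt; apply/orP; left; apply/eqP; congr Num.sqrt.
apply: eq_bigr => al mal.
by rewrite tol2_linear//; [exact: L1|exact: L2'].
Qed.

Lemma Hnorm_le f g : L2 Om f -> weak_family f g ->
  (Hnorm Om m f <= (family_norm g)%:E)%E.
Proof. by move=> Lf wg; apply: ereal_inf_lbound; split => //; exists g. Qed.

Lemma HnormP f e : (Hnorm Om m f < +oo)%E -> 0 < e ->
  exists g, [/\ L2 Om f, weak_family f g &
    ((family_norm g)%:E <= Hnorm Om m f + e%:E)%E].
Proof.
move=> foo e0.
have ffin : Hnorm Om m f \is a fin_num.
  rewrite ge0_fin_numE//; apply: le_ereal_inf_tmp => _ [_ [g [_ ->]]].
  by rewrite lee_fin sqrtr_ge0.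
have [_ [Lf [g [wg ->]]] h] := lb_ereal_inf_adherent e0 ffin.
by exists g; split => //; exact: ltW.
Qed.

Lemma Hnorm_ge0 f : (0 <= Hnorm Om m f)%E.
Proof.
by apply: le_ereal_inf_tmp => _ [_ [g [_ ->]]]; rewrite lee_fin sqrtr_ge0.
Qed.

Lemma Hnorm_L2 f : (Hnorm Om m f < +oo)%E -> L2 Om f.
Proof. by move=> /HnormP/(_ (@ltr01 R))[g []]. Qed.

Lemma Hnorm_linear k f1 f2 :
  (Hnorm Om m f1 < +oo)%E -> (Hnorm Om m f2 < +oo)%E ->
  (Hnorm Om m (k *: f1 + f2)%R <= `|k|%:E * Hnorm Om m f1 + Hnorm Om m f2)%E.
Proof.
move=> f1oo f2oo; apply/lee_addgt0Pr => e e0.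
(* The slack is used twice, once multiplied by the absolute value of [k]. *)
pose d := e / (`|k| + 1).
have k1 : 0 < `|k| + 1 by have := normr_ge0 k; lra.
have d0 : 0 < d by rewrite divr_gt0.
have [g1 [L1 w1 h1]] := HnormP f1oo d0.
have [g2 [L2' w2 h2]] := HnormP f2oo d0.
have w : weak_family (k *: f1 + f2) (fun al => k *: g1 al + g2 al).
  by move=> al mal; apply: weak_partial_linear => //; [exact: w1|exact: w2].
apply: le_trans (Hnorm_le (L2_linear _ L1 L2') w) _.
have := @family_norm_linear k g1 g2
  (fun al mal => (w1 al mal).1) (fun al mal => (w2 al mal).1).
rewrite -lee_fin => /le_trans; apply.
have := Hnorm_ge0 f1; have := Hnorm_ge0 f2; move: h1 h2 f1oo f2oo.
case: (Hnorm Om m f1) => [x1| |]//; case: (Hnorm Om m f2) => [x2| |]//.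
rewrite -?EFinD !lee_fin => h1 h2 _ _ _ _.
have := ler_wpM2l (normr_ge0 k) h1.
have : d * (`|k| + 1) = e by rewrite divfK// gt_eqF.
rewrite mulrDr; lra.
Qed.

Lemma Hnorm0 : Hnorm Om m (0 : fld a b) = 0%E.
Proof.
apply/eqP; rewrite eq_le Hnorm_ge0 andbT.
have L0 := L2_0 Om a b.
apply: le_trans (@Hnorm_le _ (fun=> 0) L0 _) _.
  move=> al mal; split => // phi _ i j.
  rewrite (@eq_Rintegral _ _ _ _ _ (cst 0)); last first.
    by move=> x _ /=; rewrite mxE mul0r.
  rewrite Rintegral_cst// mul0r.
  rewrite (@eq_Rintegral _ _ _ _ _ (cst 0)); last first.
    by move=> x _ /=; rewrite mxE mul0r.
  by rewrite Rintegral_cst// mul0r mulr0.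
rewrite lee_fin /family_norm big1 ?sqrtr0// => al _.
by rewrite nrmE// tol20 fnorm0 expr0n.
Qed.

Lemma Hnorm_eseminorm : eseminorm (@Hnorm _ _ Om m a b).
Proof. by split; [exact: Hnorm0|exact: Hnorm_ge0|exact: Hnorm_linear]. Qed.

End sobolev.

(** Multi-indices with entries at most 1 embed, with the same length and directions, into those with
    entries at most [m]. Interpolations are defined on [H^1], so this is what makes them available
    for fields in [H^m]. *)
Lemma Hnorm1_fin a b m (f : fld a b) : (0 < m)%N ->
  (Hnorm Om m f < +oo)%E -> (Hnorm Om 1 f < +oo)%E.
Proof.
move=> m0 /HnormP/(_ (@ltr01 R))[g [Lf wg _]].
have le2 : (2 <= m.+1)%N by [].
pose w (al : @mindex n 1) : @mindex n m := [ffun i => widen_ord le2 (al i)].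
apply: (le_lt_trans (@Hnorm_le 1 _ _ f (fun al => g (w al)) Lf _)); last by rewrite ltry.
move=> al mal.
have wE : mlength (w al) = mlength al by apply: eq_bigr => i _; rewrite ffunE.
have dE : mdirs (w al) = mdirs al.
  by rewrite /mdirs; congr flatten; apply: eq_map => i; rewrite ffunE.
have [|Lg h] := wg (w al); first by rewrite wE (leq_trans mal).
by split => // phi tphi i j; rewrite -dE -wE h.
Qed.

End weak_derivatives.

(** * The coefficients of the problem *)

Section inverse_form.
Context {R : realType} {a b : nat} (P : 'M[R]_(a, b) -> Prop).
Context (L L' : 'M[R]_(a, b) -> 'M[R]_(a, b)) (lo hi : R).
Hypotheses (lo0 : 0 < lo) (hi0 : 0 < hi).
Hypothesis Plin : forall k E F, P E -> P F -> P (k *: E + F).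
Hypothesis hL : forall k E F, P E -> P F ->
  [/\ L (k *: E + F) = k *: L E + L F, P (L E), frob (L E) F = frob E (L F) &
      lo * frob E E <= frob (L E) E <= hi * frob E E].
Hypothesis hL' : forall E, P E -> [/\ P (L' E), L' (L E) = E & L (L' E) = E].

(* The lower bound is the case [t = 1 / hi] of [0 <= (L (v - t L v), v - t L v)]
   with [v = L' E]. *)
Lemma inverse_form_bounds k E F : P E -> P F ->
  [/\ L' (k *: E + F) = k *: L' E + L' F, frob (L' E) F = frob E (L' F),
      hi^-1 * frob E E <= frob (L' E) E & frob (L' E) E <= lo^-1 * frob E E].
Proof.
move=> PE PF.
have [PvE _ LvE] := hL' PE; have [PvF _ LvF] := hL' PF.
split.
- have [h _ _ _] := hL k PvE PvF.
  by rewrite -{1}LvE -{1}LvF -h; case: (hL' (Plin k PvE PvF)).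
- have [_ _ h _] := hL 0 PvE PvF.
  by rewrite -{1}LvF -h LvE.
- set v := L' E in PvE LvE *.
  have P2 : P (- hi^-1 *: E + v) by exact: Plin.
  have [h1 _ _ _] := hL (- hi^-1) PE PvE.
  have [_ _ h2 /andP[_ h3]] := hL 0 PE PvE.
  have [_ _ _ /andP[h4 _]] := hL 0 P2 P2.
  have h5 : 0 <= frob (L (- hi^-1 *: E + v)) (- hi^-1 *: E + v).
    by apply: le_trans h4; rewrite mulr_ge0 ?frob_ge0 ?ltW.
  move: h5; rewrite h1 LvE !frobE !formE -!frobE h2 LvE (frobC v E).
  have : hi^-1 * (hi^-1 * frob (L E) E) <= hi^-1 * frob E E.
    by rewrite ler_pM2l ?invr_gt0// ler_pdivrMl.
  lra.
- set v := L' E in PvE LvE *.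
  have [_ _ _ /andP[h _]] := hL 0 PvE PvE.
  rewrite LvE in h; rewrite ler_pdivlMl//.
  have := frob_ge0 (E - lo *: v).
  rewrite !frobE !formE -!frobE (frobC v E).
  have : lo * (lo * frob v v) <= lo * frob E v by rewrite ler_pM2l.
  lra.
Qed.

End inverse_form.

Section coefficients.
Context {R : realType} {n : nat} (Om : @domain R n).

Definition coercive a b (A : coefficient Om a b) : Prop :=
  exists2 lo, 0 < lo & forall x X, dom Om x -> lo * frob X X <= frob (A x X) X.

Lemma frob_trmx (X Y : 'M[R]_n) : frob X^T Y^T = frob X Y.
Proof.
rewrite /frob exchange_big; apply: eq_bigr => i _; apply: eq_bigr => j _.
by rewrite !mxE.
Qed.

Lemma frob_sym_skew (X Y : 'M[R]_n) : X^T = X -> Y^T = - Y -> frob X Y = 0.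
Proof.
move=> hX hY; have := frob_trmx X Y; rewrite hX hY !frobE !formE; lra.
Qed.

Lemma frob_sym_skewD a (S1 S2 K1 K2 : 'M[R]_n) : S1^T = S1 -> S2^T = S2 ->
  K1^T = - K1 -> K2^T = - K2 ->
  frob (S1 + a *: K1) (S2 + K2) = frob S1 S2 + a * frob K1 K2.
Proof.
move=> hS1 hS2 hK1 hK2; rewrite !frobE !formE -!frobE (frobC K1 S2).
by rewrite (frob_sym_skew hS1 hK2) (frob_sym_skew hS2 hK1); ring.
Qed.

(** [A] is block diagonal for the orthogonal sum of symmetric and skew matrices. The bounds of the
    symmetric block are inverted from those of [C], the skew block is [a] times the identity, and
    the extremes of the two serve for [A]. *)
Lemma compliance_coef C A : compliance Om C A ->
  exists2 c : coefficient Om n n, coef c = A & coercive c.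
Proof.
move=> [As [a [cmin [cmax [a0 cmin0 [mC hC hAs hA]]]]]].
pose hi := Num.max cmax 1.
have hi0 : 0 < hi by rewrite lt_max ltr01 orbT.
pose sy (X : 'M[R]_n) := 2^-1 *: (X + X^T).
pose sk (X : 'M[R]_n) := 2^-1 *: (X - X^T).
have syT X : (sy X)^T = sy X.
  by rewrite /sy linearZ /= linearD /= trmxK addrC.
have skT X : (sk X)^T = - sk X.
  by rewrite /sk linearZ /= linearB /= trmxK -scalerN opprB.
have sD X : X = sy X + sk X.
  by apply/matrixP => i j; rewrite !mxE; field.
have syl k X Y : sy (k *: X + Y) = k *: sy X + sy Y.
  rewrite /sy scalerA mulrC -scalerA -scalerDr; congr (_ *: _).
  by rewrite linearP /= scalerDr addrACA.
have skl k X Y : sk (k *: X + Y) = k *: sk X + sk Y.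
  rewrite /sk scalerA mulrC -scalerA -scalerDr; congr (_ *: _).
  by rewrite linearP /= scalerBr opprD addrACA.
have inv x : dom Om x -> forall k E F, E^T = E -> F^T = F ->
  [/\ As x (k *: E + F) = k *: As x E + As x F, frob (As x E) F = frob E (As x F),
      hi^-1 * frob E E <= frob (As x E) E & frob (As x E) E <= cmin^-1 * frob E E].
  move=> Ox; apply: (@inverse_form_bounds _ _ _ (fun E => E^T = E) (C x) (As x)) => //.
  - by move=> k E F hE hF; rewrite linearP /= hE hF.
  - move=> k E F hE hF; have [h1 h2 h3 /andP[h4 h5]] := hC x Ox k E F hE hF.
    split => //; rewrite h4 /=; apply: le_trans h5 _.
    by rewrite ler_wpM2r ?frob_ge0// le_max lexx.
  - by move=> E hE; have [] := hAs x Ox E hE.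
have AsT x X : dom Om x -> (As x (sy X))^T = As x (sy X).
  by move=> Ox; have [] := hAs x Ox _ (syT X).
have fA x X Y : dom Om x ->
    frob (A x X) Y = frob (As x (sy X)) (sy Y) + a * frob (sk X) (sk Y).
  by move=> Ox; rewrite hA// -/(sy X) -/(sk X) [in LHS](sD Y) frob_sym_skewD// AsT.
have fE X : frob X X = frob (sy X) (sy X) + frob (sk X) (sk X).
  by rewrite [in LHS](sD X) -[sk X in X in frob X _]scale1r frob_sym_skewD// mul1r.
have ge0 x X : dom Om x -> Num.min hi^-1 a * frob X X <= frob (A x X) X.
  move=> Ox; rewrite fA// fE mulrDr.
  have [_ _ h _] := inv x Ox 0 _ _ (syT X) (syT X).
  apply: lerD; last by rewrite ler_wpM2r ?frob_ge0// ge_min lexx orbT.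
  by apply: le_trans h; rewrite ler_wpM2r ?frob_ge0// ge_min lexx.
have lo0 : 0 < Num.min hi^-1 a by rewrite lt_min a0 invr_gt0 hi0.
have hi'0 : 0 <= Num.max cmin^-1 a by rewrite le_max (ltW a0) orbT.
have me X : mentries Om (fun x => A x X).
  move=> i j; apply: (@eq_measurable_fun _ _ _ _ _
    (fun x => As x (sy X) i j + a * sk X i j)).
    by move=> x; rewrite inE => Ox; rewrite hA// [RHS]mxE [in RHS]mxE.
  by apply: measurable_funD => //; case: (mC _ (syT X) i j).
have li x k X Y : dom Om x -> A x (k *: X + Y) = k *: A x X + A x Y.
  move=> Ox; rewrite !hA// -!/(sy _) -!/(sk _) syl skl.
  have [-> _ _ _] := inv x Ox k _ _ (syT X) (syT Y).
  by rewrite [a *: (_ + _)]scalerDr [k *: (_ + _)]scalerDr addrACA !scalerA (mulrC a).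
have sm x X Y : dom Om x -> frob (A x X) Y = frob X (A x Y).
  move=> Ox; rewrite (frobC X) !fA// (frobC (sk Y)); congr (_ + _).
  by have [_ -> _ _] := inv x Ox 0 _ _ (syT X) (syT Y); rewrite frobC.
have g0 x X : dom Om x -> 0 <= frob (A x X) X.
  by move=> Ox; apply: le_trans (ge0 x X Ox); rewrite mulr_ge0 ?frob_ge0 ?ltW.
have le x X : dom Om x -> frob (A x X) X <= Num.max cmin^-1 a * frob X X.
  move=> Ox; rewrite fA// [in leRHS]fE mulrDr.
  have [_ _ _ h] := inv x Ox 0 _ _ (syT X) (syT X).
  apply: lerD; last by rewrite ler_wpM2r ?frob_ge0// le_max lexx orbT.
  by apply: le_trans h _; rewrite ler_wpM2r ?frob_ge0// le_max lexx.
exists (@Coefficient _ _ Om _ _ A _ hi'0 me li sm g0 le) => //.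
by exists (Num.min hi^-1 a).
Qed.

Lemma measurable_det m (f : 'rV[R]_n -> 'M[R]_m) : mentries Om f ->
  measurable_fun Om (fun x => \det (f x)).
Proof.
move=> mf; apply: measurable_sum => s; apply: measurable_funM => //.
by apply: measurable_prod => i _; exact: mf.
Qed.

Lemma mentries_invmx m (f : 'rV[R]_n -> 'M[R]_m) : mentries Om f ->
  (forall x, dom Om x -> f x \in unitmx) -> mentries Om (fun x => invmx (f x)).
Proof.
move=> mf uf i j.
(* The inverse of the determinant [d] is written as [d * (d ^+ 2)^-1]: the base of the real power is
   then nonnegative, and real powers are measurable. *)
apply: (@eq_measurable_fun _ _ _ _ _ (fun x =>
   (\det (f x) * powR (\det (f x) ^+ 2) (-1)) * cofactor (f x) j i)).
  move=> x; rewrite inE => Ox; rewrite /invmx uf// !mxE powR_inv1 ?sqr_ge0//.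
  congr (_ * _); have := uf x Ox; rewrite unitmxE unitfE => d0.
  by field.
apply: measurable_funM.
  apply: measurable_funM; first exact: measurable_det.
  apply: (measurableT_comp (measurable_powR (-1))).
  by apply: measurable_funX; exact: measurable_det.
apply: measurable_funM => //; apply: measurable_det => k l.
by rewrite (_ : (fun _ => _) = (fun x => f x (lift j k) (lift i l)))//;
  apply/funext => x; rewrite !mxE.
Qed.

Lemma conductivity_coef kappa : (0 < n)%N -> conductivity Om kappa ->
  exists2 c : coefficient Om 1 n,
    coef c = (fun x v => v *m (invmx (kappa x))^T) & coercive c.
Proof.
move=> n0 [cmin [cmax [cmin0 h]]].
(* The pointwise bounds stand under the quantifiers over the entries of [kappa]; an index is needed
   to extract them. *)
pose i0 := Ordinal n0.
have mk i j := (h i j).1.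
have hk x : dom Om x -> (kappa x)^T = kappa x /\
    forall v : 'rV[R]_n, cmin * frob v v <= frob (v *m kappa x) v <= cmax * frob v v.
  exact: (h i0 i0).2.
pose hi := Num.max cmax 1.
have hi0 : 0 < hi by rewrite lt_max ltr01 orbT.
have fT (X : 'M[R]_n) (v w : 'rV[R]_n) : frob (v *m X) w = frob v (w *m X^T).
  have e u1 u2 : frob u1 u2 = (u1 *m (u2 : 'rV[R]_n)^T) ord0 ord0.
    rewrite /frob big_ord1 mxE; apply: eq_bigr => j _; by rewrite mxE.
  by rewrite !e trmx_mul trmxK mulmxA.
have uk x : dom Om x -> kappa x \in unitmx.
  move=> Ox; rewrite -row_free_unit -kermx_eq0; apply/eqP/row_matrixP => i.
  rewrite row0; apply: frob_eq0; apply/eqP; rewrite eq_le frob_ge0 andbT.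
  have [_ /(_ (row i (kermx (kappa x))))/andP[+ _]] := hk x Ox.
  rewrite -row_mul mulmx_ker row0 (frobE 0) form0l => H.
  by rewrite -(pmulr_rle0 _ cmin0); exact: H.
have ikT x : dom Om x -> (invmx (kappa x))^T = invmx (kappa x).
  by move=> Ox; rewrite trmx_inv; have [-> _] := hk x Ox.
have inv x : dom Om x -> forall k (E F : 'rV[R]_n), True -> True ->
  [/\ (k *: E + F) *m invmx (kappa x) = k *: (E *m invmx (kappa x)) + F *m invmx (kappa x),
      frob (E *m invmx (kappa x)) F = frob E (F *m invmx (kappa x)),
      hi^-1 * frob E E <= frob (E *m invmx (kappa x)) E &
      frob (E *m invmx (kappa x)) E <= cmin^-1 * frob E E].
  move=> Ox; apply: (@inverse_form_bounds _ _ _ (fun=> True)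
    (fun v => v *m kappa x) (fun v => v *m invmx (kappa x))) => //.
  - move=> k E F _ _; have [kT hv] := hk x Ox; have /andP[h4 h5] := hv E.
    split => //; first by rewrite mulmxDl -scalemxAl.
      by rewrite fT kT.
    rewrite h4 /=; apply: le_trans h5 _.
    by rewrite ler_wpM2r ?frob_ge0// le_max lexx.
  - by move=> E _; rewrite mulmxK ?mulmxKV ?uk.
have hi'0 : 0 <= cmin^-1 by rewrite invr_ge0 ltW.
have me (X : 'rV[R]_n) : mentries Om (fun x => X *m (invmx (kappa x))^T).
  move=> i j; have mi := mentries_invmx mk uk.
  rewrite (_ : (fun _ => _) = fun x => \sum_k X i k * invmx (kappa x) j k).
    by apply: measurable_sum => k; apply: measurable_funM.
  by apply/funext => x; rewrite mxE; apply: eq_bigr => k _; rewrite mxE.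
pose cf x (v : 'rV[R]_n) := v *m (invmx (kappa x))^T.
have li x k X Y : dom Om x -> cf x (k *: X + Y) = k *: cf x X + cf x Y.
  by move=> Ox; rewrite /cf mulmxDl -scalemxAl.
have sm x X Y : dom Om x -> frob (cf x X) Y = frob X (cf x Y).
  by move=> Ox; rewrite /cf ikT//; case: (inv x Ox 0 X Y).
have ge x X : dom Om x -> hi^-1 * frob X X <= frob (cf x X) X.
  by move=> Ox; rewrite /cf ikT//; case: (inv x Ox 0 X X).
have g0 x X : dom Om x -> 0 <= frob (cf x X) X.
  by move=> Ox; apply: le_trans (ge x X Ox); rewrite mulr_ge0 ?frob_ge0 ?invr_ge0 ?ltW.
have le x X : dom Om x -> frob (cf x X) X <= cmin^-1 * frob X X.
  by move=> Ox; rewrite /cf ikT//; case: (inv x Ox 0 X X).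
exists (@Coefficient _ _ Om _ _ cf _ hi'0 me li sm g0 le) => //.
by exists hi^-1 => //; rewrite invr_gt0.
Qed.

Lemma scalar_coef (s : 'rV[R]_n -> R) a b : bounded_coef Om s ->
  (forall x, dom Om x -> 0 <= s x) ->
  exists c : coefficient Om a b, coef c = (fun x X => s x *: X).
Proof.
move=> [ms [M hM]] s0; pose hi := Num.max M 0.
have hi0 : 0 <= hi by rewrite le_max lexx orbT.
pose cf x (X : 'M[R]_(a, b)) := s x *: X.
have me X : mentries Om (fun x => cf x X).
  move=> i j; rewrite (_ : (fun _ => _) = fun x => s x * X i j).
    exact: measurable_funM.
  by apply/funext => x; rewrite mxE.
have li x k X Y : dom Om x -> cf x (k *: X + Y) = k *: cf x X + cf x Y.
  by move=> _; rewrite /cf scalerDr !scalerA mulrC.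
have sm x X Y : dom Om x -> frob (cf x X) Y = frob X (cf x Y).
  by move=> _; rewrite /cf !frobE !formE.
have g0 x X : dom Om x -> 0 <= frob (cf x X) X.
  by move=> Ox; rewrite /cf frobE formE mulr_ge0 ?form_ge0 ?s0.
have le x X : dom Om x -> frob (cf x X) X <= hi * frob X X.
  move=> Ox; rewrite /cf frobE formE ler_wpM2r ?form_ge0// le_max.
  by rewrite (le_trans (ler_norm _) (hM x Ox)).
by exists (@Coefficient _ _ Om _ _ cf _ hi0 me li sm g0 le).
Qed.

Lemma mulI_bound (al : 'rV[R]_n -> R) : bounded_coef Om al ->
  exists2 c, 0 <= c & forall p : 'rV[R]_n -> 'M[R]_1, L2 Om p ->
    L2 Om (mulI (n := n) al p) /\ nrm Om (mulI (n := n) al p) <= c * nrm Om p.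
Proof.
move=> [mal [M hM]]; pose hi := Num.max M 0.
have hi0 : 0 <= hi by rewrite le_max lexx orbT.
(* The squared Frobenius norm of the identity is [n]. *)
pose k : R := n%:R * hi ^+ 2.
have k0 : 0 <= k by rewrite mulr_ge0 ?sqr_ge0.
have bd p x : dom Om x ->
    frob (mulI (n := n) al p x) (mulI al p x) <= k * frob (p x) (p x).
  move=> Ox; rewrite /mulI {1}/frob.
  rewrite (eq_bigr (fun=> (al x * p x ord0 ord0) ^+ 2)); last first.
    move=> i _; rewrite (bigD1 i)//= big1 ?addr0.
      by rewrite mxE eqxx mulr1n expr2.
    by move=> j ji; rewrite mxE eq_sym (negbTE ji) mulr0n mul0r.
  rewrite sumr_const card_ord -mulr_natl /k -mulrA ler_wpM2l//.
  rewrite /frob !big_ord1 -expr2 exprMn ler_wpM2r ?sqr_ge0//.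
  rewrite -(real_normK (num_real (al x))) ler_pXn2r// ?nnegrE//.
  by rewrite le_max hM.
exists (Num.sqrt k); first exact: sqrtr_ge0.
move=> p Lp; have LI : L2 Om (mulI (n := n) al p).
  apply: (L2_dominated _ (bd p) Lp) => i j.
  rewrite (_ : (fun _ => _) = fun x => al x * p x ord0 ord0 * (i == j)%:R).
    by apply: measurable_funM => //; apply: measurable_funM => //; case/L2P: Lp.
  by apply/funext => x; rewrite /mulI mxE mulr_natr.
split => //.
rewrite /nrm -sqrtrM// ler_wsqrtr// -RintegralZl//.
- apply: le_Rintegral => //; try exact: integrable_frob.
  + exact: dom_measurable.
  + exact: (integrableZl (dom_measurable Om) k (integrable_frob Lp Lp)).
  + by move=> x Ox; exact: bd.
- exact: dom_measurable.
- exact: integrable_frob.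
Qed.

Lemma mulI_linear (al : 'rV[R]_n -> R) k (p q : 'rV[R]_n -> 'M[R]_1) :
  mulI (n := n) al (k *: p + q) = k *: mulI al p + mulI al q.
Proof.
apply/funext => x; apply/matrixP => i j; rewrite /mulI !mxE.
by case: (i == j); rewrite ?mulr1n ?mulr0n; ring.
Qed.

End coefficients.

(** * Lower integrals and strong measurability *)

Section lower_integral.
Context d (T : measurableType d) (R : realType).
Variable mu : {measure set T -> \bar R}.
Local Open Scope ereal_scope.
Import HBNNSimple.

(* The library integral of a nonnegative function is a supremum over simple
   minorants: no measurability is needed here, nor in the next lemmas. *)
Lemma lower_integral_le (D : set T) (f g : T -> \bar R) :
  (forall x, D x -> 0 <= f x) -> (forall x, D x -> f x <= g x) ->
  \int[mu]_(x in D) f x <= \int[mu]_(x in D) g x.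
Proof.
move=> f0 fg; rewrite (integral_mkcond D f) (integral_mkcond D g).
have h0 x : 0 <= (f \_ D) x by apply: erestrict_ge0.
have hg x : 0 <= (g \_ D) x.
  by apply: erestrict_ge0 => // t Dt; apply: le_trans (fg _ Dt); exact: f0.
rewrite !ge0_integralTE//; apply: ereal_sup_le => _ [h hf <-].
exists h => // x; apply: le_trans (hf x) _.
by rewrite lee_restrict.
Qed.

(** [Lr_norm] restricts the measure, whereas the other integrals restrict the domain. As [f] need
    not be measurable, the two are compared on simple minorants. *)
Lemma lower_integral_mrestr (D : set T) (mD : measurable D) (f : T -> \bar R) :
  (forall x, 0 <= f x) ->
  \int[mrestr mu mD]_x f x = \int[mu]_(x in D) f x.
Proof.
move=> f0; rewrite integral_mkcond.
have h0 x : 0 <= (f \_ D) x by apply: erestrict_ge0.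
have e (h : {nnsfun T >-> R}) :
    sintegral (mrestr mu mD) h = sintegral mu (h \_ D).
  rewrite /sintegral; apply: eq_fsbigr => x _.
  have [->|x0] := eqVneq x 0%R; first by rewrite !mul0e.
  congr (_ * _); rewrite /mrestr; congr (mu _).
  apply/seteqP; split => t /=.
    by move=> [<- Dt]; rewrite patchE mem_set.
  by rewrite patchE; case: ifPn => [/set_mem Dt <-//|_ /eqP]; rewrite eq_sym (negbTE x0).
rewrite !ge0_integralTE//; apply/eqP; rewrite eq_le; apply/andP; split.
  apply: ereal_sup_le => _ [h hf <-]; exists (proj_nnsfun h mD).
    by move=> x; rewrite -mrestrict !patchE; case: (x \in D) => //; exact: hf.
  by rewrite e mrestrict.
(* A nonnegative simple minorant of [f \_ D] vanishes outside [D], so that restricting it changes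
   nothing. *)
apply: ereal_sup_le => _ [h hf <-]; exists h.
  move=> x; apply: le_trans (hf x) _; rewrite patchE; case: ifPn => // _.
rewrite e; congr (sintegral mu _); apply/funext => x; rewrite patchE.
case: ifPn => // xD; apply/esym/eqP; rewrite eq_le fun_ge0 andbT.
by have := hf x; rewrite patchE (negbTE xD) lee_fin.
Qed.

Lemma ae_lower_integral_ge (D : set T) (f g : T -> \bar R) : measurable D ->
  (forall x, D x -> 0 <= f x) -> measurable_fun D g ->
  (forall x, D x -> 0 <= g x) -> {ae mu, forall x, D x -> g x <= f x} ->
  \int[mu]_(x in D) g x <= \int[mu]_(x in D) f x.
Proof.
move=> mD f0 mg g0 [N [mN muN sN]].
rewrite (ge0_negligible_integral mN)// integral_mkcond [leRHS]integral_mkcond.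
apply: lower_integral_le => [x _|x _].
  by apply: erestrict_ge0 => t [Dt _]; exact: g0.
rewrite !patchE; case: ifPn => [/set_mem[Dx Nx]|_].
  rewrite mem_set//; apply: contrapT => h; apply: Nx; apply: sN => /= /(_ Dx).
  exact: h.
by case: ifPn => // /set_mem; exact: f0.
Qed.

Lemma ae_lower_integral_le (D : set T) (f g : T -> \bar R) : measurable D ->
  (forall x, D x -> 0 <= f x) -> measurable_fun D g ->
  (forall x, D x -> 0 <= g x) -> {ae mu, forall x, D x -> f x <= g x} ->
  \int[mu]_(x in D) f x <= \int[mu]_(x in D) g x.
Proof.
move=> mD f0 mg g0 [N [mN muN sN]].
(* Adding [+oo] on the null set makes the inequality hold everywhere without changing the integral
   of the measurable bound. *)
pose g' x := g x + (cst +oo \_ N) x.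
have N0 x : 0 <= ((cst +oo : T -> \bar R) \_ N) x by apply: erestrict_ge0 => t _; rewrite leey.
have mN' : measurable_fun D ((cst +oo : T -> \bar R) \_ N).
  apply: measurable_funTS; apply/(measurable_restrictT _ mN).
  exact: measurable_cst.
have -> : \int[mu]_(x in D) g x = \int[mu]_(x in D) g' x.
  apply: ge0_ae_eq_integral => //.
  - exact: emeasurable_funD.
  - by move=> x Dx; rewrite adde_ge0// g0.
  exists N; split => // x /= h; apply: contrapT => Nx; apply: h => _.
  by rewrite /g' patchE memNset// adde0.
apply: lower_integral_le => // x Dx.
have [Nx|Nx] := pselect (N x).
  rewrite /g' patchE mem_set// addey ?leey// gt_eqF//.
  by rewrite (lt_le_trans _ (g0 _ Dx)).
rewrite /g' patchE memNset// adde0; apply: contrapT => h; apply: Nx; apply: sN.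
by move=> /= /(_ Dx).
Qed.

End lower_integral.

Section strong_measurability.
Context {R : realType} {n a b : nat}.
Local Notation fld := ('rV[R]_n -> 'M[R]_(a, b)).
Local Notation leb1 := (@lebesgue_measure R).
Context {N : fld -> \bar R} (sN : eseminorm N).
Local Notation sset s k := (@step_set R n a b s k).
Local Notation sval s k := (@step_val R n a b s k).
Implicit Types (s : @step R n a b) (f : R -> fld) (D : set R).

(** The sets of a step function may overlap. The level sets of this index are disjoint and
    measurable, and the step function is constant on each of them. *)
Definition step_index s (t : R) : {set 'I_(step_size s)} :=
  [set k | `[< sset s k t >]]%SET.

Definition step_at s (B : {set 'I_(step_size s)}) : fld :=
  \sum_(k in B) sval s k.

Lemma step_funE s t : step_fun s t = step_at (step_index s t).
Proof.
rewrite /step_fun /step_at [in RHS]big_mkcond; apply/funext => x /=.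
rewrite fct_sumE; apply: eq_bigr => k _.
rewrite inE indicE; case: asboolP => h; first by rewrite mem_set// scale1r.
by rewrite memNset// scale0r.
Qed.

Lemma measurable_step_index s B : step_in N s ->
  measurable (step_index s @^-1` [set B]).
Proof.
move=> hs.
have -> : step_index s @^-1` [set B] =
    \bigcap_(k in [set: 'I_(step_size s)])
      (if k \in B then sset s k else ~` sset s k).
  apply/seteqP; split => t /=.
    by move=> <- k _ /=; rewrite inE; case: asboolP.
  move=> h; apply/setP => k; have := h k Logic.I; rewrite inE.
  by case: ifP => _; case: asboolP.
apply: fin_bigcap_measurable; first exact: finite_finset.
by move=> k _; case: ifP => _; [|apply: measurableC]; case: (hs k).
Qed.

Lemma step_at_fin s B : step_in N s -> (N (@step_at s B) < +oo)%E.
Proof.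
move=> hs; apply: le_lt_trans (eseminorm_sum sN _ _ _) _.
by apply: lte_sum_pinfty => k _; case: (hs k).
Qed.

Definition nstep s B : R := fine (N (@step_at s B)).

Lemma nstepE s B : step_in N s -> N (@step_at s B) = (nstep B)%:E.
Proof.
by move=> hs; rewrite fineK// ge0_fin_numE ?step_at_fin// eseminorm_ge0.
Qed.

Lemma nstep_ge0 s B : 0 <= @nstep s B.
Proof. by rewrite fine_ge0// eseminorm_ge0. Qed.

Lemma norm_step_funE s t : step_in N s ->
  N (step_fun s t) =
    (\sum_B (nstep B * \1_(step_index s @^-1` [set B]) t))%:E.
Proof.
move=> hs; rewrite step_funE nstepE//; congr EFin.
rewrite (bigD1 (step_index s t))//= big1 ?addr0.
  by rewrite indicE mem_set// mulr1.
by move=> B Bt; rewrite indicE memNset ?mulr0//= => h; rewrite h eqxx in Bt.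
Qed.

Lemma measurable_norm_step s D : step_in N s ->
  measurable_fun D (fun t => N (step_fun s t)).
Proof.
move=> hs; rewrite (_ : (fun _ => _) =
   EFin \o (fun t => \sum_B (nstep B * \1_(step_index s @^-1` [set B]) t))).
  apply/measurable_EFinP; apply: measurable_sum => B.
  apply: measurable_funM => //; apply: measurable_indic.
  exact: measurable_step_index.
by apply/funext => t /=; rewrite norm_step_funE.
Qed.

Lemma integral_scale_indic D (E : set R) (k : R) : measurable D -> measurable E ->
  0 <= k -> (\int[leb1]_(t in D) (k * \1_E t)%:E = k%:E * leb1 (D `&` E))%E.
Proof.
move=> mD mE k0; under eq_integral do rewrite EFinM.
have mi : measurable_fun D (EFin \o \1_E : R -> \bar R).
  by apply/measurable_EFinP; exact: measurable_indic.
have i0 (t : R) : D t -> (0 <= (EFin \o (\1_E : R -> R)) t)%E by move=> _; rewrite lee_fin.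
by rewrite (ge0_integralZl_EFin leb1 mD i0 mi k0) integral_indic// setIC.
Qed.

Lemma step_intE s D : measurable D -> (leb1 D < +oo)%E -> step_in N s ->
  step_int s D = \sum_(B : {set 'I_(step_size s)})
    fine (leb1 (D `&` step_index s @^-1` [set B])) *: step_at B.
Proof.
move=> mD Doo hs; apply/funext => x; rewrite /step_int fct_sumE.
pose w B := fine (leb1 (D `&` step_index s @^-1` [set B])).
transitivity (\sum_k (\sum_(B : {set 'I_(step_size s)} | k \in B) w B) *: sval s k x).
  apply: eq_bigr => k _; congr (_ *: _).
  have mk B : measurable (D `&` step_index s @^-1` [set B]).
    by apply: measurableI => //; exact: measurable_step_index.
  have fk B : leb1 (D `&` step_index s @^-1` [set B]) \is a fin_num.
    rewrite ge0_fin_numE//; apply: le_lt_trans Doo.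
    by apply: le_measure; rewrite ?inE//; exact: mk.
  have mJ B : measurable (step_index s @^-1` [set B]) by exact: measurable_step_index.
  have [mA _] := hs k.
  pose F (B : {set 'I_(step_size s)}) (t : R) : \bar R :=
    ((k \in B)%:R * \1_(step_index s @^-1` [set B]) t)%:E.
  have mF B : measurable_fun D (F B).
    by apply/measurable_EFinP; apply: measurable_funM => //; exact: measurable_indic.
  have -> : leb1 (D `&` sset s k) = (\sum_B \int[leb1]_(t in D) F B t)%E.
    rewrite -ge0_integral_sum//; last first.
      by move=> B t _; rewrite lee_fin mulr_ge0.
    rewrite setIC -integral_indic//; apply: eq_integral => t _.
    rewrite /F sumEFin (bigD1 (step_index s t))//= big1.
      have e1 : \1_(step_index s @^-1` [set step_index s t]) t = 1 :> R.
        by rewrite indicE mem_set.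
      rewrite addr0 e1 mulr1 inE indicE.
      by case: asboolP => h; [rewrite mem_set|rewrite memNset].
    move=> B Bt; rewrite indicE memNset ?mulr0//= => h.
    by rewrite h eqxx in Bt.
  rewrite [RHS]big_mkcond -sum_fine /=.
    apply: eq_bigr => B _; rewrite /F integral_scale_indic//.
    by case: ifP => _; rewrite ?mul0e// mul1e.
  by move=> B _; rewrite /F integral_scale_indic// fin_numM.
under eq_bigr do rewrite scaler_suml.
rewrite (exchange_big_dep xpredT)//=; apply: eq_bigr => B _.
by rewrite -scaler_sumr /step_at fct_sumE.
Qed.

(** On the disjoint pieces the integral of the norm is exactly the weighted sum of the norms of the
    values. On the original sets, which may overlap, the triangle inequality would only give the
    larger sum of the separate norms. *)
Lemma norm_step_int s D : measurable D -> (leb1 D < +oo)%E -> step_in N s ->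
  (N (step_int s D) <= \int[leb1]_(t in D) N (step_fun s t))%E.
Proof.
move=> mD Doo hs; rewrite step_intE//.
apply: le_trans (eseminorm_sum sN _ _ _) _.
have mJ B : measurable (step_index s @^-1` [set B]) by exact: measurable_step_index.
under [leRHS]eq_integral do rewrite norm_step_funE// -sumEFin.
have mF (B : {set 'I_(step_size s)}) : measurable_fun D
    (fun t : R => (nstep B * \1_(step_index s @^-1` [set B]) t)%:E).
  by apply/measurable_EFinP; apply: measurable_funM.
have F0 (B : {set 'I_(step_size s)}) (t : R) : D t ->
    (0 <= (nstep B * \1_(step_index s @^-1` [set B]) t)%:E)%E.
  by move=> _; rewrite lee_fin mulr_ge0// nstep_ge0.
rewrite (ge0_integral_sum leb1 mD mF F0).
apply: lee_sum => B _.
rewrite integral_scale_indic//; last exact: nstep_ge0.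
apply: le_trans (eseminormZ sN _ (step_at_fin _ hs)) _.
rewrite nstepE// ger0_norm ?fine_ge0// fineK 1?muleC//.
rewrite ge0_fin_numE//; apply: le_lt_trans Doo.
by apply: le_measure; rewrite ?inE//; apply: (measurableI _ _ mD (mJ B)).
Qed.

End strong_measurability.

(** * Bochner spaces *)

Lemma ae_lebS {R : realType} (P Q : R -> Prop) : (forall x, P x -> Q x) ->
  {ae (@lebesgue_measure R), forall x, P x} ->
  {ae (@lebesgue_measure R), forall x, Q x}.
Proof.
move=> PQ [A [mA A0 sA]]; exists A; split => // x /= nQ; apply: sA => /= Px.
exact/nQ/PQ.
Qed.

Lemma ae_lebI {R : realType} (P Q : R -> Prop) :
  {ae (@lebesgue_measure R), forall x, P x} ->
  {ae (@lebesgue_measure R), forall x, Q x} ->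
  {ae (@lebesgue_measure R), forall x, P x /\ Q x}.
Proof.
move=> [A [mA A0 sA]] [B [mB B0 sB]]; exists (A `|` B); split.
- exact: measurableU.
- exact: null_set_setU.
- move=> x /= nPQ; have [Ax|Ax] := pselect (A x); first by left.
  right; apply: sB => /= Qx; apply: nPQ; split => //.
  by apply: contrapT => nP; apply: Ax; exact: sA.
Qed.

Section bochner.
Context {R : realType} {n a b : nat}.
Local Notation fld := ('rV[R]_n -> 'M[R]_(a, b)).
Local Notation leb1 := (@lebesgue_measure R).
Context {N : fld -> \bar R} (sN : eseminorm N).
Local Notation sset s k := (@step_set R n a b s k).
Local Notation sval s k := (@step_val R n a b s k).
Implicit Types (s : @step R n a b) (f : R -> fld) (D : set R) (g : R -> R).

(* A Borel version of [N \o f], which is itself only measurable up to a null set. *)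
Definition version D f g : Prop :=
  [/\ measurable_fun setT g, forall t, 0 <= g t, forall t, ((g t)%:E <= N (f t))%E &
      {ae leb1, forall t, D t -> N (f t) = (g t)%:E}].

Lemma eseminorm_cvg (x : fld) (u : nat -> fld) :
  (forall k, (N (u k) < +oo)%E) -> N (x - u k)%R @[k --> \oo] --> 0%E ->
  (N x < +oo)%E /\ N (u k) @[k --> \oo] --> N x.
Proof.
move=> uoo h.
have xoo : (N x < +oo)%E.
  have /fine_cvgP[[k _ hk] _] := h.
  apply: le_lt_trans (_ : (N (x - u k)%R + N (u k) < +oo)%E).
    by have := eseminormD sN (x - u k) (u k); rewrite subrK.
  apply: lte_add_pinfty => //.
  have := hk k (leqnn k); rewrite ge0_fin_numE//; exact: (eseminorm_ge0 sN).
split => //.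
have xfin : N x \is a fin_num by rewrite ge0_fin_numE ?(eseminorm_ge0 sN).
have dfin k : N (x - u k)%R \is a fin_num.
  rewrite ge0_fin_numE ?(eseminorm_ge0 sN)//.
  by apply: le_lt_trans (eseminormB sN _ _) _; exact: lte_add_pinfty.
apply: (@squeeze_cvge _ _ _ _ (fun k => N x - N (x - u k)%R)%E _
   (fun k => N x + N (x - u k)%R)%E).
- apply: nearW => k; apply/andP; split.
    rewrite leeBlDr//; have := eseminormD sN (u k) (x - u k).
    by rewrite addrC subrK.
  have := eseminormD sN x (u k - x); rewrite addrC subrK (eseminormBC sN).
  by [].
- rewrite -[X in _ --> X]sube0; apply: cvgeB => //; first by rewrite fin_num_adde_defl.
  exact: cvg_cst.
- rewrite -[X in _ --> X]adde0; apply: cvgeD => //; first by rewrite fin_num_adde_defl.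
  exact: cvg_cst.
Qed.

(** Off a null set [N \o f] is a pointwise limit of norms of step functions, which are measurable.
    The version is 0 on the null set and outside [D], hence below [N \o f] everywhere. *)
Lemma strongly_measurable_version D f : measurable D ->
  strongly_measurable N D f -> exists g, version D f g.
Proof.
move=> mD [s [hs [N0 [mN0 muN0 sN0]]]].
pose E := D `\` N0.
have mE : measurable E by exact: measurableD.
have hE t : E t -> (N (f t) < +oo)%E /\ N (step_fun (s k) t) @[k --> \oo] --> N (f t).
  move=> [Dt N0t]; apply: eseminorm_cvg => [k|].
    by rewrite step_funE; exact: step_at_fin.
  by apply: contrapT => h; apply: N0t; apply: sN0 => /= /(_ Dt).
pose g t := if t \in E then fine (N (f t)) else 0.
have gE t : E t -> N (f t) = (g t)%:E.
  move=> Et; rewrite /g mem_set// fineK// ge0_fin_numE ?(eseminorm_ge0 sN)//.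
  by case: (hE t Et).
exists g; split.
- apply/measurable_EFinP.
  apply: (emeasurable_fun_cvg (fun k => (fun t => N (step_fun (s k) t)) \_ E)) => [k|t _].
    by apply/(measurable_restrictT _ mE); exact: measurable_norm_step.
  rewrite /g /=; have [Et|Et] := pselect (E t).
    have [_] := hE t Et; rewrite gE// /g mem_set//.
    by apply: cvg_trans; apply: near_eq_cvg; apply: nearW => k; rewrite patchE mem_set.
  rewrite memNset//; apply: cvg_near_cst; apply: nearW => k.
  by rewrite patchE memNset.
- by move=> t; rewrite /g; case: ifP => // _; rewrite fine_ge0// (eseminorm_ge0 sN).
- move=> t; have [Et|Et] := pselect (E t); first by rewrite gE.
  by rewrite /g memNset// (eseminorm_ge0 sN).
- exists N0; split => // t /= h; apply: contrapT => N0t; apply: h => Dt.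
  exact: gE.
Qed.

Lemma version_integral_ge D D' f g : measurable D -> D `<=` D' -> version D' f g ->
  (\int[leb1]_(t in D) (g t)%:E <= \int[leb1]_(t in D) N (f t))%E.
Proof.
move=> mD DD' [mg g0 gf ae]; apply: lower_integral_le => t _; last exact: gf.
by rewrite lee_fin.
Qed.

Lemma version_integral D f g : measurable D -> version D f g ->
  (\int[leb1]_(t in D) (g t)%:E = \int[leb1]_(t in D) N (f t))%E.
Proof.
move=> mD v; apply/eqP; rewrite eq_le (version_integral_ge mD _ v)//=.
case: v => mg g0 gf ae; apply: ae_lower_integral_le => //.
- by move=> t _; exact: (eseminorm_ge0 sN).
- by apply/measurable_EFinP; exact: measurable_funTS.
- by move=> t _; rewrite lee_fin.
- by apply: ae_lebS ae => t h Dt; rewrite h.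
Qed.

(** Cutting the second step function off to [E] expresses a difference of integrals over two
    intervals as one integral over the larger one. *)
Definition step_diff s s' (E : set R) : @step R n a b := Step
  (fun k : 'I_(step_size s + step_size s') => match fintype.split k with
     | inl i => sset s i | inr j => E `&` sset s' j end)
  (fun k => match fintype.split k with inl i => sval s i | inr j => - sval s' j end).

Lemma step_diff_in s s' E : measurable E -> step_in N s -> step_in N s' ->
  step_in N (step_diff s s' E).
Proof.
move=> mE hs hs' k; rewrite /=; case: (fintype.split k) => i; first exact: hs.
have [h1 h2] := hs' i; split; first exact: measurableI.
by rewrite (eseminormN sN).
Qed.

Lemma step_fun_diff s s' E t :
  step_fun (step_diff s s' E) t = step_fun s t - \1_E t *: step_fun s' t.
Proof.
apply/funext => x; rewrite /step_fun /= big_split_ord /=; congr (_ + _).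
  by apply: eq_bigr => i _; rewrite (unsplitK (inl i)).
rewrite [RHS](_ : _ = - (\1_E t *: \sum_k (\1_(sset s' k) t *: sval s' k x)))//.
rewrite scaler_sumr -sumrN; apply: eq_bigr => i _.
rewrite (unsplitK (inr i)) indicI /= scalerN scalerA; congr (- (_ *: _)).
Qed.

Lemma step_int_diff s s' E D :
  step_int (step_diff s s' E) D = step_int s D - step_int s' (D `&` E).
Proof.
apply/funext => x; rewrite /step_int /= big_split_ord /=; congr (_ + _).
  by apply: eq_bigr => i _; rewrite (unsplitK (inl i)).
rewrite [RHS](_ : _ = - \sum_k (fine (leb1 (D `&` E `&` sset s' k)) *: sval s' k x))//.
rewrite -sumrN; apply: eq_bigr => i _.
by rewrite (unsplitK (inr i)) scalerN setIA.
Qed.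

Lemma strongly_measurableB D f s : step_in N s -> strongly_measurable N D f ->
  strongly_measurable N D (fun t => f t - step_fun s t).
Proof.
move=> hs [w [hw ae]]; exists (fun k => step_diff (w k) s setT); split.
  by move=> k; exact: step_diff_in.
apply: ae_lebS ae => t h Dt; apply: cvg_trans (h Dt); apply: near_eq_cvg.
apply: nearW => k; rewrite step_fun_diff indicT scale1r.
have e : f t - step_fun s t - (step_fun (w k) t - step_fun s t) =
    f t - step_fun (w k) t by rewrite opprB addrA subrK.
by congr N; first [exact: e|exact: (esym e)].
Qed.

Lemma cvge0_small (u : nat -> \bar R) (e : R) : 0 < e ->
  u k @[k --> \oo] --> 0%E -> \forall k \near \oo, (u k <= e%:E)%E.
Proof.
move=> e0 /fine_cvgP[ufin /cvgrPdist_le/(_ e e0) h].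
near=> k; have ukf : u k \is a fin_num by near: k.
have : `|0 - fine (u k)| <= e by near: k.
rewrite sub0r normrN => h1; rewrite -(fineK ukf) lee_fin.
exact: le_trans (ler_norm _) h1.
Unshelve. all: by end_near. Qed.

(** The two integrals have unrelated approximating step functions. Their difference, with the second
    one cut off to [[0, t]], is close to 0 on [[0, t]] and to [f'] on []t, s]], and the inequality
    for step functions applies to it. *)
Lemma bochner_integral_diff (t s : R) f' g (y z : fld) : 0 <= t -> t <= s ->
  bochner_integral N `[0, s] f' y -> bochner_integral N `[0, t] f' z ->
  version `[0, s] f' g ->
  (N (y - z)%R <= \int[leb1]_(x in `]t, s]) (g x)%:E)%E.
Proof.
move=> t0 ts [sm1 [s1 [h1 i1 e1]]] [sm2 [s2 [h2 i2 e2]]] vg.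
have [mg g0 gf aeg] := vg.
apply/lee_addgt0Pr => e e0.
(* Four errors add up: for each integral, the approximation of the integrand and that of the
   value. *)
have e4 : 0 < e / 4 by rewrite divr_gt0.
have [k] := filter_ex (filterI
  (filterI (cvge0_small e4 i1) (cvge0_small e4 e1))
  (filterI (cvge0_small e4 i2) (cvge0_small e4 e2))).
move=> [[{}i1 {}e1] [{}i2 {}e2]].
have sub_ts : `[0, t] `<=` `[0, s]%classic by apply: subset_itvl; rewrite bnd_simp.
(* The integral is additive on measurable functions only, so the norms of the approximation errors
   are replaced by their Borel versions. *)
have [w1 [mw1 w10 w1f ae1]] := strongly_measurable_version
  (measurable_itv `[0, s]) (strongly_measurableB (h1 k) sm1).
have [w2 [mw2 w20 w2f ae2]] := strongly_measurable_version
  (measurable_itv `[0, t]) (strongly_measurableB (h2 k) sm2).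
have v1 : (\int[leb1]_(x in `[0%R, s]) (w1 x)%:E <= (e / 4)%:E)%E.
  apply: le_trans i1; apply: lower_integral_le => x _; [by rewrite lee_fin|exact: w1f].
have v2 : (\int[leb1]_(x in `[0%R, t]) (w2 x)%:E <= (e / 4)%:E)%E.
  apply: le_trans i2; apply: lower_integral_le => x _; [by rewrite lee_fin|exact: w2f].
pose S := step_diff (s1 k) (s2 k) `[0, t].
have hS : step_in N S by apply: step_diff_in.
have fin_s : (leb1 `[0%R, s] < +oo)%E.
  by rewrite lebesgue_measure_itv; case: ifP => _; rewrite ltry.
have key : (N (step_int S `[0%R, s]) <= (e / 4)%:E + (e / 4)%:E +
    \int[leb1]_(x in `]t, s]) (g x)%:E)%E.
  apply: le_trans (norm_step_int sN (measurable_itv `[0, s]) fin_s hS) _.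
  have mE (w : R -> R) (D E : set R) : measurable_fun setT w -> measurable E ->
      measurable_fun D ((EFin \o w) \_ E).
    move=> mw mE; apply: measurable_funTS; apply/(measurable_restrictT _ mE).
    by apply/measurable_EFinP; exact: measurable_funTS.
  have pE (w : R -> R) (E : set R) : (forall x, 0 <= w x) ->
      forall x, (0 <= ((EFin \o w) \_ E) x)%E.
    by move=> w0; apply: erestrict_ge0 => x _; rewrite lee_fin.
  pose F x := ((w1 x)%:E + ((EFin \o w2) \_ `[0%R, t]) x + ((EFin \o g) \_ `]t, s]) x)%E.
  have mw : measurable_fun `[0%R, s] (EFin \o w1).
    by apply/measurable_EFinP; exact: measurable_funTS.
  have mF : measurable_fun `[0%R, s] F.
    by apply: emeasurable_funD; [apply: emeasurable_funD => //|]; exact: mE.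
  have F0 x : (0 <= F x)%E.
    by rewrite /F !adde_ge0 ?lee_fin// pE.
  have -> : (\int[leb1]_(x in `]t, s]) (g x)%:E =
      \int[leb1]_(x in `[0%R, s]) ((EFin \o g) \_ `]t, s]) x)%E.
    rewrite -integral_mkcondr; congr (integral _ _ _); apply/esym/setIidr.
    by apply: subset_itvr; rewrite bnd_simp.
  apply: (@le_trans _ _ (\int[leb1]_(x in `[0%R, s]) F x)%E).
    apply: ae_ge0_le_integral => //.
    - by move=> x _; exact: (eseminorm_ge0 sN).
    - exact: measurable_norm_step.
    apply: ae_lebS (ae_lebI ae1 (ae_lebI ae2 aeg)) => x [a1 [a2 a3]] xs.
    rewrite /F /= step_fun_diff !patchE.
    rewrite -(a1 xs).
    have [xt|xt] := pselect (`[0, t]%classic x).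
      rewrite indicE mem_set// scale1r [X in (_ + X)%E](_ : _ = 0%E); last first.
        rewrite memNset// /= in_itv/= => /andP[tx _].
        by move: xt; rewrite /= in_itv/= => /andP[_]; rewrite leNgt tx.
      rewrite adde0 /= -(a2 xt) (eseminormBC sN (f' x)).
      have := eseminormD sN (step_fun (s1 k) x - f' x) (f' x - step_fun (s2 k) x).
      by rewrite addrA subrK.
    rewrite indicE memNset// scale0r subr0 adde0 mem_set; last first.
      move: xs xt; rewrite /= !in_itv/= => /andP[-> ->]; rewrite andbT => /negP.
      by rewrite -ltNge.
    rewrite /= -(a3 xs) (eseminormBC sN (f' x)).
    have := eseminormD sN (step_fun (s1 k) x - f' x) (f' x).
    by rewrite subrK.
  rewrite ge0_integralD//; last 4 first.
  - by move=> x _; rewrite adde_ge0 ?lee_fin// pE.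
  - by apply: emeasurable_funD => //; exact: mE.
  - by move=> x _; exact: pE.
  - exact: mE.
  apply: leeD => //; rewrite ge0_integralD//; last 3 first.
  - by move=> x _; rewrite lee_fin.
  - by move=> x _; exact: pE.
  - exact: mE.
  apply: leeD => //.
  by rewrite -integral_mkcondr setIidr.
have -> : y - z = (y - step_int (s1 k) `[0, s]) - (z - step_int (s2 k) `[0, t])
    + step_int S `[0, s].
  rewrite /S step_int_diff setIidr// opprB addrACA subrK.
  by rewrite [step_int _ `[0, t] - z]addrC addrK.
apply: le_trans (eseminormD sN _ _) _.
have := eseminormB sN (y - step_int (s1 k) `[0, s]) (z - step_int (s2 k) `[0, t]).
move=> /(fun h => le_trans h (leeD e1 e2)) h.
apply: le_trans (leeD h key) _.
rewrite addeA [leRHS]addeC; apply: leeD => //.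
by rewrite -!EFinD lee_fin; lra.
Qed.

End bochner.
Arguments version {R n a b} N D f g.

(** * Indefinite integrals of nonnegative functions *)

Section cumulative.
Context {R : realType}.
Local Notation leb1 := (@lebesgue_measure R).
Variables (T : R) (g : R -> R).
Hypotheses (mg : measurable_fun setT g) (g0 : forall t, 0 <= g t).
Hypothesis goo : (\int[leb1]_(x in `[0%R, T]) (g x)%:E < +oo)%E.
Implicit Types t s : R.

Definition cumulative t : R := \int[leb1]_(x in `[0, t]) g x.

Lemma integral_sub_fin (D : set R) : measurable D -> D `<=` `[0, T] ->
  (\int[leb1]_(x in D) (g x)%:E = (\int[leb1]_(x in D) g x)%R%:E)%E.
Proof.
move=> mD DT.
have h0 : (0 <= \int[leb1]_(x in D) (g x)%:E)%E.
  by apply: integral_ge0 => x _; rewrite lee_fin.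
have hoo : (\int[leb1]_(x in D) (g x)%:E < +oo)%E.
  apply: le_lt_trans goo; apply: ge0_subset_integral => //.
  - by apply/measurable_EFinP; exact: measurable_funTS.
  - by move=> x _; rewrite lee_fin.
by rewrite /Rintegral fineK// ge0_fin_numE.
Qed.

Lemma cumulative_diff t s : 0 <= t -> t <= s -> s <= T ->
  (\int[leb1]_(x in `]t, s]) (g x)%:E = (cumulative s - cumulative t)%:E)%E.
Proof.
move=> t0 ts sT.
have sub1 : `[0, t] `<=` `[0, T]%classic.
  by apply: subset_itvl; rewrite bnd_simp (le_trans ts).
have sub2 : `]t, s] `<=` `[0, T]%classic.
  by apply: subset_itv; rewrite bnd_simp.
have e : (\int[leb1]_(x in `[0%R, s]) (g x)%:E = \int[leb1]_(x in `[0%R, t]) (g x)%:E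
    + \int[leb1]_(x in `]t, s]) (g x)%:E)%E.
  have mU : measurable_fun (`[0%R, t] `|` `]t, s]) (EFin \o g).
    by apply/measurable_EFinP; exact: measurable_funTS.
  have pU (x : R) : (`[0%R, t] `|` `]t, s])%classic x -> (0 <= (EFin \o g) x)%E.
    by rewrite lee_fin.
  have dU : [disjoint `[0%R, t]%classic & `]t, s]%classic].
    apply/disj_set2P; rewrite -subset0 => x [] /=; rewrite !in_itv/= => /andP[_ xt] /andP[tx _].
    by move: xt; rewrite leNgt tx.
  rewrite -(ge0_integral_setU leb1 (measurable_itv _) (measurable_itv _) mU pU dU).
  congr (integral _ _ _); apply/seteqP; split => x /=; rewrite !in_itv/=.
    move=> /andP[x0 xs]; have [xt|xt] := leP x t; [left|right];
      by rewrite ?x0 ?xs ?xt.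
  by case => /andP[h1 h2]; apply/andP; split; lra.
have e1 := integral_sub_fin (measurable_itv `[0, t]) sub1.
have sub3 : `[0, s] `<=` `[0, T]%classic by apply: subset_itvl; rewrite bnd_simp.
have e3 := integral_sub_fin (measurable_itv `[0, s]) sub3.
have e2 := integral_sub_fin (measurable_itv `]t, s]) sub2.
move: e; rewrite e1 e2 e3 -EFinD => -[e].
by congr EFin; rewrite /cumulative e addrC addKr.
Qed.

Lemma cumulative_lower t s X : 0 <= t -> t <= s -> s <= T ->
  {ae leb1, forall x, x \in `]t, s] -> X <= g x} ->
  X * (s - t) <= cumulative s - cumulative t.
Proof.
move=> t0 ts sT h; rewrite -lee_fin -cumulative_diff//.
have [X0|X0] := leP X 0.
  apply: le_trans (_ : (0 <= _)%E); last by apply: integral_ge0 => x _; rewrite lee_fin.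
  by rewrite lee_fin mulr_le0_ge0// subr_ge0.
have -> : ((X * (s - t))%:E = \int[leb1]_(x in `]t, s]) X%:E)%E.
  rewrite integral_cst//= lebesgue_measure_itv/= lte_fin.
  case: ifPn => [_|]; first by rewrite -EFinD -EFinM.
  rewrite -leNgt => st; have -> : s = t by apply/le_anti; rewrite st ts.
  by rewrite subrr mulr0 mule0.
apply: ae_ge0_le_integral => //.
- by move=> x _; rewrite lee_fin ltW.
- by move=> x _; rewrite lee_fin.
- by apply/measurable_EFinP; exact: measurable_funTS.
Qed.

Lemma cumulative_le t s : 0 <= t -> t <= s -> s <= T ->
  cumulative t <= cumulative s.
Proof.
move=> t0 ts sT; rewrite -subr_ge0 -lee_fin -cumulative_diff//.
by apply: integral_ge0 => x _; rewrite lee_fin.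
Qed.

Lemma cumulative0 : cumulative 0 = 0.
Proof. by rewrite /cumulative set_itv1 Rintegral_set1. Qed.

Lemma cumulative_end : (\int[leb1]_(x in `[0%R, T]) (g x)%:E = (cumulative T)%:E)%E.
Proof. exact: integral_sub_fin. Qed.

Lemma cumulative_continuous t e : 0 <= T -> t \in `[0, T] -> 0 < e ->
  exists2 d, 0 < d & forall s, s \in `[0, T] -> `|s - t| < d ->
    `|cumulative s - cumulative t| < e.
Proof.
move=> T0 tT e0.
have ig : leb1.-integrable `[0, T] (EFin \o g).
  apply/integrableP; split; first by apply/measurable_EFinP; exact: measurable_funTS.
  by under eq_integral do rewrite /= ger0_norm//.
have /subspace_continuousP/(_ t tT) := parameterized_integral_continuous T0 ig.
move=> /cvgrPdist_lt/(_ e e0); rewrite near_withinE => /nbhs_ballP[d /= d0 hd].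
exists d => // s sT st; rewrite distrC; apply: hd => //.
by rewrite -ball_normE /= distrC.
Qed.

End cumulative.

Lemma cumulative_sqr {R : realType} (T : R) (g : R -> R) t s :
  measurable_fun setT g -> (forall t, 0 <= g t) ->
  (\int[@lebesgue_measure R]_(x in `[0%R, T]) (g x)%:E < +oo)%E ->
  (\int[@lebesgue_measure R]_(x in `[0%R, T]) (g x ^+ 2)%:E < +oo)%E ->
  0 <= t -> t <= s -> s <= T ->
  (cumulative g s - cumulative g t) ^+ 2 <=
  (s - t) * (cumulative (fun x => g x ^+ 2) s - cumulative (fun x => g x ^+ 2) t).
Proof.
move=> mg g0 goo g2oo t0 ts sT.
have mg2 : measurable_fun setT (fun x => g x ^+ 2) by exact: measurable_funX.
have g20 x : 0 <= g x ^+ 2 by exact: sqr_ge0.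
have c1 := cumulative_diff mg g0 goo t0 ts sT.
have c2 := cumulative_diff mg2 g20 g2oo t0 ts sT.
set a := cumulative g s - _ in c1 *.
set b := cumulative _ s - _ in c2 *.
have [st|st] := leP s t.
  have -> : s = t by apply/le_anti; rewrite st ts.
  by rewrite /a subrr mul0r; have -> : s = t; [apply/le_anti; rewrite st ts|rewrite subrr expr0n].
have a0 : 0 <= a by rewrite subr_ge0; exact: (cumulative_le mg g0 goo).
have b0 : 0 <= b by rewrite subr_ge0; exact: (cumulative_le mg2 g20 g2oo).
pose l := a / (s - t).
have l0 : 0 <= l by rewrite divr_ge0// subr_ge0.
(* Integrate [2 l g <= g^2 + l^2] with [l] the mean value of [g]. *)
have h : 2 * l * a <= b + l ^+ 2 * (s - t).
  rewrite -lee_fin EFinM -c1 EFinD -c2.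
  have m1 : measurable_fun `]t, s] (EFin \o g).
    by apply/measurable_EFinP; exact: measurable_funTS.
  have m2 : measurable_fun `]t, s] (EFin \o (fun x => g x ^+ 2)).
    by apply/measurable_EFinP; exact: measurable_funTS.
  have -> : ((l ^+ 2 * (s - t))%:E =
      \int[@lebesgue_measure R]_(x in `]t, s]) (l ^+ 2)%:E)%E.
    by rewrite integral_cst//= lebesgue_measure_itv/= lte_fin st -EFinD -EFinM.
  have p1 (x : R) : `]t, s]%classic x -> (0 <= (g x)%:E)%E by rewrite lee_fin.
  have p2 (x : R) : `]t, s]%classic x -> (0 <= (g x ^+ 2)%:E)%E by rewrite lee_fin.
  have p3 (x : R) : `]t, s]%classic x -> (0 <= (l ^+ 2)%:E)%E by rewrite lee_fin sqr_ge0.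
  have k0 : 0 <= 2 * l by rewrite mulr_ge0.
  have m3 : measurable_fun `]t, s] (fun=> (l ^+ 2)%:E) by exact: measurable_cst.
  have e1 : (\int[@lebesgue_measure R]_(x in `]t, s]) ((2 * l)%:E * (g x)%:E) =
      (2 * l)%:E * \int[@lebesgue_measure R]_(x in `]t, s]) (g x)%:E)%E.
    by apply: ge0_integralZl_EFin => //; first [exact: m1|exact: p1].
  have e2 : (\int[@lebesgue_measure R]_(x in `]t, s]) ((g x ^+ 2)%:E + (l ^+ 2)%:E) =
      \int[@lebesgue_measure R]_(x in `]t, s]) (g x ^+ 2)%:E +
      \int[@lebesgue_measure R]_(x in `]t, s]) (l ^+ 2)%:E)%E.
    by apply: ge0_integralD => //; first [exact: m2|exact: p2|exact: p3].
  rewrite -e1 -e2.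
  apply: lower_integral_le => x xt; first by rewrite mule_ge0 ?lee_fin.
  by rewrite -EFinM -EFinD lee_fin; have := sqr_ge0 (g x - l); rewrite sqrrB; lra.
have st0 : s - t != 0 by rewrite subr_eq0 gt_eqF.
have la : l * (s - t) = a by rewrite /l divfK.
have h2 : a * l <= b by move: h; rewrite expr2 -(mulrA l l) la; lra.
have e : (s - t) * (a * l) = a * (l * (s - t)) by ring.
have -> : a ^+ 2 = (s - t) * (a * l) by rewrite e la expr2.
apply: ler_wpM2l; [by rewrite subr_ge0|exact: h2].
Qed.

(** * Lebesgue and Sobolev norms in time *)

Section Lr_spaces.
Context {R : realType} {n a b : nat}.
Local Notation fld := ('rV[R]_n -> 'M[R]_(a, b)).
Local Notation leb1 := (@lebesgue_measure R).
Context {N : fld -> \bar R} (sN : eseminorm N).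
Implicit Types (f : R -> fld) (g : R -> R).
Variable T : R.
Hypothesis T0 : 0 < T.

Lemma Lr_norm_ge0 r f : (0 <= Lr_norm T N r f)%E.
Proof. by rewrite /Lr_norm; case: ifP => _; rewrite ?Lnorm_ge0 ?leey. Qed.

Lemma W1r_norm_ge0 r f : (0 <= W1r_norm T N r f)%E.
Proof.
apply: adde_ge0; first exact: Lr_norm_ge0.
by apply: le_ereal_inf_tmp => _ [f' _ ->]; exact: Lr_norm_ge0.
Qed.

Lemma Lr_norm_fin r f : (Lr_norm T N r f < +oo)%E -> strongly_measurable N `[0, T] f.
Proof. by rewrite /Lr_norm; case: asboolP. Qed.

Lemma Lr_norm1E f g : strongly_measurable N `[0, T] f -> version N `[0, T] f g ->
  Lr_norm T N 1 f = (\int[leb1]_(x in `[0%R, T]) (g x)%:E)%E.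
Proof.
move=> sm v; rewrite /Lr_norm asboolT// Lnorm1 lower_integral_mrestr.
  rewrite (version_integral sN (measurable_itv `[0, T]) v).
  by apply: eq_integral => x _ /=; rewrite gee0_abs// (eseminorm_ge0 sN).
by move=> x; exact: abse_ge0.
Qed.

Lemma Lr_norm2E f g : strongly_measurable N `[0, T] f -> version N `[0, T] f g ->
  (Lr_norm T N 2%:E f `^ 2 = \int[leb1]_(x in `[0%R, T]) (g x ^+ 2)%:E)%E.
Proof.
move=> sm [mg g0 gf ae]; rewrite /Lr_norm asboolT// poweR_Lnorm//.
rewrite lower_integral_mrestr; last by move=> x; exact: poweR_ge0.
have e (x : R) : ((g x ^+ 2)%:E = `|(g x)%:E| `^ 2)%E.
  by rewrite /= ger0_norm// powR_mulrn.
have mg2 : measurable_fun `[0, T] (EFin \o (fun x => g x ^+ 2)).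
  by apply/measurable_EFinP; apply: measurable_funTS; exact: measurable_funX.
apply/eqP; rewrite eq_le; apply/andP; split.
  apply: ae_lower_integral_le => //.
  - by move=> x _; exact: poweR_ge0.
  - by move=> x _; rewrite lee_fin sqr_ge0.
  - by apply: ae_lebS ae => x h Dx; rewrite /= h// -e.
apply: ae_lower_integral_ge => //.
- by move=> x _; exact: poweR_ge0.
- by move=> x _; rewrite lee_fin sqr_ge0.
- by apply: ae_lebS ae => x h Dx; rewrite /= h// -e.
Qed.

Lemma Lr_norm1_data f : (Lr_norm T N 1 f < +oo)%E -> exists g,
  [/\ version N `[0, T] f g, (\int[leb1]_(x in `[0%R, T]) (g x)%:E < +oo)%E &
    Lr_norm T N 1 f = (cumulative g T)%:E].
Proof.
move=> foo; have sm := Lr_norm_fin foo.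
have [g v] := strongly_measurable_version sN (measurable_itv `[0, T]) sm.
have [mg g0 _ _] := v; move: foo; rewrite (Lr_norm1E sm v) => foo.
by exists g; split => //; rewrite cumulative_end.
Qed.

Lemma Lr_norm2_data f : (Lr_norm T N 2%:E f < +oo)%E -> exists g,
  [/\ version N `[0, T] f g, (\int[leb1]_(x in `[0%R, T]) (g x)%:E < +oo)%E,
      (\int[leb1]_(x in `[0%R, T]) (g x ^+ 2)%:E < +oo)%E &
      Lr_norm T N 2%:E f = (Num.sqrt (cumulative (fun x => g x ^+ 2) T))%:E].
Proof.
move=> foo; have sm := Lr_norm_fin foo.
have [g v] := strongly_measurable_version sN (measurable_itv `[0, T]) sm.
have [mg g0 _ _] := v.
have mg2 : measurable_fun setT (fun x => g x ^+ 2) by exact: measurable_funX.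
have g20 x : 0 <= g x ^+ 2 by exact: sqr_ge0.
have E := Lr_norm2E sm v.
have L0 := Lr_norm_ge0 2%:E f.
set L := Lr_norm T N 2%:E f in foo E L0 *.
have Lfin : L \is a fin_num by rewrite ge0_fin_numE.
move: E; rewrite -(fineK Lfin) /= powR_mulrn ?fine_ge0// => E.
have g2oo : (\int[leb1]_(x in `[0%R, T]) (g x ^+ 2)%:E < +oo)%E by rewrite -E ltry.
exists g; split => //.
  (* Square integrability implies integrability on a bounded interval, since [g <= g ^+ 2 + 1]. *)
  apply: (@le_lt_trans _ _ (\int[leb1]_(x in `[0%R, T]) ((g x ^+ 2)%:E + 1))%E).
    apply: lower_integral_le => x _; first by rewrite lee_fin.
    rewrite -EFinD lee_fin; have := sqr_ge0 (g x - 2^-1); rewrite sqrrB; lra.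
  rewrite ge0_integralD//; last 2 first.
  - by move=> x _; rewrite lee_fin.
  - by apply/measurable_EFinP; exact: measurable_funTS.
  apply: lte_add_pinfty => //.
  by rewrite integral_cst//= mul1e lebesgue_measure_itv; case: ifP => _; rewrite ltry.
congr EFin; move: E; rewrite (cumulative_end mg2 g20 g2oo) => -[<-].
by rewrite sqrtr_sqr ger0_norm// fine_ge0.
Qed.

Lemma Lr_norm12 f : (Lr_norm T N 1 f <= (Num.sqrt T)%:E * Lr_norm T N 2%:E f)%E.
Proof.
have sT : 0 < Num.sqrt T by rewrite sqrtr_gt0.
have [foo|] := ltP (Lr_norm T N 2%:E f) +oo%E; last first.
  by rewrite leye_eq => /eqP ->; rewrite gt0_muley ?lte_fin// leey.
have sm := Lr_norm_fin foo.
have [g [v g1 g2 ->]] := Lr_norm2_data foo.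
have [mg g0 _ _] := v.
rewrite (Lr_norm1E sm v) cumulative_end// -EFinM lee_fin -sqrtrM ?(ltW T0)//.
have c0 : 0 <= cumulative g T.
  by rewrite -(cumulative0 g); exact: (cumulative_le mg g0 g1 (lexx 0) (ltW T0) (lexx T)).
rewrite -(ger0_norm c0) -sqrtr_sqr ler_wsqrtr//.
have := cumulative_sqr mg g0 g1 g2 (lexx 0) (ltW T0) (lexx T).
by rewrite !cumulative0 !subr0.
Qed.

Lemma Lr_normy_le f M : strongly_measurable N `[0, T] f ->
  (forall t, t \in `[0, T] -> (N (f t) <= M%:E)%E) ->
  (Lr_norm T N +oo f <= M%:E)%E.
Proof.
move=> sm h; rewrite /Lr_norm asboolT// unlock.
have M0 : 0 <= M.
  have z : 0 \in `[0, T] by rewrite in_itv/= lexx ltW.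
  by rewrite -lee_fin (le_trans _ (h _ z))// (eseminorm_ge0 sN).
case: ifP => _; last by rewrite lee_fin.
apply/ess_supP; exists (~` `[0, T]); split.
- exact: measurableC.
- by rewrite -[LHS]/(leb1 (~` `[0, T] `&` `[0, T])) setICl measure0.
move=> t /= nh tT; apply: nh.
by rewrite /= gee0_abs ?(eseminorm_ge0 sN)// h.
Qed.

Lemma continuous_strongly_measurable f :
  (forall t, t \in `[0, T] -> (N (f t) < +oo)%E) ->
  (forall t e, t \in `[0, T] -> 0 < e -> exists2 d, 0 < d &
     forall s, s \in `[0, T] -> `|s - t| < d -> (N (f t - f s)%R <= e%:E)%E) ->
  strongly_measurable N `[0, T] f.
Proof.
move=> foo cf.
pose dl k : R := T / k.+1%:R.
have dl0 k : 0 < dl k by rewrite divr_gt0.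
(* There are [k.+2] half-open intervals of length [T / k.+1]: the last one starts at [T], so that
   the endpoint is covered as well. *)
pose s k : @step R n a b := Step
  (fun j : 'I_k.+2 => [set t : R | t \in `[j%:R * dl k, j.+1%:R * dl k[])
  (fun j : 'I_k.+2 => f (j%:R * dl k)).
have jT k (j : nat) : (j < k.+2)%N -> j%:R * dl k \in `[0, T].
  move=> jk; rewrite in_itv/= mulr_ge0 ?(ltW (dl0 k))//=.
  by rewrite mulrA ler_pdivrMr// mulrC ler_pM2l// ler_nat.
exists s; split.
  by move=> k j; split; [exact: measurable_itv|apply: foo; exact: jT].
exists set0; split => //; rewrite ?measure0// => t /= nh; apply: nh => tT.
have /andP[t0 tT'] : 0 <= t <= T by move: tT; rewrite /= in_itv.
pose j k := Num.truncn (t / dl k).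
have jitv k : (j k)%:R * dl k <= t < (j k).+1%:R * dl k.
  have := @truncn_itv _ (t / dl k) ltac:(by rewrite divr_ge0// ltW).
  by rewrite ler_pdivlMr// ltr_pdivrMr.
have jk k : (j k < k.+2)%N.
  rewrite ltnS -(ler_nat R) -(ler_pM2r (dl0 k)).
  case/andP: (jitv k) => h _; apply: le_trans h (le_trans tT' _).
  by rewrite /dl mulrC divfK// pnatr_eq0.
have sE k : step_fun (s k) t = f ((j k)%:R * dl k).
  apply/funext => x; rewrite /step_fun (bigD1 (Ordinal (jk k)))//= big1 ?addr0.
    by rewrite indicE mem_set ?scale1r//= in_itv/= jitv.
  move=> i ij; rewrite indicE memNset ?scale0r//= in_itv/= => /andP[h1 h2].
  have /andP[h3 h4] := jitv k.
  have := le_lt_trans h1 h4; have := le_lt_trans h3 h2.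
  rewrite !ltr_pM2r// !ltr_nat !ltnS => h5 h6.
  by move: ij; rewrite -val_eqE /= eqn_leq h5 h6.
have hN k : N (fun x => f t x - step_fun (s k) t x) = N (f t - f ((j k)%:R * dl k)).
  by rewrite sE.
under eq_fun do rewrite hN.
have small e : 0 < e -> \forall k \near \oo, (N (f t - f ((j k)%:R * dl k))%R <= e%:E)%E.
  move=> e0; have [d d0 hd] := cf t e tT e0.
  near=> k; apply: hd; first exact: jT.
  have /andP[h3 h4] := jitv k.
  have hk : dl k < d.
    near: k; exists (Num.truncn (T / d)) => // k /= hk.
    rewrite /dl ltr_pdivrMr// mulrC -ltr_pdivrMr//.
    have /andP[_] := @truncn_itv _ (T / d) ltac:(by rewrite divr_ge0// ltW).
    by move=> /lt_le_trans; apply; rewrite ler_nat ltnS.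
  move: h4; rewrite -natr1 mulrDl mul1r ltr_norml => h4; lra.
apply/fine_cvgP; split.
  by near=> k; rewrite ge0_fin_numE ?(eseminorm_ge0 sN)//;
    apply: (@le_lt_trans _ _ 1%:E); [near: k; exact: small|rewrite ltry].
apply/cvgrPdist_le => e e0; near=> k; rewrite sub0r normrN.
have h : (N (f t - f ((j k)%:R * dl k))%R <= e%:E)%E by near: k; exact: small.
have fk : N (f t - f ((j k)%:R * dl k))%R \is a fin_num.
  by rewrite ge0_fin_numE ?(eseminorm_ge0 sN)// (le_lt_trans h)// ltry.
by rewrite ger0_norm ?fine_ge0 ?(eseminorm_ge0 sN)// -lee_fin fineK.
Unshelve. all: by end_near. Qed.

Lemma W1r_normP r f e : (W1r_norm T N r f < +oo)%E -> 0 < e ->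
  exists f', [/\ primitive T N f f', (Lr_norm T N r f < +oo)%E,
    (Lr_norm T N r f' < +oo)%E &
    (Lr_norm T N r f + Lr_norm T N r f' <= W1r_norm T N r f + e%:E)%E].
Proof.
rewrite /W1r_norm; set S := [set y | _] => Woo e0.
have L0 := Lr_norm_ge0 r f.
have S0 : (0 <= ereal_inf S)%E.
  by apply: le_ereal_inf_tmp => _ [f' _ ->]; exact: Lr_norm_ge0.
have Loo : (Lr_norm T N r f < +oo)%E by apply: le_lt_trans Woo; rewrite leeDl.
have Soo : (ereal_inf S < +oo)%E by apply: le_lt_trans Woo; rewrite leeDr.
have Sfin : ereal_inf S \is a fin_num by rewrite ge0_fin_numE.
have [_ [f' pf ->] h] := lb_ereal_inf_adherent e0 Sfin.
exists f'; split => //; first by apply: lt_trans h _; rewrite -(fineK Sfin) -EFinD ltry.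
by rewrite -addeA leeD// ltW.
Qed.

Lemma lee_real_ub (x : \bar R) (c : R) : (0 <= x)%E ->
  (forall X, (X%:E <= x)%E -> X <= c) -> (x <= c%:E)%E.
Proof.
case: x => [x| |]// _ h; first by rewrite lee_fin h.
by have := h (c + 1) (leey _); rewrite gerDl ler10.
Qed.

Lemma primitive_diff f f' g t s : primitive T N f f' -> version N `[0, T] f' g ->
  0 <= t -> t <= s -> s <= T ->
  (N (f s - f t)%R <= \int[leb1]_(x in `]t, s]) (g x)%:E)%E.
Proof.
move=> pf [mg g0 gf ae] t0 ts sT.
have tT : t \in `[0, T] by rewrite in_itv/= t0 (le_trans ts).
have sT' : s \in `[0, T] by rewrite in_itv/= sT (le_trans t0).
have v : version N `[0, s] f' g.
  split => //; apply: ae_lebS ae => x h xs; apply: h.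
  by move: xs; rewrite /= !in_itv/= => /andP[-> /le_trans]; apply.
have := bochner_integral_diff sN t0 ts (pf s sT') (pf t tT) v.
rewrite (_ : (fun x => f s x - f 0 x) - _ = f s - f t)//.
rewrite -[LHS]/((f s - f 0) - (f t - f 0)).
by rewrite opprB addrA subrK.
Qed.

(** The norm of [f t] is at most that of [f x] plus the integral of the norm of [f']; averaging over
    [x] in J gives the factor [T^-1]. This is the origin of the constant [T^-1 + 1] below. *)
Lemma primitive_sup f f' g gf : primitive T N f f' -> version N `[0, T] f' g ->
  (\int[leb1]_(x in `[0%R, T]) (g x)%:E < +oo)%E ->
  version N `[0, T] f gf -> (\int[leb1]_(x in `[0%R, T]) (gf x)%:E < +oo)%E ->
  forall t, t \in `[0, T] -> (N (f t) <= (T^-1 * cumulative gf T + cumulative g T)%:E)%E.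
Proof.
move=> pf v goo vf gfoo t; rewrite in_itv/= => /andP[t0 tT].
have [mg g0 _ _] := v; have [mf f0 _ aef] := vf.
(* [N (f t)] is not yet known to be finite, so its real lower bounds [X] are estimated instead. *)
apply: lee_real_ub; first exact: (eseminorm_ge0 sN).
move=> X hX.
have hd x : x \in `[0, T] -> (N (f t - f x)%R <= (cumulative g T)%:E)%E.
  rewrite in_itv/= => /andP[x0 xT].
  have mono y z : 0 <= y -> y <= z -> z <= T -> cumulative g y <= cumulative g z.
    exact: (cumulative_le mg g0 goo).
  have c0 y : 0 <= y -> y <= T -> 0 <= cumulative g y.
    by move=> y0 yT; rewrite -(cumulative0 g); exact: mono.
  have [tx|xt] := leP t x.
    rewrite (eseminormBC sN) (le_trans (primitive_diff pf v t0 tx xT))//.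
    rewrite (cumulative_diff mg g0 goo)// lee_fin.
    by have := mono _ _ x0 xT (lexx T); have := c0 _ t0 tT; lra.
  rewrite (le_trans (primitive_diff pf v x0 (ltW xt) tT))//.
  rewrite (cumulative_diff mg g0 goo) ?(ltW xt)// lee_fin.
  by have := mono _ _ t0 tT (lexx T); have := c0 _ x0 xT; lra.
have := @cumulative_lower _ T gf mf f0 gfoo 0 T (X - cumulative g T) (lexx 0) (ltW T0) (lexx T).
rewrite cumulative0 !subr0 => H.
suff /H : {ae leb1, forall x, x \in `]0, T] -> X - cumulative g T <= gf x}.
  by rewrite -ler_pdivlMr// mulrC; lra.
apply: ae_lebS aef => x h xT.
have xT' : x \in `[0, T] by move: xT; rewrite !in_itv/= => /andP[/ltW -> ->].
rewrite -lee_fin -h// EFinB leeBlDr//.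
apply: le_trans hX _; have := eseminormD sN (f x) (f t - f x).
by rewrite addrC subrK => /le_trans; apply; rewrite leeD// hd.
Qed.

(** [Phi] plays the part of the indefinite integral of the norm of the weak derivative; the energy
    estimates use the derivative through such bounds on increments only. *)
Definition modulus (Phi : R -> R) f : Prop :=
  [/\ Phi 0 = 0,
      forall t s, 0 <= t -> t <= s -> s <= T -> Phi t <= Phi s &
      forall t s, 0 <= t -> t <= s -> s <= T -> (N (f s - f t)%R <= (Phi s - Phi t)%:E)%E].

Definition modulus_continuous (Phi : R -> R) : Prop :=
  forall t e, t \in `[0, T] -> 0 < e -> exists2 d, 0 < d &
    forall s, s \in `[0, T] -> `|s - t| < d -> `|Phi s - Phi t| < e.

(** The real-valued data that the energy estimates need from Bochner theory. The slack [e] is due to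
    the infimum over weak derivatives; [w] bounds both the total increment and, up to a constant,
    all values. *)
Lemma W11_data f e : (W1r_norm T N 1 f < +oo)%E -> 0 < e -> exists Phi w,
  [/\ modulus Phi f, modulus_continuous Phi,
      Phi T <= w /\ (w%:E <= W1r_norm T N 1 f + e%:E)%E &
      forall t, t \in `[0, T] -> (N (f t) <= ((T^-1 + 1) * w)%:E)%E].
Proof.
move=> Woo e0; have [f' [pf L1 L2 h]] := W1r_normP Woo e0.
have [gf [vf gfoo Ef]] := Lr_norm1_data L1.
have [g [v goo E]] := Lr_norm1_data L2.
have [mg g0 _ _] := v; have [mf f0 _ _] := vf.
have c1 : 0 <= cumulative gf T.
  by rewrite -(cumulative0 gf); exact: (cumulative_le mf f0 gfoo (lexx 0) (ltW T0) (lexx T)).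
have c2 : 0 <= cumulative g T.
  by rewrite -(cumulative0 g); exact: (cumulative_le mg g0 goo (lexx 0) (ltW T0) (lexx T)).
have Ti : 0 <= T^-1 by rewrite invr_ge0 ltW.
exists (cumulative g), (cumulative gf T + cumulative g T); split.
- split; first exact: cumulative0.
    exact: (cumulative_le mg g0 goo).
  move=> t s t0 ts sT; rewrite -(cumulative_diff mg g0 goo)//.
  exact: primitive_diff pf v _ _ _.
- move=> t d tT d0; exact: (cumulative_continuous mg g0 goo (ltW T0) tT d0).
- by split; [rewrite lerDr|rewrite EFinD -Ef -E].
- move=> t tT; apply: le_trans (primitive_sup pf v goo vf gfoo tT) _.
  by rewrite lee_fin; nra.
Qed.

(** [Phi] and [Phi2] integrate the same norm and its square, and are related by the Cauchy-Schwarz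
    inequality on []t, s]]. No bound on the values of [f] is recorded: the estimate of the flux sees
    the stress, the pressure and the rotation through increments only. *)
Lemma W12_data f e : (W1r_norm T N 2%:E f < +oo)%E -> 0 < e -> exists Phi Phi2 w,
  [/\ modulus Phi f, modulus_continuous Phi, Phi2 0 = 0 /\
        (forall t s, 0 <= t -> t <= s -> s <= T -> Phi2 t <= Phi2 s),
      forall t s, 0 <= t -> t <= s -> s <= T ->
        (Phi s - Phi t) ^+ 2 <= (s - t) * (Phi2 s - Phi2 t) &
      [/\ 0 <= w, Phi2 T <= w ^+ 2 & (w%:E <= W1r_norm T N 2%:E f + e%:E)%E]].
Proof.
move=> Woo e0; have [f' [pf L1 L2 h]] := W1r_normP Woo e0.
have [g [v goo g2oo E]] := Lr_norm2_data L2.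
have [mg g0 _ _] := v.
have mg2 : measurable_fun setT (fun x => g x ^+ 2) by exact: measurable_funX.
have g20 x : 0 <= g x ^+ 2 by exact: sqr_ge0.
have c2 : 0 <= cumulative (fun x => g x ^+ 2) T.
  by rewrite -(cumulative0 (fun x => g x ^+ 2));
    exact: (cumulative_le mg2 g20 g2oo (lexx 0) (ltW T0) (lexx T)).
exists (cumulative g), (cumulative (fun x => g x ^+ 2)),
  (Num.sqrt (cumulative (fun x => g x ^+ 2) T)); split.
- split; first exact: cumulative0.
    exact: (cumulative_le mg g0 goo).
  move=> t s t0 ts sT; rewrite -(cumulative_diff mg g0 goo)//.
  exact: primitive_diff pf v _ _ _.
- move=> t d tT d0; exact: (cumulative_continuous mg g0 goo (ltW T0) tT d0).
- split; first exact: cumulative0.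
  exact: (cumulative_le mg2 g20 g2oo).
- by move=> t s t0 ts sT; exact: (cumulative_sqr mg g0 goo g2oo).
- split; [exact: sqrtr_ge0|by rewrite sqr_sqrtr|].
  rewrite -E; apply: le_trans h; rewrite leeDr//; exact: Lr_norm_ge0.
Qed.

(** The integral of the squared norm is used through constant lower bounds on short intervals, which
    asks for no measurability of the quantity bounded. Such a bound has to be checked only where the
    norm is finite, hence only where the interpolation of [f x] is under control. *)
Lemma L2_data f : (Lr_norm T N 2%:E f < +oo)%E -> exists Psi w,
  [/\ Psi 0 = 0,
      forall t s, 0 <= t -> t <= s -> s <= T -> Psi t <= Psi s,
      forall t s X, 0 <= t -> t <= s -> s <= T ->
        (forall x y, x \in `]t, s] -> N (f x) = y%:E -> X <= y ^+ 2) ->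
        X * (s - t) <= Psi s - Psi t &
      [/\ 0 <= w, Psi T <= w ^+ 2 & w%:E = Lr_norm T N 2%:E f]].
Proof.
move=> foo; have [g [v goo g2oo E]] := Lr_norm2_data foo.
have [mg g0 _ ae] := v.
have mg2 : measurable_fun setT (fun x => g x ^+ 2) by exact: measurable_funX.
have g20 x : 0 <= g x ^+ 2 by exact: sqr_ge0.
have c2 : 0 <= cumulative (fun x => g x ^+ 2) T.
  by rewrite -(cumulative0 (fun x => g x ^+ 2));
    exact: (cumulative_le mg2 g20 g2oo (lexx 0) (ltW T0) (lexx T)).
exists (cumulative (fun x => g x ^+ 2)),
  (Num.sqrt (cumulative (fun x => g x ^+ 2) T)); split.
- exact: cumulative0.
- exact: (cumulative_le mg2 g20 g2oo).
- move=> t s X t0 ts sT h; apply: (cumulative_lower mg2 g20 g2oo) => //.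
  apply: ae_lebS ae => x hx xts; apply: (h x (g x)) => //; apply: hx.
  move: xts; rewrite /= !in_itv/= => /andP[tx xs].
  by rewrite (le_trans t0 (ltW tx)) (le_trans xs sT).
- by split; [exact: sqrtr_ge0|rewrite sqr_sqrtr|rewrite E].
Qed.

Lemma W1r_norm12 f :
  (W1r_norm T N 1 f <= (Num.sqrt T)%:E * W1r_norm T N 2%:E f)%E.
Proof.
have sT : 0 < Num.sqrt T by rewrite sqrtr_gt0.
have [Woo|] := ltP (W1r_norm T N 2%:E f) +oo%E; last first.
  by rewrite leye_eq => /eqP ->; rewrite gt0_muley ?lte_fin// leey.
apply/lee_addgt0Pr => e e0.
have e'0 : 0 < e / Num.sqrt T by rewrite divr_gt0.
have [f' [pf L1 L2 h]] := W1r_normP Woo e'0.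
apply: (@le_trans _ _ (Lr_norm T N 1 f + Lr_norm T N 1 f')%E).
  by rewrite leeD//; apply: ereal_inf_lbound; exists f'.
apply: le_trans (leeD (Lr_norm12 f) (Lr_norm12 f')) _.
rewrite -muleDr//; last by rewrite ge0_adde_def// inE Lr_norm_ge0.
have := @lee_wpmul2l _ (Num.sqrt T)%:E _ _ _ h; rewrite lee_fin (ltW sT) => /(_ isT).
move=> /le_trans; apply.
rewrite muleDr//; last first.
  by rewrite ge0_adde_def// inE ?lee_fin ?(ltW e'0)// /W1r_norm adde_ge0 ?Lr_norm_ge0//;
    apply: le_ereal_inf_tmp => _ [f'' _ ->]; exact: Lr_norm_ge0.
by rewrite leeD// -EFinM lee_fin mulrC divfK// gt_eqF.
Qed.

(** On a bounded interval the supremum bound of [W11_data] controls the norm in [L^2]. *)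
Lemma Lr_norm2_W11 f :
  (Lr_norm T N 2%:E f <= (Num.sqrt T * (T^-1 + 1))%:E * W1r_norm T N 1 f)%E.
Proof.
have sT : 0 < Num.sqrt T by rewrite sqrtr_gt0.
have Ti : 0 < T^-1 + 1 by rewrite addr_gt0// invr_gt0.
have k0 : 0 < Num.sqrt T * (T^-1 + 1) by rewrite mulr_gt0.
have [Woo|] := ltP (W1r_norm T N 1 f) +oo%E; last first.
  by rewrite leye_eq => /eqP ->; rewrite gt0_muley ?lte_fin// leey.
apply/lee_addgt0Pr => e e0.
have e'0 : 0 < e / (Num.sqrt T * (T^-1 + 1)) by rewrite divr_gt0.
have [Phi [w [_ _ [_ hw] hs]]] := W11_data Woo e'0.
have [f' [_ L1 _ _]] := W1r_normP Woo e'0.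
have sm := Lr_norm_fin L1.
have [g v] := strongly_measurable_version sN (measurable_itv `[0, T]) sm.
have [mg g0 gf ae] := v.
have w0 : 0 <= (T^-1 + 1) * w.
  have z : 0 \in `[0, T] by rewrite in_itv/= lexx ltW.
  by rewrite -lee_fin (le_trans _ (hs _ z))// (eseminorm_ge0 sN).
have h : (Lr_norm T N 2%:E f <= (Num.sqrt T * ((T^-1 + 1) * w))%:E)%E.
  have L0 := Lr_norm_ge0 2%:E f.
  have E := Lr_norm2E sm v.
  have : (\int[leb1]_(x in `[0%R, T]) (g x ^+ 2)%:E <= (T * ((T^-1 + 1) * w) ^+ 2)%:E)%E.
    apply: (@le_trans _ _ (\int[leb1]_(x in `[0%R, T]) (((T^-1 + 1) * w) ^+ 2)%:E)%E).
      apply: lower_integral_le => x xT; rewrite lee_fin ?sqr_ge0//.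
      rewrite ler_pXn2r// ?nnegrE// -lee_fin.
      exact: le_trans (gf x) (hs x xT).
    rewrite integral_cst//= lebesgue_measure_itv/= lte_fin T0 sube0 -EFinM lee_fin.
    by rewrite mulrC.
  rewrite -E; move: L0; case: (Lr_norm T N 2%:E f) => [l| |]//; last first.
    by move=> _; rewrite poweRyr// leye_eq.
  rewrite lee_fin => l0; rewrite /= powR_mulrn// !lee_fin => hl.
  have p0 := mulr_ge0 (ltW sT) w0.
  rewrite -(ler_pXn2r (n := 2))//.
  by rewrite [leRHS]exprMn sqr_sqrtr// ltW.
apply: le_trans h _; rewrite mulrA EFinM.
have := @lee_wpmul2l _ (Num.sqrt T * (T^-1 + 1))%:E _ _ _ hw.
rewrite lee_fin (ltW k0) => /(_ isT) /le_trans; apply.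
rewrite muleDr//; last first.
  by rewrite ge0_adde_def// inE ?lee_fin ?(ltW e'0)// /W1r_norm adde_ge0 ?Lr_norm_ge0//;
    apply: le_ereal_inf_tmp => _ [f'' _ ->]; exact: Lr_norm_ge0.
by rewrite leeD// -EFinM lee_fin mulrC divfK// gt_eqF.
Qed.

End Lr_spaces.

Arguments modulus {R n a b} N T Phi f.

(** * Differential inequalities and the energy estimates *)

Section differential_inequality.
Context {R : realType}.
Implicit Types (K G : R -> R) (T : R).

Definition continuous_on T K : Prop :=
  forall t e, t \in `[0, T] -> 0 < e -> exists2 d, 0 < d &
    forall s, s \in `[0, T] -> `|s - t| < d -> `|K s - K t| < e.

Definition nondecreasing_on T G : Prop :=
  forall t s, 0 <= t -> t <= s -> s <= T -> G t <= G s.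

(* [G] need not be continuous, so that integrals of merely integrable functions
   can serve as right-hand sides. *)
Lemma nonincreasing_from_left T K G : 0 <= T ->
  continuous_on T K -> nondecreasing_on T G ->
  (forall s e, 0 < s -> s <= T -> 0 < e -> exists2 d, 0 < d &
     forall t, 0 <= t -> s - d < t -> t < s ->
       K s - K t <= G s - G t + e * (s - t)) ->
  K T - K 0 <= G T - G 0.
Proof.
move=> T0 cK mG loc.
suff H e : 0 < e -> K T - K 0 <= G T - G 0 + e * T.
  apply/ler_addgt0Pr => e e0.
  have T1 : 0 < T + 1 by lra.
  have := H (e / (T + 1)) (divr_gt0 e0 T1).
  move=> /le_trans; apply; rewrite lerD2l mulrAC ler_pdivrMr//.
  by rewrite ler_pM2l//; lra.
move=> e0.
pose S := [set t : R | t \in `[0, T] /\ K T - K t <= G T - G t + e * (T - t)].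
have TS : S T by split; [rewrite in_itv/= T0 lexx|lra].
have lS : has_lbound S by exists 0 => t [+ _]; rewrite in_itv/= => /andP[].
have iS : has_inf S by split => //; exists T.
pose m := inf S.
have m0 : 0 <= m.
  by apply: lb_le_inf; [exists T|move=> t [+ _]; rewrite in_itv/= => /andP[]].
have mT : m <= T by exact: ge_inf.
(* Points of [S] tend to [m] from the right: [K] passes to the limit, and [G m <= G t] has the
   favorable sign. *)
have Sm : S m.
  split; first by rewrite in_itv/= m0.
  apply/ler_addgt0Pr => h h0.
  have mI : m \in `[0, T] by rewrite in_itv/= m0.
  have [d d0 hd] := cK m h mI h0.
  have [t [tT tS] tm] := inf_adherent d0 iS.
  have mt : m <= t by apply: ge_inf.
  have /(hd _ tT) : `|t - m| < d by rewrite ger0_norm ?subr_ge0//; rewrite -/m in tm; lra.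
  move: tT; rewrite in_itv/= => /andP[t0 tT].
  have := mG _ _ m0 mt tT.
  have : e * (T - t) <= e * (T - m) by rewrite ler_pM2l//; lra.
  rewrite ltr_norml => h1 h2 /andP[h3 h4]; lra.
have [m00|mpos] := leP m 0.
  have mE : m = 0 by apply/le_anti; rewrite m00 m0.
  by case: Sm => _; rewrite mE subr0.
have [d d0 hd] := loc m e mpos mT e0.
pose t := Num.max 0 (m - d / 2).
have t0 : 0 <= t by rewrite le_max lexx.
have tm : t < m by rewrite gt_max mpos/=; lra.
have td : m - d < t by rewrite lt_max; apply/orP; right; lra.
have h1 := hd t t0 td tm.
suff : S t by move=> /(ge_inf lS); rewrite -/m leNgt tm.
split; first by rewrite in_itv/= t0; lra.
case: Sm => _ h2; have : e * (T - t) = e * (T - m) + e * (m - t) by ring.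
lra.
Qed.

Lemma continuous_on_max T K : 0 <= T -> continuous_on T K ->
  exists2 m, m \in `[0, T] & forall t, t \in `[0, T] -> K t <= K m.
Proof.
move=> T0 cK; apply: EVT_max => //.
apply/subspace_continuousP => t tT; apply/cvgrPdist_lt => e e0.
have [d d0 hd] := cK t e tT e0; rewrite near_withinE.
apply/nbhs_ballP; exists d => //= s; rewrite -ball_normE /= => ts sT.
by rewrite distrC hd// distrC.
Qed.

(** With [M] the maximum of the square root of [K], the hypothesis becomes
    [M ^+ 2 <= K 0 + M * a + b], and an [M] larger than the stated sum would violate it. No factor
    exponential in [T] arises. *)
Lemma energy_closure T K a b : 0 <= T -> continuous_on T K ->
  (forall t, 0 <= K t) -> 0 <= a -> 0 <= b ->
  (forall M, 0 <= M -> (forall t, t \in `[0, T] -> Num.sqrt (K t) <= M) ->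
     forall t, t \in `[0, T] -> K t <= K 0 + M * a + b) ->
  forall t, t \in `[0, T] -> Num.sqrt (K t) <= a + Num.sqrt (K 0) + Num.sqrt b.
Proof.
move=> T0 cK K0 a0 b0 H.
have [m mT hm] := continuous_on_max T0 cK.
pose M := Num.sqrt (K m).
have M0 : 0 <= M by exact: sqrtr_ge0.
have hM t : t \in `[0, T] -> Num.sqrt (K t) <= M by move=> tT; rewrite ler_wsqrtr// hm.
have Mm := H M M0 hM m mT.
have zT : 0 \in `[0, T] by rewrite in_itv/= lexx.
suff hh : M <= a + Num.sqrt (K 0) + Num.sqrt b.
  by move=> t tT; apply: le_trans (hM t tT) hh.
rewrite leNgt; apply/negP => lt.
have k0 := sqrtr_ge0 (K 0); have q0 := sqrtr_ge0 b.
have k2 := sqr_sqrtr (K0 0); have q2 := sqr_sqrtr b0; have M2 := sqr_sqrtr (K0 m).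
have Mp : 0 < M by lra.
have h1 : M * (a + Num.sqrt (K 0) + Num.sqrt b) < M ^+ 2 by rewrite expr2 ltr_pM2l.
have h2 : Num.sqrt (K 0) ^+ 2 <= M * Num.sqrt (K 0).
  by rewrite expr2 ler_wpM2r// hM.
have h3 : Num.sqrt b ^+ 2 <= M * Num.sqrt b by rewrite expr2 ler_wpM2r//; lra.
by move: h1; rewrite -/M in M2; rewrite M2 !mulrDr; lra.
Qed.

End differential_inequality.

(** * Curves continuous for a semidefinite form *)

Section continuity_in_form.
Context {R : realType} {V : lmodType R} (T : R).
Implicit Types (B : form V) (x : R -> V).

Definition form_continuous_on B x : Prop :=
  forall t e, t \in `[0, T] -> 0 < e -> exists2 d, 0 < d &
    forall s, s \in `[0, T] -> `|s - t| < d -> fnorm B (x s - x t) < e.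

Lemma form_continuousB B x y : form_continuous_on B x -> form_continuous_on B y ->
  form_continuous_on B (fun t => x t - y t).
Proof.
move=> cx cy t e tT e0; have e2 : 0 < e / 2 by lra.
have [d1 d10 h1] := cx t _ tT e2; have [d2 d20 h2] := cy t _ tT e2.
exists (Num.min d1 d2); first by rewrite lt_min d10.
move=> s sT; rewrite lt_min => /andP[/(h1 s sT) {}h1 /(h2 s sT) {}h2].
have := ler_fnormB B (x s - x t) (y s - y t).
rewrite (_ : x s - x t - (y s - y t) = x s - y s - (x t - y t)); first lra.
by rewrite !opprB addrACA (addrC (- x t)) addrACA.
Qed.

Lemma form_continuous_dot B x y : form_continuous_on B x -> form_continuous_on B y ->
  continuous_on T (fun t => B (x t) (y t)).
Proof.
move=> cx cy t e tT e0.
pose k := fnorm B (x t) + fnorm B (y t) + 1.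
have nx := fnorm_ge0 B (x t); have ny := fnorm_ge0 B (y t).
have k1 : 1 <= k by rewrite /k; lra.
pose e' := Num.min 1 (e / (2 * k)).
have e'0 : 0 < e' by rewrite lt_min ltr01/= divr_gt0//; lra.
have [d1 d10 h1] := cx t _ tT e'0; have [d2 d20 h2] := cy t _ tT e'0.
exists (Num.min d1 d2); first by rewrite lt_min d10.
move=> s sT; rewrite lt_min => /andP[/(h1 s sT) {}h1 /(h2 s sT) {}h2].
have E : B (x s) (y s) - B (x t) (y t) =
   B (x s - x t) (y t) + B (x t) (y s - y t) + B (x s - x t) (y s - y t).
  by rewrite !formE; ring.
rewrite E; apply: le_lt_trans (ler_normD _ _) _.
have i1 := form_CS B (x s - x t) (y t).
have i2 := form_CS B (x t) (y s - y t).
have i3 := form_CS B (x s - x t) (y s - y t).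
have i4 := ler_normD (B (x s - x t) (y t)) (B (x t) (y s - y t)).
set p := fnorm B (x s - x t) in h1 i1 i3; set q := fnorm B (y s - y t) in h2 i2 i3.
have p0 : 0 <= p by exact: fnorm_ge0.
have q0 : 0 <= q by exact: fnorm_ge0.
have q1 : q <= 1 by apply: le_trans (ltW h2) _; rewrite ge_min lexx.
have j1 : p * fnorm B (y t) <= e' * fnorm B (y t) by rewrite ler_wpM2r// ltW.
have j2 : fnorm B (x t) * q <= fnorm B (x t) * e' by rewrite ler_wpM2l// ltW.
have j3 : p * q <= e' * 1 by rewrite ler_pM// ltW.
have : e' * k <= e / 2.
  apply: (@le_trans _ _ (e / (2 * k) * k)).
    by rewrite ler_wpM2r ?ge_min ?lexx ?orbT//; lra.
  by rewrite invfM mulrA divfK//; lra.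
rewrite /k !mulrDr mulr1; lra.
Qed.

Lemma form_continuous_le B B' c x : (forall v, fnorm B' v <= c * fnorm B v) ->
  form_continuous_on B x -> form_continuous_on B' x.
Proof.
move=> hc cx t e tT e0; pose k := `|c| + 1.
have k0 : 0 < k by rewrite /k; have := normr_ge0 c; lra.
have ek : 0 < e / k by rewrite divr_gt0.
have [d d0 hd] := cx t _ tT ek; exists d => // s sT st.
apply: le_lt_trans (hc _) _.
have := hd s sT st; rewrite ltr_pdivlMr//.
have := fnorm_ge0 B (x s - x t); have := ler_norm c.
rewrite /k; nra.
Qed.

End continuity_in_form.

(** Two controlling curves are allowed because the mixed projection is stable in the norm of
    [H(div)] only: its error inherits continuity from the stress together with its divergence. *)
Lemma form_continuous_bound {R : realType} {U V W : lmodType R} (T K : R)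
    (B : form U) (B1 : form V) (B2 : form W) x y w : 0 <= K ->
  (forall s t, s \in `[0, T] -> t \in `[0, T] ->
     fnorm B (x s - x t) <= K * (fnorm B1 (y s - y t) + fnorm B2 (w s - w t))) ->
  form_continuous_on T B1 y -> form_continuous_on T B2 w -> form_continuous_on T B x.
Proof.
move=> K0 hb cy cw t e tT e0; pose e' := e / (2 * (K + 1)).
have k0 : 0 < 2 * (K + 1) by lra.
have e'0 : 0 < e' by rewrite divr_gt0.
have [d1 d10 h1] := cy t _ tT e'0; have [d2 d20 h2] := cw t _ tT e'0.
exists (Num.min d1 d2); first by rewrite lt_min d10.
move=> s sT; rewrite lt_min => /andP[/(h1 s sT) {}h1 /(h2 s sT) {}h2].
apply: le_lt_trans (hb s t sT tT) _.
have ee : 2 * (K + 1) * e' = e by rewrite /e' mulrC divfK// gt_eqF.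
apply: (@le_lt_trans _ _ (K * (e' + e'))).
  by rewrite ler_wpM2l//; lra.
by rewrite -ee; lra.
Qed.

(** * Energy estimates for abstract error equations *)

Section energy.
Context {R : realType} {S Q Z : lmodType R}.
Variables (ipS cA : form S) (ipQ cs : form Q) (ipZ ck : form Z) (J : Q -> S).
Hypothesis hJ : forall k x y, J (k *: x + y) = k *: J x + J y.
Variable c : R.
Hypothesis c0 : 0 <= c.
Hypothesis hcA : forall f, fnorm cA f <= c * fnorm ipS f.
Hypothesis hAc : forall f, fnorm ipS f <= c * fnorm cA f.
Hypothesis hcs : forall q, fnorm cs q <= c * fnorm ipQ q.
Hypothesis hck : forall w, fnorm ck w <= c * fnorm ipZ w.
Hypothesis hJn : forall q, fnorm ipS (J q) <= c * fnorm ipQ q.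

Lemma couplingB x y : J (x - y) = J x - J y.
Proof. by have := hJ (-1) y x; rewrite !scaleN1r addrC => ->; rewrite addrC. Qed.

Let eB_fun (x y : S * Q) : R := cA (x.1 + J x.2) (y.1 + J y.2) + cs x.2 y.2.

Let eB_sym x y : eB_fun x y = eB_fun y x.
Proof. by rewrite /eB_fun formC (formC cs). Qed.

Let eB_linear k x y z : eB_fun (k *: x + y) z = k * eB_fun x z + eB_fun y z.
Proof.
rewrite /eB_fun /= hJ (_ : _ + _ + _ = k *: (x.1 + J x.2) + (y.1 + J y.2)).
  by rewrite !formE; ring.
by rewrite scalerDr addrACA.
Qed.

Let eB_ge0 x : 0 <= eB_fun x x.
Proof. by rewrite /eB_fun addr_ge0 ?form_ge0. Qed.

(** Paired with [(tau, 0)] this form is the left-hand side of the constitutive law, paired with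
    [(0, q)] the storage terms of the mass balance; its symmetry makes the coupled system an energy
    identity. *)
Definition energy_form : form (S * Q)%type := Form eB_sym eB_linear eB_ge0.
Local Notation eB := energy_form.

Lemma energy_formE x y : eB x y = cA (x.1 + J x.2) (y.1 + J y.2) + cs x.2 y.2.
Proof. by []. Qed.

Lemma energy_norm_ge x : fnorm cA (x.1 + J x.2) <= fnorm eB x.
Proof. by rewrite ler_wsqrtr// energy_formE lerDl form_ge0. Qed.

(** The part in [cA] contributes [c * (|f| + c * |q|)] and the part in [cs] contributes
    [c * |q|]. *)
Let cB := c + c ^+ 2.

Let cB0 : 0 <= cB. Proof. by rewrite addr_ge0// sqr_ge0. Qed.

Lemma energy_norm_le f q : fnorm eB (f, q) <= cB * (fnorm ipS f + fnorm ipQ q).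
Proof.
have nA := fnorm_ge0 cA (f + J q); have ns := fnorm_ge0 cs q.
have nf := fnorm_ge0 ipS f; have nq := fnorm_ge0 ipQ q.
apply: (@le_trans _ _ (fnorm cA (f + J q) + fnorm cs q)).
  rewrite -(ler_pXn2r (n := 2))// ?nnegrE ?addr_ge0 ?fnorm_ge0//.
  rewrite sqr_fnorm sqrrD !sqr_fnorm energy_formE /=.
  by have := mulr_ge0 nA ns; lra.
apply: le_trans (lerD (hcA _) (hcs q)) _.
have h1 := ler_wpM2l c0 (ler_fnormD ipS f (J q)).
have h2 := ler_wpM2l c0 (hJn q).
have h3 : 0 <= c ^+ 2 * fnorm ipS f by rewrite mulr_ge0// sqr_ge0.
rewrite /cB; move: h1 h2 h3; rewrite !mulrDr !mulrDl expr2 !mulrA; lra.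
Qed.

Variable T : R.
Hypothesis T0 : 0 <= T.
Variables (Zh : S -> Prop) (Qh : Q -> Prop).
Hypothesis ZhB : forall x y, Zh x -> Zh y -> Zh (x - y).
Hypothesis QhB : forall x y, Qh x -> Qh y -> Qh (x - y).
Variables (ds Is Ig : R -> S) (dp Ip D : R -> Q).
Let es t := ds t - Is t.
Let ep t := dp t - Ip t.
Let err t : S * Q := (es t, ep t).
Hypothesis hes : forall t, t \in `[0, T] -> Zh (es t).
Hypothesis hep : forall t, t \in `[0, T] -> Qh (ep t).
Hypothesis hI : forall t q, t \in `[0, T] -> Qh q -> ipQ (Ip t) q = 0.
Hypothesis constitutive : forall t tau q, t \in `[0, T] -> Zh tau -> Qh q ->
  cA (ds t + J (dp t)) tau = - ipS (Ig t) (tau + J q).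
Hypothesis mass_balance : forall s, s \in `[0, T] -> exists ds' dp',
  (forall q, Qh q -> eB (ds', dp') (0, q) = ipQ (D s) q) /\
  forall e, 0 < e -> exists2 d, 0 < d & forall t, t \in `[0, T] -> `|t - s| < d ->
    fnorm ipS (ds s - ds t - (s - t) *: ds') <= e * `|s - t| /\
    fnorm ipQ (dp s - dp t - (s - t) *: dp') <= e * `|s - t|.
Variable Phi : R -> R.
Hypothesis mPhi : nondecreasing_on T Phi.
Hypothesis hPhi : forall t s, 0 <= t -> t <= s -> s <= T ->
  fnorm ipS (Is s - Is t) + fnorm ipQ (Ip s - Ip t) + fnorm ipS (Ig s - Ig t)
    <= Phi s - Phi t.

(** The first summand accounts for the interpolation errors of stress and pressure, paired through
    the energy form, the second for that of the rotation. *)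
Let cC := cB + c.

Let cC0 : 0 <= cC. Proof. exact: addr_ge0. Qed.

(* The error equations at [s] and [t], tested with the same discrete pair. *)
Lemma error_increment s : 0 < s -> s <= T -> exists2 L, 0 <= L &
  forall e, 0 < e -> exists2 d, 0 < d & forall t, 0 <= t -> s - d < t -> t < s ->
    fnorm ipQ (ep s - ep t) <= L * (s - t) /\
    forall tau q, Zh tau -> Qh q ->
      `|eB (err s - err t) (tau, q) - (s - t) * ipQ (D s) q| <=
      cC * (Phi s - Phi t) * fnorm eB (tau, q) + e * (s - t) * fnorm ipQ q.
Proof.
move=> s0 sT; have sI : s \in `[0, T] by rewrite in_itv/= (ltW s0).
have [ds' [dp' [h4 hdiff]]] := mass_balance sI.
(* [L] must not depend on [e]: the remainder of the difference quotient is absorbed by 1, thanks to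
   [e' <= 1]. *)
exists (fnorm ipQ dp' + 1); first by rewrite addr_ge0 ?fnorm_ge0.
move=> e e0; pose k := 2 * cB ^+ 2 + 1.
have k0 : 0 < k by have := sqr_ge0 cB; rewrite /k; lra.
pose e' := Num.min 1 (e / k).
have e'0 : 0 < e' by rewrite lt_min ltr01/= divr_gt0.
have [d d0 hd] := hdiff e' e'0; exists d => // t t0 st ts.
have tI : t \in `[0, T] by rewrite in_itv/= t0; lra.
have /(hd t tI) : `|t - s| < d by rewrite ltr0_norm; lra.
have sp : 0 <= s - t by lra.
rewrite ger0_norm//; set rs := _ - _ *: ds'; set rp := _ - _ *: dp' => -[hrs hrp].
have e1 : e' <= 1 by rewrite ge_min lexx.
have eepB : ep s - ep t = dp s - dp t - (Ip s - Ip t).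
  by rewrite /ep !opprB addrACA (addrC (- Ip s)) addrACA.
have eesB : es s - es t = ds s - ds t - (Is s - Is t).
  by rewrite /es !opprB addrACA (addrC (- Is s)) addrACA.
split.
  (* [ep] is the projection of [dp]. *)
  have hq : Qh (ep s - ep t) by apply: QhB; exact: hep.
  have h : fnorm ipQ (ep s - ep t) <= fnorm ipQ (dp s - dp t).
    have o : ipQ (Ip s - Ip t) (ep s - ep t) = 0 by rewrite formBl !hI// subrr.
    have E : ipQ (ep s - ep t) (ep s - ep t) = ipQ (dp s - dp t) (ep s - ep t).
      by rewrite {1}eepB formBl o subr0.
    have := form_leCS ipQ (dp s - dp t) (ep s - ep t).
    rewrite -E -sqr_fnorm expr2.
    have := fnorm_ge0 ipQ (ep s - ep t).
    rewrite le_eqVlt => /predU1P[<- _|p0]; first exact: fnorm_ge0.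
    by rewrite ler_pM2r.
  apply: le_trans h _.
  have -> : dp s - dp t = (s - t) *: dp' + rp by rewrite /rp [RHS]addrC subrK.
  apply: le_trans (ler_fnormD _ _ _) _; rewrite fnormZ ger0_norm//.
  have : e' * (s - t) <= 1 * (s - t) by rewrite ler_wpM2r.
  by move: hrp; lra.
move=> tau q Zt Qq.
pose dI : S * Q := (Is s - Is t, Ip s - Ip t).
pose rr : S * Q := (rs, rp).
pose dd : S * Q := (ds s - ds t, dp s - dp t).
have E1 : err s - err t = dd - dI.
  by apply/pair_equal_spec; split; rewrite /= ?eesB ?eepB.
(* The test pair is split: [(tau, 0)] meets the constitutive law at both times, [(0, q)] the mass
   balance at [s] alone. *)
have E2 : eB dd (tau, q) = cA (ds s - ds t + J (dp s - dp t)) tau + eB dd (0, q).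
  by rewrite !energy_formE /= formDr add0r addrA.
have E3 : cA (ds s - ds t + J (dp s - dp t)) tau =
    - ipS (Ig s - Ig t) (tau + J q).
  rewrite (_ : _ + J _ = ds s + J (dp s) - (ds t + J (dp t))); last first.
    by rewrite couplingB opprD addrACA.
  rewrite formBl (constitutive sI Zt Qq).
  by rewrite (constitutive tI Zt Qq) formBl; lra.
have E4 : eB dd (0, q) = (s - t) * ipQ (D s) q + eB rr (0, q).
  have E0 : (s - t) *: (ds', dp') + rr = dd.
    have -> : (s - t) *: (ds', dp') + rr =
        ((s - t) *: ds' + rs, (s - t) *: dp' + rp) by [].
    by rewrite /rs /rp !(addrC (_ *: _)) !subrK.
  by rewrite -E0 form_linear h4.
rewrite E1 formBl E2 E3 E4.
have b1 := form_CS ipS (Ig s - Ig t) (tau + J q).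
have b2 := form_CS eB dI (tau, q).
have b3 := form_CS eB rr (0, q).
have n1 := energy_norm_le (Is s - Is t) (Ip s - Ip t).
have n2 := energy_norm_le rs rp.
have n3 := energy_norm_le 0 q; rewrite fnorm0 add0r in n3.
have n4 : fnorm ipS (tau + J q) <= c * fnorm eB (tau, q).
  apply: le_trans (hAc _) _; rewrite ler_wpM2l//.
  exact: (energy_norm_ge (tau, q)).
have hP := hPhi t0 (ltW ts) sT.
set N := fnorm eB (tau, q) in b2 n4 *.
have N0 : 0 <= N by exact: fnorm_ge0.
have i1 := fnorm_ge0 ipS (Is s - Is t); have i2 := fnorm_ge0 ipQ (Ip s - Ip t).
have i3 := fnorm_ge0 ipS (Ig s - Ig t).
have q0 := fnorm_ge0 ipQ q.
have P0 : 0 <= Phi s - Phi t by lra.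
have t1 : `|ipS (Ig s - Ig t) (tau + J q)| <= (Phi s - Phi t) * (c * N).
  by apply: le_trans b1 _; apply: ler_pM; rewrite ?fnorm_ge0//; lra.
have t2 : `|eB dI (tau, q)| <= cB * (Phi s - Phi t) * N.
  apply: le_trans b2 _; rewrite ler_wpM2r//; apply: le_trans n1 _.
  by rewrite ler_wpM2l//; lra.
have t3 : `|eB rr (0, q)| <= e * (s - t) * fnorm ipQ q.
  apply: le_trans b3 _.
  apply: (@le_trans _ _ (cB * (e' * (s - t) + e' * (s - t)) * (cB * fnorm ipQ q))).
    apply: ler_pM; rewrite ?fnorm_ge0//; apply: le_trans n2 _.
    by rewrite ler_wpM2l// lerD.
  rewrite (_ : _ * _ = 2 * cB ^+ 2 * e' * ((s - t) * fnorm ipQ q)); last by ring.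
  rewrite -[leRHS]mulrA ler_wpM2r ?mulr_ge0//.
  apply: (@le_trans _ _ (k * e')).
    by rewrite ler_wpM2r ?(ltW e'0)// /k; lra.
  by rewrite mulrC -ler_pdivlMr// ge_min lexx orbT.
rewrite (_ : _ - _ = - ipS (Ig s - Ig t) (tau + J q) - eB dI (tau, q) + eB rr (0, q));
  last by ring.
apply: le_trans (ler_normD _ _) _; apply: lerD => //.
apply: le_trans (ler_normB _ _) _; rewrite normrN.
apply: le_trans (lerD t1 t2) _.
by rewrite /cC le_eqVlt; apply/orP; left; apply/eqP; ring.
Qed.

Section first_energy_estimate.
Variable Psi : R -> R.
Hypothesis mPsi : nondecreasing_on T Psi.
Hypothesis hPsi : forall t s X, 0 <= t -> t <= s -> s <= T ->
  (forall x, x \in `]t, s] -> X <= ipQ (D x) (ep x)) ->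
  X * (s - t) <= Psi s - Psi t.
Hypothesis ces : form_continuous_on T eB err.
Hypothesis cX : continuous_on T (fun t => ipQ (D t) (ep t)).

Lemma first_energy_estimate t : t \in `[0, T] ->
  fnorm eB (err t) <= 2 * cC * (Phi T - Phi 0) + fnorm eB (err 0) +
    Num.sqrt (2 * (Psi T - Psi 0)).
Proof.
have P0 : 0 <= Phi T - Phi 0 by rewrite subr_ge0; exact: mPhi.
have Q0 : 0 <= Psi T - Psi 0 by rewrite subr_ge0; exact: mPsi.
have cK := form_continuous_dot ces ces.
apply: (energy_closure T0 cK) => [u| | |M M0 hM u uT].
- exact: form_ge0.
- by rewrite !mulr_ge0.
- by rewrite mulr_ge0.
have /andP[u0 uT'] : 0 <= u <= T by move: uT; rewrite in_itv.
pose G t := 2 * cC * M * Phi t + 2 * Psi t.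
have k0 : 0 <= 2 * cC * M by rewrite !mulr_ge0.
have sub s : s \in `[0, u] -> s \in `[0, T].
  by rewrite !in_itv/= => /andP[-> h]; rewrite (le_trans h).
suff : eB (err u) (err u) - eB (err 0) (err 0) <= G u - G 0.
  have h1 : Phi u <= Phi T by exact: mPhi.
  have h2 : Psi u <= Psi T by exact: mPsi.
  have := ler_wpM2l k0 h1; rewrite /G => h3 h4.
  rewrite -lerBlDl; lra.
apply: (@nonincreasing_from_left _ u (fun s => eB (err s) (err s)) G) => //.
- move=> s e sI e0; have [d d0 hd] := cK s e (sub s sI) e0.
  by exists d => // v vI; apply: hd; exact: sub.
- move=> v s v0 vs su; rewrite /G lerD ?ler_wpM2l//.
    by apply: mPhi => //; exact: le_trans su uT'.
  by apply: mPsi => //; exact: le_trans su uT'.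
move=> s e s0 su e0.
have sT := le_trans su uT'.
have sI : s \in `[0, T] by rewrite in_itv/= (ltW s0).
have [L L0 hL] := error_increment s0 sT.
pose e1 := e / (4 * (fnorm ipQ (ep s) + 1)).
have n1 : 0 < fnorm ipQ (ep s) + 1 by have := fnorm_ge0 ipQ (ep s); lra.
have e10 : 0 < e1 by rewrite divr_gt0// mulr_gt0.
have e40 : 0 < e / 4 by lra.
have [d d0 hd] := hL e1 e10.
have [d' d'0 hd'] := cX sI e40.
exists (Num.min d d'); first by rewrite lt_min d0.
move=> v v0 dv vs.
have dd : Num.min d d' <= d by rewrite ge_min lexx.
have dd' : Num.min d d' <= d' by rewrite ge_min lexx orbT.
have [_ /(_ _ _ (hes sI) (hep sI))] := hd v v0 ltac:(lra) vs.
set N := fnorm eB _; rewrite -[(es s, ep s)]/(err s) => h.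
have NM : N <= M by exact: hM.
(* By continuity the value at [s], diminished by [e / 4], is a lower bound on all of []v, s]], which
   is the form in which [Psi] can be used. *)
have hX : (ipQ (D s) (ep s) - e / 4) * (s - v) <= Psi s - Psi v.
  apply: hPsi => //; first exact: ltW.
  move=> x; rewrite in_itv/= => /andP[vx xs].
  have xI : x \in `[0, T] by rewrite in_itv/=; lra.
  have /(hd' x xI) : `|x - s| < d' by rewrite ler0_norm; lra.
  by rewrite ltr_norml; lra.
have h5 := form_diff_le eB (err s) (err v).
have vP : 0 <= Phi s - Phi v by rewrite subr_ge0; apply: mPhi => //; exact: ltW.
have h6 : cC * (Phi s - Phi v) * N <= cC * (Phi s - Phi v) * M.
  by rewrite ler_wpM2l// mulr_ge0.
have h7 : e1 * (s - v) * fnorm ipQ (ep s) <= e / 4 * (s - v).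
  rewrite mulrAC ler_wpM2r//; first by lra.
  apply: (@le_trans _ _ (e1 * (fnorm ipQ (ep s) + 1))).
    by rewrite ler_wpM2l ?(ltW e10)//; lra.
  by rewrite /e1 invfM mulrA divfK// gt_eqF.
move: h; rewrite ler_norml => /andP[_ h].
rewrite /G; lra.
Qed.

End first_energy_estimate.

Section second_energy_estimate.
Variables (dz Iz : R -> Z).
Let ez t := dz t - Iz t.
Variables Phi2 Theta : R -> R.
Hypothesis mPhi2 : nondecreasing_on T Phi2.
Hypothesis hPhi2 : forall t s, 0 <= t -> t <= s -> s <= T ->
  (Phi s - Phi t) ^+ 2 <= (s - t) * (Phi2 s - Phi2 t).
Hypothesis mTheta : nondecreasing_on T Theta.
Hypothesis hTheta : forall t s, 0 <= t -> t <= s -> s <= T ->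
  fnorm ipZ (Iz s - Iz t) <= Theta s - Theta t.
Hypothesis cez : form_continuous_on T ck ez.
Hypothesis darcy : forall t s, t \in `[0, T] -> s \in `[0, T] ->
  ck (dz t) (ez s) = - ipQ (ep t) (D s).

(** Darcy's law at times [s] and [v] is tested with the same [ez s], which yields the increment of
    the flux without differentiating it. The inequality obtained from the other equations is then
    divided by [s - v]; its remainder is small of second order because the test function
    [ep s - ep v] is itself at most [L * (s - v)]. *)
Lemma second_energy_estimate t : t \in `[0, T] ->
  fnorm ck (ez t) <= 2 * c * (Theta T - Theta 0) + fnorm ck (ez 0) +
    Num.sqrt (2 * cC ^+ 2 * (Phi2 T - Phi2 0)).
Proof.
have P0 : 0 <= Phi2 T - Phi2 0 by rewrite subr_ge0; exact: mPhi2.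
have Q0 : 0 <= Theta T - Theta 0 by rewrite subr_ge0; exact: mTheta.
have cK := form_continuous_dot cez cez.
apply: (energy_closure T0 cK) => [u| | |M M0 hM u uT].
- exact: form_ge0.
- by rewrite !mulr_ge0.
- by rewrite !mulr_ge0// sqr_ge0.
have /andP[u0 uT'] : 0 <= u <= T by move: uT; rewrite in_itv.
pose G t := 2 * c * M * Theta t + 2 * cC ^+ 2 * Phi2 t.
have k0 : 0 <= 2 * c * M by rewrite !mulr_ge0.
have k1 : 0 <= 2 * cC ^+ 2 by rewrite mulr_ge0// sqr_ge0.
have sub s : s \in `[0, u] -> s \in `[0, T].
  by rewrite !in_itv/= => /andP[-> h]; rewrite (le_trans h).
suff : ck (ez u) (ez u) - ck (ez 0) (ez 0) <= G u - G 0.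
  have h1 : Theta u <= Theta T by exact: mTheta.
  have h2 : Phi2 u <= Phi2 T by exact: mPhi2.
  have := ler_wpM2l k0 h1; have := ler_wpM2l k1 h2; rewrite /G => h3 h4 h5.
  rewrite -lerBlDl; lra.
apply: (@nonincreasing_from_left _ u (fun s => ck (ez s) (ez s)) G) => //.
- move=> s e sI e0; have [d d0 hd] := cK s e (sub s sI) e0.
  by exists d => // v vI; apply: hd; exact: sub.
- move=> v s v0 vs su; rewrite /G lerD ?ler_wpM2l//.
    by apply: mTheta => //; exact: le_trans su uT'.
  by apply: mPhi2 => //; exact: le_trans su uT'.
move=> s e s0 su e0.
have sT := le_trans su uT'.
have sI : s \in `[0, T] by rewrite in_itv/= (ltW s0).
have [L L0 hL] := error_increment s0 sT.
have L1 : 0 < 2 * (L + 1) by rewrite mulr_gt0//; lra.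
pose e1 := e / (2 * (L + 1)).
have e10 : 0 < e1 by rewrite divr_gt0.
have [d d0 hd] := hL e1 e10; exists d => // v v0 dv vs.
have vI : v \in `[0, T] by rewrite in_itv/= v0; lra.
have [hl H] := hd v v0 dv vs.
have {}H := H _ _ (ZhB (hes sI) (hes vI)) (QhB (hep sI) (hep vI)).
pose b := fnorm eB (err s - err v).
have b2 : eB (err s - err v) (err s - err v) = b ^+ 2 by rewrite sqr_fnorm.
move: H; rewrite -[(es s - es v, _)]/(err s - err v) b2 -/b.
set DQ := ipQ (D s) (ep s - ep v); set dP := Phi s - Phi v; set P2 := Phi2 s - Phi2 v.
have sv : 0 < s - v by lra.
have hP2 : dP ^+ 2 <= (s - v) * P2 by apply: hPhi2 => //; exact: ltW.
rewrite ler_norml => /andP[_ H].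
(* [- D(e_p) (s - v) <= - b^2 + C dPhi b + o(s - v)^2 <= (C dPhi)^2 + o(s - v)^2] *)
have h1 : e1 * (s - v) * fnorm ipQ (ep s - ep v) <= (e / 2 * (s - v)) * (s - v).
  apply: (@le_trans _ _ (e1 * (s - v) * (L * (s - v)))).
    by rewrite ler_wpM2l// mulr_ge0 ?(ltW e10) ?(ltW sv).
  rewrite mulrA ler_wpM2r ?(ltW sv)// mulrAC ler_wpM2r ?(ltW sv)//.
  apply: (@le_trans _ _ (e1 * (L + 1))).
    by rewrite ler_wpM2l ?(ltW e10)//; lra.
  by rewrite /e1 invfM mulrA divfK//; lra.
have h2 : cC * dP * b <= b ^+ 2 + cC ^+ 2 * dP ^+ 2.
  rewrite -exprMn; have := sqr_ge0 (b - cC * dP); rewrite sqrrB.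
  have := sqr_ge0 b; have := sqr_ge0 (cC * dP); lra.
have h3 : cC ^+ 2 * dP ^+ 2 <= cC ^+ 2 * ((s - v) * P2).
  by rewrite ler_wpM2l// sqr_ge0.
have h4 : - DQ * (s - v) <= (cC ^+ 2 * P2 + e / 2 * (s - v)) * (s - v).
  by rewrite [leRHS]mulrDl; lra.
have h5 : - DQ <= cC ^+ 2 * P2 + e / 2 * (s - v) by rewrite -(ler_pM2r sv).
have h6 := form_diff_le ck (ez s) (ez v).
have h7 : ck (ez s - ez v) (ez s) = - DQ - ck (Iz s - Iz v) (ez s).
  have -> : ez s - ez v = dz s - dz v - (Iz s - Iz v).
    by rewrite /ez !opprB addrACA (addrC (- Iz s)) addrACA.
  rewrite formBl formBl !darcy// /DQ formBr !(formC ipQ (D s)); ring.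
have h8 : - ck (Iz s - Iz v) (ez s) <= c * M * (Theta s - Theta v).
  have i1 := form_geCS ck (Iz s - Iz v) (ez s).
  have i2 := le_trans (hck (Iz s - Iz v)) (ler_wpM2l c0 (hTheta v0 (ltW vs) sT)).
  have : fnorm ck (Iz s - Iz v) * fnorm ck (ez s) <= c * (Theta s - Theta v) * M.
    by apply: ler_pM; rewrite ?fnorm_ge0// hM.
  rewrite (mulrAC c M); lra.
move: h5; rewrite /P2 /G; lra.
Qed.

End second_energy_estimate.
End energy.

(** * Finite element spaces and interpolation errors *)

Section finite_element_spaces.
Context {R : realType} {n : nat} (Om : @domain R n).
Local Notation pt := 'rV[R]_n.
Local Notation fld a b := (pt -> 'M[R]_(a, b)).
Local Notation mu := (leb n).
Let mOm : measurable Om := dom_measurable Om.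

Lemma polyfun_linear k c (f g : pt -> R) : polyfun k f -> polyfun k g ->
  polyfun k (fun x => c * f x + g x).
Proof.
move=> [a ->] [b ->]; exists (fun al => c * a al + b al).
apply/funext => x; rewrite mulr_sumr -big_split /=; apply: eq_bigr => al _.
by rewrite mulrDl mulrA.
Qed.

Lemma polyfield_linear k c a b (f g : fld a b) : polyfield k f -> polyfield k g ->
  polyfield k (c *: f + g).
Proof.
move=> hf hg i j; have := polyfun_linear c (hf i j) (hg i j).
by congr polyfun; apply/funext => x; rewrite !mxE.
Qed.

Lemma ae_eq_linear a b (D : set pt) c (f g f' g' : fld a b) :
  f = f' %[ae mu in D] -> g = g' %[ae mu in D] ->
  c *: f + g = c *: f' + g' %[ae mu in D].
Proof.
move=> hf hg; apply: filterS2 hf hg => x hf hg Dx.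
by rewrite -[LHS]/(c *: f x + g x) hf// hg.
Qed.

Lemma DG_linear k M c (f g : fld 1 1) : DG_space Om k M f -> DG_space Om k M g ->
  DG_space Om k M (c *: f + g).
Proof.
move=> [Lf hf] [Lg hg]; split; first exact: L2_linear.
move=> K KM; have [p hp ep] := hf K KM; have [q hq eq] := hg K KM.
by exists (c *: p + q); [exact: polyfield_linear|exact: ae_eq_linear].
Qed.

Lemma RT_linear k M c (f g : fld 1 n) : RT_space Om k M f -> RT_space Om k M g ->
  RT_space Om k M (c *: f + g).
Proof.
move=> [[Lf [df hdf]] hf] [[Lg [dg hdg]] hg]; split.
  split; first exact: L2_linear.
  by exists (c *: df + dg); exact: wdiv_linear.
move=> K KM; have [p [v [s [hv hs ep']]] ep] := hf K KM.
have [q [w [t [hw ht eq']]] eq] := hg K KM.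
exists (c *: p + q); last exact: ae_eq_linear.
exists (c *: v + w), (fun x => c * s x + t x); split.
- exact: polyfield_linear.
- exact: polyfun_linear.
rewrite ep' eq'; apply/funext => x.
rewrite -[LHS]/(c *: (v x + s x *: x) + (w x + t x *: x)).
rewrite -[RHS]/((c *: v x + w x) + (c * s x + t x) *: x).
by rewrite scalerDr scalerDl scalerA addrACA.
Qed.

Lemma ip_ae_eq a b (f g f' g' : fld a b) : L2 Om f -> L2 Om g -> L2 Om f' ->
  L2 Om g' -> f = f' %[ae mu in dom Om] -> g = g' %[ae mu in dom Om] ->
  ip Om f g = ip Om f' g'.
Proof.
move=> Lf Lg Lf' Lg' hf hg; congr fine; apply: ae_eq_integral => //.
- apply/measurable_EFinP; apply: measurable_frob; [by case/L2P: Lf|by case/L2P: Lg].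
- apply/measurable_EFinP; apply: measurable_frob; [by case/L2P: Lf'|by case/L2P: Lg'].
- by apply: filterS2 hf hg => x hf hg Ox; rewrite hf// hg.
Qed.

Lemma nrm_ae_eq a b (f f' : fld a b) : L2 Om f -> L2 Om f' ->
  f = f' %[ae mu in dom Om] -> nrm Om f = nrm Om f'.
Proof. by move=> Lf Lf' h; congr Num.sqrt; exact: ip_ae_eq. Qed.

Lemma ip_skew_mulI (eta : fld n n) al (q : fld 1 1) : skewL2 Om eta ->
  L2 Om (mulI (n := n) al q) -> ip Om eta (mulI al q) = 0.
Proof.
move=> [Leta heta] Lq.
suff -> : ip Om eta (mulI al q) = \int[mu]_(x in Om) cst 0 x.
  by rewrite Rintegral_cst// mul0r.
congr fine; apply: ae_eq_integral => //.
  apply/measurable_EFinP; apply: measurable_frob; [by case/L2P: Leta|by case/L2P: Lq].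
  by apply/measurable_EFinP; exact: measurable_cst.
apply: filterS heta => x h Ox; congr EFin.
have hs : (mulI (n := n) al q x)^T = mulI al q x by rewrite /mulI tr_scalar_mx.
by rewrite frobC; apply: frob_sym_skew => //; exact: h.
Qed.

Lemma skewL2B (f g : fld n n) : skewL2 Om f -> skewL2 Om g -> skewL2 Om (f - g).
Proof.
move=> [Lf hf] [Lg hg]; split; first exact: L2B.
apply: filterS2 hf hg => x hf hg Ox.
by rewrite -[(f - g) x]/(f x - g x) linearB /= hf// hg// opprB opprK addrC.
Qed.

Lemma nrmB a b (f g : fld a b) : L2 Om f -> L2 Om g ->
  nrm Om (f - g) <= nrm Om f + nrm Om g.
Proof.
move=> Lf Lg; rewrite (nrmE (L2B Lf Lg)) (nrmE Lf) (nrmE Lg) (tol2B Lf Lg).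
exact: ler_fnormB.
Qed.

Lemma nrm_ge0 a b (f : fld a b) : 0 <= nrm Om f.
Proof. exact: sqrtr_ge0. Qed.

Lemma ipBl a b (f g h : fld a b) : L2 Om f -> L2 Om g -> L2 Om h ->
  ip Om (f - g) h = ip Om f h - ip Om g h.
Proof.
move=> Lf Lg Lh; rewrite addrC -(scaleN1r g) ip_linear// mulN1r addrC //.
Qed.

Lemma ipC a b (f g : fld a b) : ip Om f g = ip Om g f.
Proof. by apply: eq_Rintegral => x _; rewrite frobC. Qed.

Lemma ip_nrm0 a b (f g : fld a b) : L2 Om f -> L2 Om g -> nrm Om f = 0 -> ip Om f g = 0.
Proof.
move=> Lf Lg; rewrite (nrmE Lf) (ipE Lf Lg) => f0.
exact: fnorm_eq0_form f0.
Qed.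

Section best_approximation.
Context {a b : nat} (X : set (fld a b)).
Hypotheses (XL : X `<=` @L2 _ _ Om a b).
Hypothesis (XB : forall f g, X f -> X g -> X (f - g)).

(** A relation, since the values of a projection operator at [f], [g] and [f - g] are given
    independently and only up to null sets. The relation passes to differences, which is all the
    linearity that time increments require. *)
Definition orth_proj (f y : fld a b) : Prop :=
  X y /\ forall xi, X xi -> ip Om (f - y) xi = 0.

Lemma orth_projB f g y z : L2 Om f -> L2 Om g ->
  orth_proj f y -> orth_proj g z -> orth_proj (f - g) (y - z).
Proof.
move=> Lf Lg [Xy hy] [Xz hz]; split; first exact: XB.
have Ly := XL Xy; have Lz := XL Xz.
move=> xi Xxi; have Lxi := XL Xxi.
rewrite (_ : f - g - (y - z) = f - y - (g - z)); last first.
  by rewrite !opprB addrACA (addrC (- g)) addrACA.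
by rewrite ipBl ?hy ?hz ?subrr//; exact: L2B.
Qed.

Lemma orth_proj_best f y xi : L2 Om f -> orth_proj f y -> X xi ->
  nrm Om (f - y) <= nrm Om (f - xi).
Proof.
move=> Lf [Xy hy] Xxi; have Ly := XL Xy; have Lxi := XL Xxi.
have h := hy _ (XB Xy Xxi).
have := nrm_orth (L2B Lf Ly) (L2B Ly Lxi) h.
by rewrite addrA subrK.
Qed.

End best_approximation.
End finite_element_spaces.

Section mesh_width.
Context {R : realType} {n : nat}.

(** In positive dimension a simplex has two vertices, and equal ones would give the affine relation
    [lam] excluded by nondegeneracy. Powers of the width are divided by below. *)
Lemma mesh_size_gt0 (Om : set 'rV[R]_n) M : (0 < n)%N -> Om !=set0 ->
  is_mesh Om M -> 0 < mesh_size M.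
Proof.
move=> n0 [x Ox] [nd cov _].
have : closure Om x by exact: subset_closure.
rewrite cov => -[K KM _].
have n1 : (1 < n.+1)%N by [].
pose i0 : 'I_n.+1 := ord0; pose i1 : 'I_n.+1 := Ordinal n1.
have i01 : i0 != i1 by [].
have K01 : row i0 K - row i1 K != 0.
  apply/eqP => h.
  pose lam : 'rV[R]_n.+1 := delta_mx 0 i0 - delta_mx 0 i1.
  have : lam = 0.
    apply: (nd K KM); first by rewrite mulmxBl -!rowE.
    rewrite (bigD1 i0)//= (bigD1 i1)//= big1 ?addr0.
      by rewrite !mxE !eqxx /= subr0 sub0r subrr.
    move=> j /andP[j0 j1]; rewrite !mxE !eqxx /=.
    by rewrite (negbTE j0) (negbTE j1) subrr.
  move=> /rowP/(_ i0); rewrite !mxE !eqxx /= subr0 => /eqP.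
  by rewrite oner_eq0.
have e0 : 0 < enorm (row i0 K - row i1 K).
  rewrite sqrtr_gt0 lt_def frob_ge0 andbT; apply/eqP => /frob_eq0/eqP.
  by rewrite (negbTE K01).
have dK : 0 < diam K.
  apply: lt_le_trans e0 _; rewrite /diam.
  apply: le_trans (_ : _ <= \big[Num.max/0]_j enorm (row i0 K - row j K)) _.
    exact: (le_bigmax _ (fun j => enorm (row i0 K - row j K)) i1).
  exact: (le_bigmax _ (fun i => \big[Num.max/0]_j enorm (row i K - row j K)) i0).
by apply: lt_le_trans dK _; exact: le_bigmax_seq.
Qed.

End mesh_width.

(** * Projections and interpolations of a single discretization *)

Section interpolation_errors.
Context {R : realType} {n : nat} (Om : @domain R n).
Local Notation pt := 'rV[R]_n.
Local Notation fld a b := (pt -> 'M[R]_(a, b)).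
Variables (r : nat) (c h : R) (d : @discretization R n).

(** All properties hold with one constant [c], so that estimates for a single discretization become
    uniform as soon as [c] is common to the family. *)
Record stable_discretization : Prop := StableDiscretization {
  sd_c : 0 <= c ;
  sd_h : 0 < h ;
  sd_SHdiv : Sigmah d `<=` @Hdiv _ _ Om n ;
  sd_WHdiv : Wh d `<=` @Hdiv _ _ Om 1 ;
  sd_Gskew : Gammah d `<=` skewL2 Om ;
  sd_VL2 : Vh d `<=` @L2 _ _ Om n 1 ;
  sd_QL2 : Qh d `<=` @L2 _ _ Om 1 1 ;
  sd_SB : forall f g, Sigmah d f -> Sigmah d g -> Sigmah d (f - g) ;
  sd_VB : forall f g, Vh d f -> Vh d g -> Vh d (f - g) ;
  sd_GB : forall f g, Gammah d f -> Gammah d g -> Gammah d (f - g) ;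
  sd_WB : forall f g, Wh d f -> Wh d g -> Wh d (f - g) ;
  sd_QB : forall f g, Qh d f -> Qh d g -> Qh d (f - g) ;
  sd_divS : forall tau e, Sigmah d tau -> wdiv Om tau e -> Vh d e ;
  sd_divW : forall w e, Wh d w -> wdiv Om w e -> Qh d e ;
  sd_S3 : forall q, Qh d q -> exists w,
    [/\ Wh d w, wdiv Om w q & nrmdiv Om w q <= c * nrm Om q] ;
  sd_S4 : forall v eta, Vh d v -> Gammah d eta -> exists tau,
    [/\ Sigmah d tau, wdiv Om tau v,
        forall eta', Gammah d eta' -> ip Om tau eta' = ip Om eta eta' &
        nrmdiv Om tau v <= c * (nrm Om v + nrm Om eta)] ;
  sd_Pi : exists Pi, good_interpolation Om r c h (Sigmah d) (PV d) Pi ;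
  sd_IW : good_interpolation Om r c h (Wh d) (PQ d) (IW d) ;
  sd_PV : L2_projection Om (Vh d) (PV d) ;
  sd_PG : L2_projection Om (Gammah d) (PGamma d) ;
  sd_PQ : L2_projection Om (Qh d) (PQ d) ;
  sd_mixed : mixed_projection Om d ;
  sd_apG : forall m f, (1 <= m <= r)%N -> skewL2 Om f -> (Hnorm Om m f < +oo)%E ->
    exists2 xi, Gammah d xi &
      ((nrm Om (f - xi))%:E <= (c * h ^+ m)%:E * Hnorm Om m f)%E ;
  sd_apQ : forall m f, (1 <= m <= r)%N -> L2 Om f -> (Hnorm Om m f < +oo)%E ->
    exists2 xi, Qh d xi &
      ((nrm Om (f - xi))%:E <= (c * h ^+ m)%:E * Hnorm Om m f)%E }.

Hypothesis sd : stable_discretization.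

Lemma sd_SL2 : Sigmah d `<=` @L2 _ _ Om n n.
Proof. by move=> f /(sd_SHdiv sd)[]. Qed.

Lemma sd_WL2 : Wh d `<=` @L2 _ _ Om 1 n.
Proof. by move=> f /(sd_WHdiv sd)[]. Qed.

Lemma sd_GL2 : Gammah d `<=` @L2 _ _ Om n n.
Proof. by move=> f /(sd_Gskew sd)[]. Qed.

Lemma sd_hm m : 0 <= c * h ^+ m.
Proof. by rewrite mulr_ge0 ?(sd_c sd)// exprn_ge0// ltW// (sd_h sd). Qed.

Lemma nrm_le_nrmdiv a (tau : fld a n) e : nrm Om tau <= nrmdiv Om tau e.
Proof.
rewrite -[leLHS]ger0_norm ?nrm_ge0// -sqrtr_sqr ler_wsqrtr//.
by rewrite lerDl sqr_ge0.
Qed.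

Lemma scaled_Hnorm_le m a b (f : fld a b) x N : (x%:E <= (c * h ^+ m)%:E * Hnorm Om m f)%E ->
  (Hnorm Om m f <= N%:E)%E -> x <= c * h ^+ m * N.
Proof.
move=> h1 h2; rewrite -lee_fin EFinM; apply: le_trans h1 _.
by apply: lee_wpmul2l => //; rewrite lee_fin sd_hm.
Qed.

Lemma projQ_error m f y N : (1 <= m <= r)%N -> orth_proj Om (Qh d) f y ->
  (Hnorm Om m f <= N%:E)%E -> nrm Om (f - y) <= c * h ^+ m * N.
Proof.
move=> mr hy hN; have foo : (Hnorm Om m f < +oo)%E by apply: le_lt_trans hN (ltry _).
have Lf := Hnorm_L2 foo; have [xi Qxi hxi] := sd_apQ sd mr Lf foo.
apply: le_trans (scaled_Hnorm_le hxi hN).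
exact: (orth_proj_best (sd_QL2 sd) (sd_QB sd)).
Qed.

Lemma projG_error m f y N : (1 <= m <= r)%N -> skewL2 Om f ->
  orth_proj Om (Gammah d) f y ->
  (Hnorm Om m f <= N%:E)%E -> nrm Om (f - y) <= c * h ^+ m * N.
Proof.
move=> mr sf hy hN; have foo : (Hnorm Om m f < +oo)%E by apply: le_lt_trans hN (ltry _).
have Lf := Hnorm_L2 foo; have [xi Qxi hxi] := sd_apG sd mr sf foo.
apply: le_trans (scaled_Hnorm_le hxi hN).
exact: (orth_proj_best sd_GL2 (sd_GB sd)).
Qed.

(* Divergences are only determined up to null sets, hence [nrm e = 0]. *)
Definition sigma_kernel (tau : fld n n) : Prop :=
  [/\ Sigmah d tau, exists2 e, wdiv Om tau e & nrm Om e = 0 &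
      forall eta, Gammah d eta -> ip Om tau eta = 0].

Lemma sigma_kernelB s t : sigma_kernel s -> sigma_kernel t -> sigma_kernel (s - t).
Proof.
move=> [Ss [e1 he1 n1] h1] [St [e2 he2 n2] h2].
have Ls := sd_SL2 Ss; have Lt := sd_SL2 St.
split; first exact: (sd_SB sd).
  exists (e1 - e2); first exact: wdivB.
  apply/eqP; rewrite eq_le nrm_ge0 andbT.
  by have := nrmB he1.1 he2.1; rewrite n1 n2 addr0.
by move=> eta Geta; rewrite ipBl ?h1 ?h2 ?subrr//; exact: sd_GL2.
Qed.

(** The multipliers of the saddle point problem are eliminated by testing with the kernel of the
    constraints only. As a relation it is stable under differences, whatever multipliers the
    problems have. *)
Definition mixed_proj (sg : fld n n) (e : fld n 1) (x : fld n n) : Prop :=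
  [/\ Sigmah d x, forall tau, sigma_kernel tau -> ip Om x tau = ip Om sg tau,
      exists2 ex, wdiv Om x ex & forall v, Vh d v -> ip Om ex v = ip Om e v &
      forall eta, Gammah d eta -> ip Om x eta = ip Om sg eta].

Lemma mixed_projP sg e : Hdiv Om sg -> wdiv Om sg e -> mixed_proj sg e (ISigma d sg).
Proof.
move=> Hsg he; have [Sx [u [g [Vu Gg h1 h2 h3]]]] := sd_mixed sd Hsg he.
split => //; last first.
  have [_ [ex hex]] := sd_SHdiv sd Sx.
  by exists ex => // v Vv; exact: h2.
move=> tau [St [et het nt] gt]; rewrite -(h1 tau et St het).
have -> : ip Om u et = 0.
  by rewrite ipC; apply: ip_nrm0 => //; [exact: het.1|exact: (sd_VL2 sd)].
by rewrite addr0 ipC (ipC _ g) (gt g Gg) addr0.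
Qed.

Lemma mixed_projB s1 e1 x1 s2 e2 x2 : L2 Om s1 -> L2 Om s2 ->
  L2 Om e1 -> L2 Om e2 -> mixed_proj s1 e1 x1 -> mixed_proj s2 e2 x2 ->
  mixed_proj (s1 - s2) (e1 - e2) (x1 - x2).
Proof.
move=> Ls1 Ls2 Le1 Le2 [Sx1 h1 [f1 hf1 g1] k1] [Sx2 h2 [f2 hf2 g2] k2].
have Lx1 := sd_SL2 Sx1; have Lx2 := sd_SL2 Sx2.
split; first exact: (sd_SB sd).
- move=> tau kt; have [St _ _] := kt; have Lt := sd_SL2 St.
  by rewrite !ipBl// h1// h2.
- exists (f1 - f2); first exact: wdivB.
  move=> v Vv; have Lv := sd_VL2 sd Vv.
  by rewrite !ipBl ?g1 ?g2//; [exact: hf1.1|exact: hf2.1].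
- move=> eta Geta; have Leta := sd_GL2 Geta.
  by rewrite !ipBl// k1// k2.
Qed.

(** Two discrete fields with the same constraints differ by an element of the kernel, to which
    [sg - x] is orthogonal. The next two lemmas differ only in the competitor [chi]. *)
Lemma mixed_proj_best sg e x chi echi : L2 Om sg -> mixed_proj sg e x ->
  Sigmah d chi -> wdiv Om chi echi ->
  (forall v, Vh d v -> ip Om echi v = ip Om e v) ->
  (forall eta, Gammah d eta -> ip Om chi eta = ip Om sg eta) ->
  nrm Om (sg - x) <= nrm Om (sg - chi).
Proof.
move=> Ls [Sx h1 [ex hex h2] h3] Sc hec h2' h3'.
have Lx := sd_SL2 Sx; have Lc := sd_SL2 Sc.
have L1 := L2B Ls Lx; have L2' := L2B Lx Lc.
have Lex := hex.1; have Lec := hec.1.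
have Vex := sd_divS sd Sx hex; have Vec := sd_divS sd Sc hec.
have Vd := sd_VB sd Vex Vec.
have k : sigma_kernel (x - chi).
  split; first exact: (sd_SB sd).
    exists (ex - echi); first exact: wdivB.
    have Ld := sd_VL2 sd Vd.
    by rewrite /nrm ipBl// h2// h2'// subrr sqrtr0.
  by move=> eta Geta; rewrite ipBl ?h3 ?h3' ?subrr//; exact: sd_GL2.
have o : ip Om (sg - x) (x - chi) = 0 by rewrite ipBl// h1// subrr.
by have := nrm_orth L1 L2' o; rewrite addrA subrK.
Qed.

Lemma proj_nrm_le a b (X : set (fld a b)) P f : X `<=` @L2 _ _ Om a b ->
  L2_projection Om X P -> L2 Om f -> nrm Om (P f) <= nrm Om f.
Proof.
move=> XL hP Lf; have [XP ho] := hP f Lf.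
have LP := XL _ XP.
have o := ho _ XP; rewrite -[(fun x => _)]/(f - P f) in o.
rewrite ipC in o; have := nrm_orth LP (L2B Lf LP) o.
by rewrite addrC subrK.
Qed.

(** The competitor is given by (S4) from the projections of the divergence and of [sg]. No Sobolev
    regularity enters: this bound is for the continuity in time of the projection error. *)
Lemma mixed_proj_stable sg e x : L2 Om sg -> L2 Om e -> mixed_proj sg e x ->
  nrm Om (sg - x) <= (1 + c) * (nrm Om sg + nrm Om e).
Proof.
move=> Ls Le hx.
have [Vp hp] := sd_PV sd Le; have [Gp hg] := sd_PG sd Ls.
have Lp := sd_VL2 sd Vp; have Lg := sd_GL2 Gp.
have [chi [Sc wc gc nc]] := sd_S4 sd Vp Gp.
have Lc := sd_SL2 Sc.
apply: le_trans (mixed_proj_best Ls hx Sc wc _ _) _.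
- move=> v Vv; have Lv := sd_VL2 sd Vv.
  have := hp v Vv; rewrite -[(fun x => _)]/(e - PV d e) ipBl// => /eqP.
  by rewrite subr_eq0 => /eqP ->.
- move=> eta Ge; rewrite gc//; have Leta := sd_GL2 Ge.
  have := hg eta Ge; rewrite -[(fun x => _)]/(sg - PGamma d sg) ipBl// => /eqP.
  by rewrite subr_eq0 => /eqP ->.
have h1 := nrmB Ls Lc.
have h2 := nrm_le_nrmdiv chi (PV d e).
have h3 := proj_nrm_le (sd_VL2 sd) (sd_PV sd) Le.
have h4 := proj_nrm_le sd_GL2 (sd_PG sd) Ls.
have h5 : c * (nrm Om (PV d e) + nrm Om (PGamma d sg)) <= c * (nrm Om e + nrm Om sg).
  by rewrite ler_wpM2l ?(sd_c sd)// lerD.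
have := nrm_ge0 Om e; rewrite mulrDl mul1r; lra.
Qed.

(** [Pi sg] has the right divergence but not the right moments against [Gammah d]. A divergence-free
    field from (S4) corrects the moments at the cost of [c] times the error of [Pi], hence the
    factor [1 + c]. *)
Lemma mixed_proj_error m sg e x N : (1 <= m <= r)%N -> wdiv Om sg e ->
  mixed_proj sg e x -> (Hnorm Om m sg <= N%:E)%E ->
  nrm Om (sg - x) <= (1 + c) * (c * h ^+ m * N).
Proof.
move=> mr we hx hN.
have soo : (Hnorm Om m sg < +oo)%E by apply: le_lt_trans hN (ltry _).
have s1oo : (Hnorm Om 1 sg < +oo)%E.
  by apply: (Hnorm1_fin _ soo); case/andP: mr.
have Ls := Hnorm_L2 soo; have Le := we.1.
have [Pi [_ /(_ _ s1oo)[SPi wPi _ ePi]]] := sd_Pi sd.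
have LPi := sd_SL2 SPi.
have {}ePi := scaled_Hnorm_le (ePi m mr) hN.
rewrite -[(fun x => _)]/(sg - Pi sg) in ePi.
have Lr := L2B Ls LPi.
have [Gp hg] := sd_PG sd Lr; have Lg := sd_GL2 Gp.
have [Vp hp] := sd_PV sd Le; have Lp := sd_VL2 sd Vp.
have V0 : Vh d 0 by rewrite -(subrr (PV d e)); exact: (sd_VB sd).
have [tau [St wt gt nt]] := sd_S4 sd V0 Gp.
have Lt := sd_SL2 St.
(* The space is only recorded to be closed under differences, so the sum is written as one. *)
have S' : Sigmah d (Pi sg - (0 - tau)).
  by do 2?apply: (sd_SB sd) => //; rewrite -(subrr tau); exact: (sd_SB sd).
have chiE : Pi sg - (0 - tau) = Pi sg + tau by rewrite sub0r opprK.
rewrite chiE in S'.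
have w' : wdiv Om (Pi sg + tau) (PV d e).
  have := wdiv_linear 1 LPi Lt (wPi e we) wt.
  by rewrite !scale1r addr0.
apply: le_trans (mixed_proj_best Ls hx S' w' _ _) _.
- move=> v Vv; have Lv := sd_VL2 sd Vv.
  have := hp v Vv; rewrite -[(fun x => _)]/(e - PV d e) ipBl// => /eqP.
  by rewrite subr_eq0 => /eqP ->.
- move=> eta Ge; have Leta := sd_GL2 Ge.
  have := hg eta Ge; rewrite -[(fun x => _)]/(sg - Pi sg - PGamma d (sg - Pi sg)) ipBl//.
  move/eqP; rewrite subr_eq0 ipBl// => /eqP hE.
  have := ip_linear 1 LPi Lt Leta; rewrite scale1r mul1r => ->.
  by rewrite gt// -hE addrC subrK.
have h1 : nrm Om (sg - (Pi sg + tau)) <= nrm Om (sg - Pi sg) + nrm Om tau.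
  by have := nrmB Lr Lt; rewrite opprD addrA.
have h2 := nrm_le_nrmdiv tau 0.
have h4 := proj_nrm_le sd_GL2 (sd_PG sd) Lr.
have n0 : nrm Om (0 : fld n 1) = 0.
  by rewrite nrmE ?tol20 ?fnorm0//; exact: L2_0.
rewrite n0 add0r in nt.
have h5 : c * nrm Om (PGamma d (sg - Pi sg)) <= c * nrm Om (sg - Pi sg).
  by rewrite ler_wpM2l ?(sd_c sd).
have h6 : c * nrm Om (sg - Pi sg) <= c * (c * h ^+ m * N).
  by rewrite ler_wpM2l ?(sd_c sd).
rewrite mulrDl mul1r; lra.
Qed.

Lemma IW_error m z N : (1 <= m <= r)%N -> (Hnorm Om m z <= N%:E)%E ->
  nrm Om (z - IW d z) <= c * h ^+ m * N.
Proof.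
move=> mr hN; have zoo : (Hnorm Om m z < +oo)%E by apply: le_lt_trans hN (ltry _).
have z1oo : (Hnorm Om 1 z < +oo)%E by apply: (Hnorm1_fin _ zoo); case/andP: mr.
have [_ /(_ _ z1oo)[_ _ _ e]] := sd_IW sd.
exact: scaled_Hnorm_le (e m mr) hN.
Qed.

(** The interpolation is linear on [H^1] up to null sets, hence the two finiteness hypotheses and
    the comparison of norms of fields that agree almost everywhere. *)
Lemma IW_diff_error m z w N : (1 <= m <= r)%N ->
  (Hnorm Om 1 z < +oo)%E -> (Hnorm Om 1 w < +oo)%E ->
  (Hnorm Om m (z - w)%R <= N%:E)%E ->
  nrm Om ((z - IW d z) - (w - IW d w)) <= c * h ^+ m * N.
Proof.
move=> mr z1 w1 hN; apply: le_trans (IW_error mr hN).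
have [lin good] := sd_IW sd.
have [Wz _ _ _] := good _ z1; have [Ww _ _ _] := good _ w1.
have zw1 : (Hnorm Om 1 (z - w)%R < +oo)%E.
  apply: le_lt_trans (eseminormB (Hnorm_eseminorm Om 1 _ _) _ _) _.
  exact: lte_add_pinfty.
have [Wzw _ _ _] := good _ zw1.
have Lz := Hnorm_L2 z1; have Lw := Hnorm_L2 w1.
have LIz := sd_WL2 Wz; have LIw := sd_WL2 Ww; have LIzw := sd_WL2 Wzw.
have e : (fun x => -1 *: w x + z x) = z - w.
  by apply/funext => x; rewrite scaleN1r addrC.
have := lin (-1) w z w1 z1; rewrite e => ae.
rewrite le_eqVlt; apply/orP; left; apply/eqP.
rewrite (_ : z - IW d z - (w - IW d w) = z - w - (IW d z - IW d w)); last first.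
  by rewrite !opprB addrACA (addrC (- IW d z)) addrACA.
apply: nrm_ae_eq; try by do 2?apply: L2B.
apply: filterS ae => x hx Ox.
rewrite -[RHS]/((z - w) x - IW d (z - w) x) hx// scaleN1r (addrC (- _)).
by [].
Qed.

End interpolation_errors.

(** * Uniform constants for a family of discretizations *)

Section families.
Context {R : realType} {n : nat} (Om : @domain R n).
Local Notation fld a b := ('rV[R]_n -> 'M[R]_(a, b)).

Lemma good_interpolation_le a r c c' h (X : set (fld a n)) P Pi :
  c <= c' -> 0 <= h -> good_interpolation Om r c h X P Pi ->
  good_interpolation Om r c' h X P Pi.
Proof.
move=> cc h0 [lin good]; split => // f f1.
have [h1 h2 h3 h4] := good f f1; split => //.
  move=> e he; apply: le_trans (h3 e he) _; apply: lee_wpmul2r.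
    exact: Hnorm_ge0.
  by rewrite lee_fin.
move=> m mr; apply: le_trans (h4 m mr) _; apply: lee_wpmul2r.
  exact: Hnorm_ge0.
by rewrite lee_fin ler_wpM2r// exprn_ge0.
Qed.

Lemma subspaceL2B a b (X : set (fld a b)) : subspaceL2 Om X ->
  forall f g, X f -> X g -> X (f - g).
Proof.
move=> [_ _ lin _] f g Xf Xg; have := lin (-1) g f Xg Xf.
by congr X; apply/funext => x; rewrite scaleN1r addrC.
Qed.

Lemma linear_closedB a b (X : set (fld a b)) :
  (forall k f g, X f -> X g -> X (k *: f + g)) ->
  forall f g, X f -> X g -> X (f - g).
Proof.
by move=> lin f g Xf Xg; rewrite addrC -(scaleN1r g); exact: lin.
Qed.

Lemma family_stable (I : Type) (D : I -> @discretization R n) r r' :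
  (0 < n)%N -> Om !=set0 ->
  finite_elements Om D r r' -> S1 Om D -> S2 Om D r -> S3 Om D -> S4 Om D ->
  interpolations Om D r ->
  exists2 c, 0 <= c & forall i, stable_discretization Om r c (meshwidth (D i)) (D i).
Proof.
move=> n0 Om0 [[creg hmesh] [deg hfe] hWQ
  [rS [rG [_ [apG _] rmin [_ [apQ _] _]]]]] hS1 hS2 hS3 hS4 [hproj hIW].
have [c2 c20 h2] := hS2; have [c3 c30 h3] := hS3; have [c4 c40 h4] := hS4.
have [c5 c50 h5] := hIW; have [c6 c60 h6] := apG; have [c7 c70 h7] := apQ.
exists (c2 + c3 + c4 + c5 + c6 + c7) => [|i]; first by rewrite !addr_ge0 ?ltW.
set c := (X in stable_discretization _ _ X).
have [mi ri] := hmesh i.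
have h0 : 0 < meshwidth (D i) by exact: (mesh_size_gt0 n0 Om0 mi).
have hh := ltW h0.
have [fe1 fe2 fe3 fe4 fe5] := hfe i.
have [sS _ _] := fe3; have [sV _ _] := fe4; have [sG _ _] := fe5.
have [eW eQ] := hWQ i.
have [pV pG pQ pM _] := hproj i.
have [e1 e2] := hS1 i.
have [[Pi hPi] _] := h2 i.
have cge (x y z : R) : 0 <= z -> x <= y -> x * z <= y * z by move=> z0; apply: ler_wpM2r.
have apx a b (f : fld a b) c' m x : 0 <= c' -> c' <= c ->
    (x%:E <= (c' * meshwidth (D i) ^+ m)%:E * Hnorm Om m f)%E ->
    (x%:E <= (c * meshwidth (D i) ^+ m)%:E * Hnorm Om m f)%E.
  move=> c'0 cc hx; apply: le_trans hx _; apply: lee_wpmul2r; first exact: Hnorm_ge0.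
  by rewrite lee_fin ler_wpM2r// exprn_ge0.
split.
- by rewrite /c; lra.
- exact: h0.
- exact: fe1.
- by rewrite eW => w [].
- exact: fe2.
- by case: sV.
- by rewrite eQ => q [].
- exact: subspaceL2B.
- exact: subspaceL2B.
- exact: subspaceL2B.
- by rewrite eW; apply: linear_closedB; exact: RT_linear.
- by rewrite eQ; apply: linear_closedB; exact: DG_linear.
- by move=> tau e St he; rewrite -e1; exists tau.
- by move=> w e Ww he; rewrite -e2; exists w.
- move=> q Qq; have [w [Ww hw nw]] := h3 i q Qq; exists w; split => //.
  by apply: le_trans nw _; rewrite cge ?nrm_ge0// /c; lra.
- move=> v eta Vv Ge; have [tau [St wt gt nt]] := h4 i v eta Vv Ge.
  exists tau; split => //; apply: le_trans nt _; rewrite cge ?addr_ge0 ?nrm_ge0// /c; lra.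
- by exists Pi; apply: good_interpolation_le hPi => //; rewrite /c; lra.
- by apply: good_interpolation_le (h5 i) => //; rewrite /c; lra.
- exact: pV.
- exact: pG.
- exact: pQ.
- exact: pM.
- move=> m f /andP[m1 mr] sf foo.
  have mG : (1 <= m <= rG)%N by rewrite m1 (leq_trans mr)// -rmin geq_minr.
  have [xi Gxi hxi] := h6 i m f mG sf foo; exists xi => //.
  by apply: apx hxi; [exact: ltW|rewrite /c; lra].
- move=> m f mr Lf foo.
  have [xi Gxi hxi] := h7 i m f mr Lf foo; exists xi => //.
  by apply: apx hxi; [exact: ltW|rewrite /c; lra].
Qed.

End families.

(** * Solutions as curves in L^2 *)

Section curves.
Context {R : realType} {n : nat} (Om : @domain R n) (T : R).
Local Notation fld a b := ('rV[R]_n -> 'M[R]_(a, b)).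

Lemma C0_form_continuous a b (X : set (fld a b)) f : X `<=` @L2 _ _ Om a b ->
  C0 Om T X f -> form_continuous_on T (@ipF _ _ Om a b) (fun t => tol2 Om (f t)).
Proof.
move=> XL hf t e tT e0; have [Xt ht] := hf t tT; have [d d0 hd] := ht e e0.
exists d => // s sT st; have [Xs _] := hf s sT.
rewrite -tol2B; [|exact: XL..].
by rewrite -nrmE ?hd//; apply: L2B; exact: XL.
Qed.

Lemma C1_derivative a b (X : set (fld a b)) f f' : X `<=` @L2 _ _ Om a b ->
  C1 Om T X f f' -> forall s e, s \in `[0, T] -> 0 < e -> exists2 d, 0 < d &
    forall t, t \in `[0, T] -> `|t - s| < d ->
    fnorm (@ipF _ _ Om a b) (tol2 Om (f s) - tol2 Om (f t) - (s - t) *: tol2 Om (f' s))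
      <= e * `|s - t|.
Proof.
move=> XL [c0 c1 hd] s e sT e0; have [d d0 H] := hd s sT e e0.
exists d => // t tT ts.
have [->|nts] := eqVneq t s.
  by rewrite !subrr scale0r subr0 fnorm0 normr0 mulr0.
have p0 : 0 < `|t - s| by rewrite normr_gt0 subr_eq0.
have /(H t tT) : 0 < `|t - s| < d by rewrite p0.
have Lt := XL _ (c0 t tT).1; have Ls := XL _ (c0 s sT).1; have L' := XL _ (c1 s sT).1.
have Ld := L2B Lt Ls.
have LZ k g : L2 Om g -> L2 Om (k *: g : fld a b).
  by move=> Lg; rewrite -[_ *: _]addr0; apply: L2_linear => //; exact: L2_0.
rewrite -[(fun x => _)]/((t - s)^-1 *: (f t - f s) - f' s) nrmE; last first.
  by apply: L2B => //; exact: LZ.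
rewrite tol2B//; last exact: LZ.
have -> : tol2 Om ((t - s)^-1 *: (f t - f s)) = (t - s)^-1 *: (tol2 Om (f t) - tol2 Om (f s)).
  rewrite -tol2B// -[X in tol2 Om X]addr0 tol2_linear//; last exact: L2_0.
  by rewrite tol20 addr0.
set ft := tol2 Om (f t); set fs := tol2 Om (f s); set f's := tol2 Om (f' s) => hlt.
have ne : t - s != 0 by rewrite subr_eq0.
have -> : fs - ft - (s - t) *: f's = (s - t) *: ((t - s)^-1 *: (ft - fs) - f's).
  have e1 : (s - t) / (t - s) = -1 by rewrite -[s - t]opprB mulNr divff.
  by rewrite scalerBr scalerA e1 scaleN1r opprB.
by rewrite fnormZ mulrC ler_wpM2r// ltW.
Qed.

Section coupled_system.
Variables (A : coefficient Om n n) (s0c : coefficient Om 1 1) (ka : coefficient Om 1 n).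
Variables (al s0 : 'rV[R]_n -> R) (kappa : 'rV[R]_n -> 'M[R]_n).
Hypothesis s0E : coef s0c = (fun x X => s0 x *: X).
Hypothesis kaE : coef ka = (fun x v => v *m (invmx (kappa x))^T).
Hypothesis alL : forall p : fld 1 1, L2 Om p -> L2 Om (mulI (n := n) al p).

Definition coupling (q : l2 Om 1 1) : l2 Om n n := tol2 Om (mulI (n := n) al q).
Local Notation J := coupling.
Local Notation tol2 := (tol2 Om).

Lemma couplingE q : J q = tol2 (mulI (n := n) al q).
Proof. by []. Qed.

Lemma coupling_linear k x y : J (k *: x + y) = k *: J x + J y.
Proof. by rewrite /J /= mulI_linear tol2_linear//; apply: alL; exact: l2_L2. Qed.

Lemma coupling_tol2 p : L2 Om p -> tol2 (mulI (n := n) al p) = J (tol2 p).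
Proof. by move=> Lp; rewrite /J tol2E. Qed.

Lemma coefE a b (c : coefficient Om a b) f g : L2 Om f -> L2 Om g ->
  ip Om (fun x => c x (f x)) g = coefF c (tol2 f) (tol2 g).
Proof. by move=> Lf Lg; rewrite /= /coef_ip !tol2E. Qed.

(** Time derivatives and divergences, existentially quantified in [biot_solution], are fixed here as
    curves, and the coefficients appear as forms on [l2]. *)
Record solution (Sg : set (fld n n)) (V : set (fld n 1)) (G : set (fld n n))
    (W : set (fld 1 n)) (Q : set (fld 1 1)) (f : R -> fld n 1) (g : R -> fld 1 1)
    (sg : R -> fld n n) (u : R -> fld n 1) (gm : R -> fld n n)
    (z : R -> fld 1 n) (p : R -> fld 1 1) (sg' : R -> fld n n) (p' : R -> fld 1 1)
    (dsg : R -> fld n 1) (dz : R -> fld 1 1) : Prop := Solution {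
  sol_sg : C1 Om T Sg sg sg' ;
  sol_p : C1 Om T Q p p' ;
  sol_u : C0 Om T V u ;
  sol_gm : C0 Om T G gm ;
  sol_z : C0 Om T W z ;
  sol_dsg : forall t, t \in `[0, T] -> wdiv Om (sg t) (dsg t) ;
  sol_cdsg : C0 Om T (@L2 _ _ Om n 1) dsg ;
  sol_dz : forall t, t \in `[0, T] -> wdiv Om (z t) (dz t) ;
  sol_cdz : C0 Om T (@L2 _ _ Om 1 1) dz ;
  sol_constitutive : forall t tau e, t \in `[0, T] -> Sg tau -> wdiv Om tau e ->
    coefF A (tol2 (sg t) + J (tol2 (p t))) (tol2 tau) + ip Om (u t) e
      + ip Om (gm t) tau = 0 ;
  sol_equilibrium : forall t v eta, t \in `[0, T] -> V v -> G eta ->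
    ip Om (dsg t) v + ip Om (sg t) eta = - ip Om (f t) v ;
  sol_darcy : forall t w e, t \in `[0, T] -> W w -> wdiv Om w e ->
    coefF ka (tol2 (z t)) (tol2 w) + ip Om (p t) e = 0 ;
  sol_mass : forall t q, t \in `[0, T] -> Q q ->
    coefF s0c (tol2 (p' t)) (tol2 q) +
    coefF A (tol2 (sg' t) + J (tol2 (p' t))) (J (tol2 q)) - ip Om (dz t) q
    = ip Om (g t) q }.

Lemma biot_solutionP Sg V G W Q f g sg u gm z p :
  Sg `<=` @L2 _ _ Om n n -> W `<=` @L2 _ _ Om 1 n -> Q `<=` @L2 _ _ Om 1 1 ->
  biot_solution Om T A al s0 kappa Sg V G W Q f g sg u gm z p ->
  exists sg' p' dsg dz, solution Sg V G W Q f g sg u gm z p sg' p' dsg dz.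
Proof.
move=> SgL WL QL [sg' [p' [[[csg [dsg [dsg' [hd [cd _ _]]]]] cp cu cg]
  [[cz [dz [hdz cdz]]] eqs]]]].
exists sg', p', dsg, dz.
have [csg0 csg1 _] := csg; have [cp0 cp1 _] := cp.
have JE t tau : t \in `[0, T] -> L2 Om tau ->
    ip Om (fun x => A x (sg t x + mulI al (p t) x)) tau =
    coefF A (tol2 (sg t) + J (tol2 (p t))) (tol2 tau).
  move=> tT Lt; have Ls := SgL _ (csg0 t tT).1; have Lp := QL _ (cp0 t tT).1.
  have L : L2 Om (sg t + mulI al (p t)).
    by have := L2_linear 1 Ls (alL Lp); rewrite scale1r.
  have LI := alL Lp; rewrite -coupling_tol2// -tol2D//.
  by rewrite -(coefE A L Lt).
have JE' t tau : t \in `[0, T] -> L2 Om tau ->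
    ip Om (fun x => A x (sg' t x + mulI al (p' t) x)) tau =
    coefF A (tol2 (sg' t) + J (tol2 (p' t))) (tol2 tau).
  move=> tT Lt; have Ls := SgL _ (csg1 t tT).1; have Lp := QL _ (cp1 t tT).1.
  have L : L2 Om (sg' t + mulI al (p' t)).
    by have := L2_linear 1 Ls (alL Lp); rewrite scale1r.
  have LI := alL Lp; rewrite -coupling_tol2// -tol2D//.
  by rewrite -(coefE A L Lt).
split => //.
- by move=> t tT; case: (hd t tT).
- move=> t tau e tT St we; have [h _ _ _] := eqs t tT.
  by rewrite -JE//; [exact: h|exact: SgL].
- move=> t v eta tT Vv Ge; have [_ h _ _] := eqs t tT.
  by apply: h => //; case: (hd t tT).
- move=> t w e tT Ww we; have [_ _ h _] := eqs t tT.
  rewrite -coefE; [|exact: WL (cz t tT).1|exact: WL].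
  by rewrite kaE; exact: h.
- move=> t q tT Qq; have [_ _ _ h] := eqs t tT.
  have Lq := QL _ Qq; have Lp' := QL _ (cp1 t tT).1; have LI := alL Lq.
  rewrite -(coupling_tol2 Lq) -JE'// -(coefE s0c Lp' Lq) s0E.
  by apply: h => //; exact: hdz.
Qed.

End coupled_system.
End curves.

(** * Uniform-in-time norms of continuous curves *)

Section L2_norms.
Context {R : realType} {n : nat} (Om : @domain R n) {a b : nat}.
Local Notation fld := ('rV[R]_n -> 'M[R]_(a, b)).

Definition form_norm (B : form (l2 Om a b)) (f : fld) : \bar R :=
  if `[< L2 Om f >] then (fnorm B (tol2 Om f))%:E else +oo%E.

Lemma form_normE B f : L2 Om f -> form_norm B f = (fnorm B (tol2 Om f))%:E.
Proof. by move=> Lf; rewrite /form_norm asboolT. Qed.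

Lemma form_norm_eseminorm B : eseminorm (form_norm B).
Proof.
split=> [|f|k f g].
- by rewrite form_normE ?tol20 ?fnorm0//; exact: L2_0.
- by rewrite /form_norm; case: asboolP => _; rewrite ?leey ?lee_fin ?fnorm_ge0.
rewrite /form_norm; case: asboolP => // Lf _; case: asboolP => // Lg _.
rewrite asboolT; last exact: L2_linear.
rewrite tol2_linear// -EFinM -EFinD lee_fin -fnormZ; exact: ler_fnormD.
Qed.

Lemma L2norm_form : @L2norm _ _ Om a b = form_norm ipF.
Proof.
by apply/funext => f; rewrite /L2norm /form_norm; case: asboolP => // Lf; rewrite nrmE.
Qed.

(** A pointwise bound alone is not enough: [Lr_norm] is [+oo] unless the curve is strongly
    measurable, and this is obtained from continuity. The continuity of each error is proved below
    for this reason too. *)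
Lemma Lr_norm_form_le B T x M : 0 < T -> (forall t, t \in `[0, T] -> L2 Om (x t)) ->
  form_continuous_on T B (fun t => tol2 Om (x t)) ->
  (forall t, t \in `[0, T] -> fnorm B (tol2 Om (x t)) <= M) ->
  (Lr_norm T (form_norm B) +oo x <= M%:E)%E.
Proof.
move=> T0 Lx cx xM; have sN := form_norm_eseminorm B.
apply: (Lr_normy_le sN T0); last by move=> t tT; rewrite form_normE ?lee_fin ?xM//; exact: Lx.
apply: (continuous_strongly_measurable sN T0).
  by move=> t tT; rewrite form_normE ?ltry//; exact: Lx.
move=> t e tT e0; have [del del0 hdel] := cx t e tT e0.
exists del => // s sT st; have Lt := Lx t tT; have Ls := Lx s sT.
rewrite (eseminormBC sN) (form_normE B (L2B Ls Lt)) (tol2B Ls Lt) lee_fin.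
exact/ltW/hdel.
Qed.

(** Best approximation of an increment, with 0 as the competitor: the increment of the projection
    error is no larger than that of [x]. *)
Lemma projection_error_continuous T (X Y : set fld) P x : X `<=` @L2 _ _ Om a b ->
  (forall f g, X f -> X g -> X (f - g)) -> L2_projection Om X P ->
  Y `<=` @L2 _ _ Om a b -> C0 Om T Y x ->
  form_continuous_on T ipF (fun t => tol2 Om (x t) - tol2 Om (P (x t))).
Proof.
move=> XL XB hP YL cx; have ct := C0_form_continuous YL cx.
apply: (form_continuous_bound (K := 1) (@ler01 R) _ ct ct) => s t sT tT.
have Ls := YL _ (cx s sT).1; have Lt := YL _ (cx t tT).1.
have Ps := hP _ Ls; have Pt := hP _ Lt.
have LPs := XL _ Ps.1; have LPt := XL _ Pt.1.
rewrite mul1r; apply: (@le_trans _ _ (fnorm ipF (tol2 Om (x s) - tol2 Om (x t))));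
  last by rewrite lerDl fnorm_ge0.
have X0 : X 0 by rewrite -(subrr (P (x s))); apply: XB; exact: Ps.1.
have := orth_proj_best XL XB (L2B Ls Lt) (orth_projB XL XB Ls Lt Ps Pt) X0.
rewrite subr0 (nrmE (L2B Ls Lt)) (nrmE (L2B (L2B Ls Lt) (L2B LPs LPt))).
rewrite (tol2B (L2B Ls Lt) (L2B LPs LPt)) (tol2B Ls Lt) (tol2B LPs LPt).
by rewrite opprD addrACA -opprD.
Qed.

End L2_norms.

Lemma L2Anorm_form {R : realType} n (Om : @domain R n) (A : coefficient Om n n) :
  L2Anorm Om A = form_norm (coefF A).
Proof.
apply/funext => f; rewrite /L2Anorm /form_norm; case: asboolP => // Lf.
by rewrite (coefE A Lf Lf).
Qed.

(** * Error equations *)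

Fact sub_eq3_0 (V : zmodType) (a1 a2 b1 b2 c1 c2 : V) :
  a1 + b1 + c1 = 0 -> a2 + b2 + c2 = 0 -> a1 - a2 + (b1 - b2) + (c1 - c2) = 0.
Proof. by move=> h1 h2; rewrite (addrACA a1) -opprD addrACA -opprD h1 h2 subrr. Qed.

Fact mass_subtract (V : zmodType) (a1 a2 b1 b2 c1 c2 e : V) :
  a1 + b1 - c1 = e -> a2 + b2 - c2 = e -> b1 - b2 + (a1 - a2) = c1 - c2.
Proof.
move=> <- /eqP; rewrite subr_eq => /eqP h; rewrite addrACA -opprD (addrC b2) h.
by rewrite (addrC b1) -[_ - c1 + c2]addrA opprD addrA subrr add0r opprD opprK.
Qed.

Fact subKr_error (V : zmodType) (a b c : V) : a - b - (a - c) = c - b.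
Proof. by rewrite opprB addrC addrA subrK. Qed.

Fact sub_eq2_0 (V : zmodType) (a1 a2 b1 b2 : V) :
  a1 + b1 = 0 -> a2 + b2 = 0 -> a1 - a2 + (b1 - b2) = 0.
Proof. by move=> h1 h2; rewrite addrACA -opprD h1 h2 subrr. Qed.

Fact subrACA (V : zmodType) (a b c d : V) : a - b - (c - d) = a - c - (b - d).
Proof. by rewrite opprD addrACA -opprD. Qed.

Lemma form_completed_square {R : realType} {V : lmodType R} (B : form V) x y :
  - B x (x - y) <= B y y.
Proof.
have h1 := form_ge0 B (x - y); have h2 := form_ge0 B x; have h3 := form_ge0 B y.
by move: h1 h2 h3; rewrite !formBl !formBr (formC B y x); lra.
Qed.

(** * Scalar inequalities and the constants of the estimates *)

Fact sqr_sum3_le {R : realFieldType} (d a b e a' b' e' a2 b2 e2 a2' b2' e2' : R) :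
  (a - a') ^+ 2 <= d * (a2 - a2') -> (b - b') ^+ 2 <= d * (b2 - b2') ->
  (e - e') ^+ 2 <= d * (e2 - e2') ->
  (a + b + e - (a' + b' + e')) ^+ 2 <= d * (3 * (a2 + b2 + e2) - 3 * (a2' + b2' + e2')).
Proof.
move=> h1 h2 h3.
have := sqr_ge0 ((a - a') - (b - b')); have := sqr_ge0 ((a - a') - (e - e')).
have := sqr_ge0 ((b - b') - (e - e')); nra.
Qed.

Fact sum_le_of_sqr {R : realFieldType} (v g a b x c k A F I : R) : 0 <= v -> 0 <= g ->
  0 <= a -> 0 <= b -> 0 <= k -> 0 <= c -> x <= c * (v + g) -> A <= k * x ->
  F + v ^+ 2 + (I + g ^+ 2) = 0 -> - (a * A) <= F -> - (b * x) <= I ->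
  v + g <= 2 * (c * (k * a + b)).
Proof.
move=> v0 g0 a0 b0 k0 c0 h1 h2 h3 h4 h5.
pose Y := k * a + b; have Y0 : 0 <= Y by rewrite addr_ge0// mulr_ge0.
have h6 : v ^+ 2 + g ^+ 2 <= Y * x.
  have : a * A <= a * (k * x) by rewrite ler_wpM2l.
  rewrite /Y mulrDl (mulrC k) -mulrA; lra.
have h7 : v ^+ 2 + g ^+ 2 <= Y * (c * (v + g)).
  by apply: le_trans h6 _; rewrite ler_wpM2l.
rewrite -/Y leNgt; apply/negP => lt.
have S0 : 0 < v + g by apply: le_lt_trans lt; rewrite !mulr_ge0.
have : 2 * (c * Y) * (v + g) < (v + g) * (v + g) by rewrite ltr_pM2r.
have := sqr_ge0 (v - g); move: h7; clear; nra.
Qed.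

(** In order: the increments of the interpolation errors, the initial error, and the interpolation
    of the flux. Here [k] bounds the coefficients, [c] belongs to the discretization, and [L] bounds
    values by Sobolev norms in time. *)
Definition energy_const {R : realType} (k c L : R) : R :=
  2 * (k + k ^+ 2 + k) * ((1 + c) * c) + (k + k ^+ 2) * (1 + (1 + c) * c * L)
  + 2 * (k * c + 1).

Definition rotation_const {R : realType} (k c L : R) : R :=
  2 * (c * (k * (energy_const k c L + (k + k ^+ 2) * ((1 + c) * c * L)) + c * L)).

(** The factor 3 bounds the square root of 6: 2 comes from the second energy estimate, 3 from
    squaring a sum of three increments. *)
Definition flux_const {R : realType} (k c L : R) : R :=
  2 * k * c + k * (1 + c * L) + 3 * (k + k ^+ 2 + k) * ((1 + c) * c).

Definition pressure_const {R : realType} (k c L : R) : R :=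
  k * (c * (flux_const k c L + k * (c * L))).

Section constants.
Context {R : realType} (k c L hm : R).
Hypotheses (k0 : 0 <= k) (c0 : 0 <= c) (L0 : 0 <= L) (h0 : 0 <= hm).
Implicit Types ws wp wg wz b : R.

Fact energy_const_ge0 : 0 <= energy_const k c L.
Proof. by rewrite !addr_ge0 ?mulr_ge0 ?addr_ge0 ?mulr_ge0 ?sqr_ge0 ?addr_ge0. Qed.

Fact flux_const_ge0 : 0 <= flux_const k c L.
Proof. by rewrite !addr_ge0 ?mulr_ge0 ?addr_ge0 ?mulr_ge0 ?sqr_ge0 ?addr_ge0. Qed.

Fact interp_total_le ws wp wg wz b : 0 <= ws -> 0 <= wp -> 0 <= wg -> 0 <= wz -> 0 <= b ->
  (1 + c) * (c * hm * (L * ws)) + c * hm * (L * wp) <=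
  (1 + c) * c * L * (hm * (ws + wp + wg + wz) + b).
Proof.
move=> s0 p0 g0 z0 b0; have cL : 0 <= (1 + c) * c * L by rewrite !mulr_ge0 ?addr_ge0.
apply: (@le_trans _ _ ((1 + c) * c * L * (hm * (ws + wp)))).
  have : 0 <= c * (c * hm * (L * wp)) by rewrite !mulr_ge0.
  rewrite !mulrDr !mulrDl !mul1r !mulrA; lra.
apply: ler_wpM2l => //.
have : 0 <= hm * (wg + wz) by rewrite mulr_ge0 ?addr_ge0.
rewrite !mulrDr; lra.
Qed.

Fact energy_const_bound ws wp wg wz b PS E0 S : 0 <= ws -> 0 <= wp -> 0 <= wg ->
  0 <= wz -> 0 <= b -> PS <= ws + wp + wg ->
  E0 <= (k + k ^+ 2) * (b + ((1 + c) * (c * hm * (L * ws)) + c * hm * (L * wp))) ->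
  S <= 2 * ((k * c + 1) * hm * wz) ->
  2 * (k + k ^+ 2 + k) * ((1 + c) * (c * hm) * PS) + E0 + S <=
  energy_const k c L * (hm * (ws + wp + wg + wz) + b).
Proof.
move=> s0 p0 g0 z0 b0 h1 h2 h3; set X := hm * _ + b.
have X0 : 0 <= X by rewrite addr_ge0// mulr_ge0 ?addr_ge0.
have x1 : 0 <= 2 * (k + k ^+ 2 + k) * ((1 + c) * c).
  by rewrite !mulr_ge0 ?addr_ge0 ?sqr_ge0.
have x2 : 0 <= k + k ^+ 2 by rewrite addr_ge0 ?sqr_ge0.
have x3 : 0 <= 2 * (k * c + 1) by rewrite mulr_ge0 ?addr_ge0 ?mulr_ge0.
have hwz : hm * wz <= X.
  have : 0 <= hm * (ws + wp + wg) by rewrite mulr_ge0 ?addr_ge0.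
  by rewrite /X [in X in _ -> X]mulrDr; lra.
have hPS : hm * PS <= X.
  have : hm * PS <= hm * (ws + wp + wg) by rewrite ler_wpM2l.
  have : 0 <= hm * wz by rewrite mulr_ge0.
  by rewrite /X [in X in _ -> _ -> X]mulrDr; lra.
have hb : b <= X by rewrite /X lerDr mulr_ge0 ?addr_ge0.
have t1 : 2 * (k + k ^+ 2 + k) * ((1 + c) * (c * hm) * PS) <=
    2 * (k + k ^+ 2 + k) * ((1 + c) * c) * X.
  rewrite [leLHS](_ : _ = 2 * (k + k ^+ 2 + k) * ((1 + c) * c) * (hm * PS)); last by ring.
  exact: ler_wpM2l.
have t2 : E0 <= (k + k ^+ 2) * (1 + (1 + c) * c * L) * X.
  apply: le_trans h2 _; rewrite -[leRHS]mulrA; apply: ler_wpM2l => //.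
  rewrite [leRHS]mulrDl [X in _ <= X + _]mul1r; apply: lerD => //; exact: interp_total_le.
have t3 : S <= 2 * (k * c + 1) * X.
  apply: le_trans h3 _.
  by rewrite [leLHS](_ : _ = 2 * (k * c + 1) * (hm * wz)); [exact: ler_wpM2l|ring].
by apply: le_trans (lerD (lerD t1 t2) t3) _; rewrite -!mulrDl.
Qed.

Fact flux_const_bound ws wp wg wz b PZ E0 S : 0 <= ws -> 0 <= wp -> 0 <= wg ->
  0 <= wz -> 0 <= b -> PZ <= wz -> E0 <= k * (b + c * hm * (L * wz)) ->
  S <= 3 * (k + k ^+ 2 + k) * ((1 + c) * (c * hm)) * (ws + wp + wg) ->
  2 * k * (c * hm * PZ) + E0 + S <= flux_const k c L * (hm * (ws + wp + wg + wz) + b).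
Proof.
move=> s0 p0 g0 z0 b0 h1 h2 h3; set X := hm * _ + b.
have X0 : 0 <= X by rewrite addr_ge0// mulr_ge0 ?addr_ge0.
have hw : hm * (ws + wp + wg) <= X.
  have : 0 <= hm * wz by rewrite mulr_ge0.
  by rewrite /X [in X in _ -> X]mulrDr; lra.
have hwz : hm * wz <= X.
  have : 0 <= hm * (ws + wp + wg) by rewrite mulr_ge0 ?addr_ge0.
  by rewrite /X [in X in _ -> X]mulrDr; lra.
have hPZ : hm * PZ <= X by apply: le_trans hwz; rewrite ler_wpM2l.
have hb : b <= X by rewrite /X lerDr mulr_ge0 ?addr_ge0.
have t1 : 2 * k * (c * hm * PZ) <= 2 * k * c * X.
  rewrite [leLHS](_ : _ = 2 * k * c * (hm * PZ)); last by ring.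
  by apply: ler_wpM2l => //; rewrite !mulr_ge0.
have t2 : E0 <= k * (1 + c * L) * X.
  apply: le_trans h2 _; rewrite -[leRHS]mulrA; apply: ler_wpM2l => //.
  rewrite [leRHS]mulrDl [X in _ <= X + _]mul1r; apply: lerD => //.
  rewrite [leLHS](_ : _ = c * L * (hm * wz)); last by ring.
  by apply: ler_wpM2l => //; rewrite mulr_ge0.
have t3 : S <= 3 * (k + k ^+ 2 + k) * ((1 + c) * c) * X.
  apply: le_trans h3 _.
  rewrite [leLHS](_ : _ =
    3 * (k + k ^+ 2 + k) * ((1 + c) * c) * (hm * (ws + wp + wg))); last by ring.
  by apply: ler_wpM2l => //; rewrite !mulr_ge0 ?addr_ge0 ?sqr_ge0.
by apply: le_trans (lerD (lerD t1 t2) t3) _; rewrite -!mulrDl.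
Qed.

Fact rotation_const_ge0 : 0 <= rotation_const k c L.
Proof.
have E0 := energy_const_ge0.
have D0 : 0 <= (1 + c) * c * L by rewrite !mulr_ge0 ?addr_ge0.
have k1 : 0 <= k + k ^+ 2 by rewrite addr_ge0 ?sqr_ge0.
apply: mulr_ge0 => //; apply: mulr_ge0 => //; apply: addr_ge0; last exact: mulr_ge0.
by apply: mulr_ge0 => //; apply: addr_ge0 => //; exact: mulr_ge0.
Qed.

Fact pressure_const_ge0 : 0 <= pressure_const k c L.
Proof.
apply: mulr_ge0 => //; apply: mulr_ge0 => //; apply: addr_ge0; first exact: flux_const_ge0.
by rewrite !mulr_ge0.
Qed.

End constants.

(** Removes the slack left by the infima in the Sobolev norms in time. *)
Fact le_of_perturbation {R : realFieldType} (a K hm n1 b0 be : R) : 0 <= K -> 0 <= hm ->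
  (forall e, 0 < e -> exists2 w, w <= n1 * be + e & a <= K * (hm * w + b0 * hm * be)) ->
  a <= K * ((n1 + b0) * hm * be).
Proof.
move=> K0 h0 H; apply/ler_addgt0Pr => e e0.
have k0 : 0 < K * hm + 1 by rewrite ltr_wpDl// mulr_ge0.
have [w hw ha] := H _ (divr_gt0 e0 k0).
apply: le_trans ha _.
apply: (@le_trans _ _ (K * ((n1 + b0) * hm * be) + K * hm * (e / (K * hm + 1)))).
  have := ler_wpM2l (mulr_ge0 K0 h0) hw; lra.
rewrite lerD2l mulrA ler_pdivrMr// mulrC ler_pM2l//; lra.
Qed.

Lemma fine_of_le {R : realType} (x : \bar R) b : (0 <= x)%E -> (x <= b%:E)%E ->
  exists2 y, 0 <= y & x = y%:E.
Proof.
move=> x0 xb; have f : x \is a fin_num by rewrite ge0_fin_numE// (le_lt_trans xb)// ltry.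
by exists (fine x); rewrite ?fineK ?fine_ge0.
Qed.

Lemma fine_sum3 {R : realType} (x y w : \bar R) b : (0 <= x)%E -> (0 <= y)%E -> (0 <= w)%E ->
  (x + y + w <= b%:E)%E ->
  exists x' y' w', [/\ x = x'%:E, y = y'%:E, w = w'%:E & x' + y' + w' <= b].
Proof.
move=> x0 y0 w0 hb.
have hxy : (x + y <= b%:E)%E by apply: le_trans hb; rewrite leeDl.
have hx : (x <= b%:E)%E by apply: le_trans hxy; rewrite leeDl.
have hy : (y <= b%:E)%E by apply: le_trans hxy; rewrite leeDr.
have hw : (w <= b%:E)%E by apply: le_trans hb; rewrite leeDr// adde_ge0.
have [x' _ Ex] := fine_of_le x0 hx; have [y' _ Ey] := fine_of_le y0 hy.
have [w' _ Ew] := fine_of_le w0 hw.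
by exists x', y', w'; split => //; rewrite -lee_fin !EFinD -Ex -Ey -Ew.
Qed.

Fact perturbed_sum {R : realFieldType} (ys yp yg be wz ws wp wg e : R) :
  ys + yp + yg <= be -> wz <= be -> ws <= ys + e / 3 -> wp <= yp + e / 3 ->
  wg <= yg + e / 3 -> ws + wp + wg + wz <= 2 * be + e.
Proof. by move=> *; lra. Qed.

Fact perturbed_sum4 {R : realFieldType} (ys yp yg y3 yz ws wp wg wz e : R) :
  ys + yp + yg <= y3 -> ws <= ys + e / 4 -> wp <= yp + e / 4 ->
  wg <= yg + e / 4 -> wz <= yz + e / 4 -> ws + wp + wg + wz <= 1 * (y3 + yz) + e.
Proof. by move=> *; lra. Qed.

Fact sqr3_le {R : realFieldType} (a b e : R) : 0 <= a -> 0 <= b -> 0 <= e ->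
  a ^+ 2 + b ^+ 2 + e ^+ 2 <= (a + b + e) ^+ 2.
Proof.
move=> a0 b0 e0; have := mulr_ge0 a0 b0; have := mulr_ge0 a0 e0.
by have := mulr_ge0 b0 e0; lra.
Qed.

Opaque ipF coefF coupling tol2 energy_form fnorm.

Section error_equations.
Context {R : realType} {n : nat} (Om : @domain R n) (T : R).
Local Notation fld a b := ('rV[R]_n -> 'M[R]_(a, b)).
Hypothesis T0 : 0 < T.
Variables (A : coefficient Om n n) (s0c : coefficient Om 1 1) (ka : coefficient Om 1 n).
Variable al : 'rV[R]_n -> R.
Hypothesis alL : forall p : fld 1 1, L2 Om p -> L2 Om (mulI (n := n) al p).
Local Notation J := (@coupling R n Om al).
Local Notation tol2 := (tol2 Om).
Local Notation cA := (coefF A).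
Local Notation cs := (coefF s0c).
Local Notation ck := (coefF ka).
Variable k : R.
Hypothesis k0 : 0 <= k.
Hypothesis hA1 : forall f, fnorm cA f <= k * fnorm ipF f.
Hypothesis hA2 : forall f, fnorm ipF f <= k * fnorm cA f.
Hypothesis hs1 : forall q, fnorm cs q <= k * fnorm ipF q.
Hypothesis hk1 : forall w, fnorm ck w <= k * fnorm ipF w.
Hypothesis hk2 : forall w, fnorm ipF w <= k * fnorm ck w.
Hypothesis hJ1 : forall q, fnorm ipF (J q) <= k * fnorm ipF q.
Local Notation hJ := (coupling_linear alL).
Local Notation eB := (energy_form cA cs hJ).

Variables (r : nat) (c h : R) (d : @discretization R n).
Hypothesis sd : stable_discretization Om r c h d.

Variables (f : R -> fld n 1) (g : R -> fld 1 1).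
Variables (sg : R -> fld n n) (u : R -> fld n 1) (gm : R -> fld n n)
  (z : R -> fld 1 n) (p : R -> fld 1 1) (sg' : R -> fld n n) (p' : R -> fld 1 1)
  (dsg : R -> fld n 1) (dz : R -> fld 1 1).
Variables (sgh : R -> fld n n) (uh : R -> fld n 1) (gmh : R -> fld n n)
  (zh : R -> fld 1 n) (ph : R -> fld 1 1) (sgh' : R -> fld n n) (ph' : R -> fld 1 1)
  (dsgh : R -> fld n 1) (dzh : R -> fld 1 1).
Hypothesis sol : solution T A s0c ka al (@Hdiv _ _ Om n) (@L2 _ _ Om n 1)
  (skewL2 Om) (@Hdiv _ _ Om 1) (@L2 _ _ Om 1 1) f g sg u gm z p sg' p' dsg dz.
Hypothesis solh : solution T A s0c ka al (Sigmah d) (Vh d) (Gammah d) (Wh d)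
  (Qh d) f g sgh uh gmh zh ph sgh' ph' dsgh dzh.

Definition curve_diff a b (x y : R -> fld a b) t : l2 Om a b := tol2 (x t) - tol2 (y t).

Local Notation ds := (curve_diff sg sgh).
Local Notation dp := (curve_diff p ph).
Local Notation dw := (curve_diff z zh).
Local Notation D := (curve_diff dz dzh).
Local Notation Is := (curve_diff sg (fun t => ISigma d (sg t))).
Local Notation Ip := (curve_diff p (fun t => PQ d (p t))).
Local Notation Ig := (curve_diff gm (fun t => PGamma d (gm t))).
Local Notation Iz := (curve_diff z (fun t => IW d (z t))).

Lemma ip0r a b (x : fld a b) : L2 Om x -> ip Om x 0 = 0.
Proof.
move=> Lx; rewrite ipE//; last exact: L2_0.
by rewrite tol20 form0r.
Qed.

Section at_time.
Variable t : R.
Hypothesis tT : t \in `[0, T].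

Lemma L2_sg : L2 Om (sg t). Proof. by case: (sol_sg sol) => /(_ t tT)[[]]. Qed.
Lemma L2_p : L2 Om (p t). Proof. by case: (sol_p sol) => /(_ t tT)[]. Qed.
Lemma L2_u : L2 Om (u t). Proof. by case: (sol_u sol tT). Qed.
Lemma skew_gm : skewL2 Om (gm t). Proof. by case: (sol_gm sol tT). Qed.
Lemma L2_gm : L2 Om (gm t). Proof. by case: skew_gm. Qed.
Lemma L2_z : L2 Om (z t). Proof. by case: (sol_z sol tT) => -[]. Qed.
Lemma L2_dsg : L2 Om (dsg t). Proof. by case: (sol_dsg sol tT). Qed.
Lemma L2_dz : L2 Om (dz t). Proof. by case: (sol_dz sol tT). Qed.
Lemma Sigmah_sgh : Sigmah d (sgh t). Proof. by case: (sol_sg solh) => /(_ t tT)[]. Qed.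
Lemma Qh_ph : Qh d (ph t). Proof. by case: (sol_p solh) => /(_ t tT)[]. Qed.
Lemma Vh_uh : Vh d (uh t). Proof. by case: (sol_u solh tT). Qed.
Lemma Gammah_gmh : Gammah d (gmh t). Proof. by case: (sol_gm solh tT). Qed.
Lemma Wh_zh : Wh d (zh t). Proof. by case: (sol_z solh tT). Qed.
Lemma L2_sgh : L2 Om (sgh t). Proof. exact: (sd_SL2 sd Sigmah_sgh). Qed.
Lemma L2_ph : L2 Om (ph t). Proof. exact: (sd_QL2 sd Qh_ph). Qed.
Lemma L2_uh : L2 Om (uh t). Proof. exact: (sd_VL2 sd Vh_uh). Qed.
Lemma L2_gmh : L2 Om (gmh t). Proof. exact: (sd_GL2 sd Gammah_gmh). Qed.
Lemma L2_zh : L2 Om (zh t). Proof. exact: (sd_WL2 sd Wh_zh). Qed.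
Lemma L2_dsgh : L2 Om (dsgh t). Proof. by case: (sol_dsg solh tT). Qed.
Lemma L2_dzh : L2 Om (dzh t). Proof. by case: (sol_dz solh tT). Qed.
Lemma Qh_dzh : Qh d (dzh t). Proof. exact: (sd_divW sd Wh_zh (sol_dz solh tT)). Qed.
Lemma Vh_dsgh : Vh d (dsgh t). Proof. exact: (sd_divS sd Sigmah_sgh (sol_dsg solh tT)). Qed.
#[local] Hint Resolve L2_sg L2_p L2_u skew_gm L2_gm L2_z L2_dsg L2_dz Sigmah_sgh Qh_ph Vh_uh Gammah_gmh Wh_zh L2_sgh L2_ph
  L2_uh L2_gmh L2_zh L2_dsgh L2_dzh Qh_dzh Vh_dsgh : core.

Lemma ISigma_mixed_proj : mixed_proj Om d (sg t) (dsg t) (ISigma d (sg t)).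
Proof.
apply: (mixed_projP sd); last exact: (sol_dsg sol).
by split => //; exists (dsg t); exact: (sol_dsg sol).
Qed.

Lemma Sigmah_ISigma : Sigmah d (ISigma d (sg t)). Proof. by case: ISigma_mixed_proj. Qed.
Lemma L2_ISigma : L2 Om (ISigma d (sg t)). Proof. exact: (sd_SL2 sd Sigmah_ISigma). Qed.
Lemma Qh_PQ : Qh d (PQ d (p t)). Proof. by case: (sd_PQ sd L2_p). Qed.
Lemma L2_PQ : L2 Om (PQ d (p t)). Proof. exact: (sd_QL2 sd Qh_PQ). Qed.
Lemma Gammah_PGamma : Gammah d (PGamma d (gm t)). Proof. by case: (sd_PG sd L2_gm). Qed.
Lemma L2_PGamma : L2 Om (PGamma d (gm t)). Proof. exact: (sd_GL2 sd Gammah_PGamma). Qed.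
Lemma Vh_PV : Vh d (PV d (u t)). Proof. by case: (sd_PV sd L2_u). Qed.
Lemma L2_PV : L2 Om (PV d (u t)). Proof. exact: (sd_VL2 sd Vh_PV). Qed.
#[local] Hint Resolve Sigmah_ISigma L2_ISigma Qh_PQ L2_PQ Gammah_PGamma L2_PGamma Vh_PV L2_PV : core.

Lemma sigma_errorE : ds t - Is t = tol2 (ISigma d (sg t) - sgh t).
Proof. by rewrite /curve_diff tol2B// opprB addrC addrA subrK. Qed.

Lemma pressure_errorE : dp t - Ip t = tol2 (PQ d (p t) - ph t).
Proof. by rewrite /curve_diff tol2B// opprB addrC addrA subrK. Qed.

Lemma Gammah_0 : Gammah d 0. Proof. by rewrite -(subrr (gmh t)); exact: (sd_GB sd). Qed.
Lemma Vh_0 : Vh d 0. Proof. by rewrite -(subrr (uh t)); exact: (sd_VB sd). Qed.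

(** Tested with [Vh d], both divergences equal that of minus the load, and their difference lies in
    [Vh d]: pairing it with itself gives norm 0. The equilibrium equation with zero first argument
    gives the orthogonality to [Gammah d]. *)
Lemma sigma_error_kernel : sigma_kernel Om d (ISigma d (sg t) - sgh t).
Proof.
have [_ _ [ex hex ox] og] := ISigma_mixed_proj.
have skG eta : Gammah d eta -> skewL2 Om eta by exact: (sd_Gskew sd).
split.
- exact: (sd_SB sd).
- exists (ex - dsgh t); first exact: (wdivB L2_ISigma L2_sgh hex (sol_dsg solh tT)).
  have Vd : Vh d (ex - dsgh t) by apply: (sd_VB sd) => //; exact: (sd_divS sd Sigmah_ISigma hex).
  have Ld := sd_VL2 sd Vd; have Lex := hex.1.
  rewrite /nrm ipBl// ox//.
  have h1 := sol_equilibrium sol tT Ld (skG _ Gammah_0).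
  have h2 := sol_equilibrium solh tT Vd Gammah_0.
  rewrite !ip0r// !addr0 in h1 h2.
  by rewrite h1 -h2 subrr sqrtr0.
- move=> eta Ge; have Le := sd_GL2 sd Ge.
  rewrite ipBl// og//.
  have h1 := sol_equilibrium sol tT (sd_VL2 sd Vh_0) (skG _ Ge).
  have h2 := sol_equilibrium solh tT Vh_0 Ge.
  rewrite (ip0r L2_dsg) add0r in h1; rewrite (ip0r L2_dsgh) add0r in h2.
  by rewrite h1 h2 subrr.
Qed.

Lemma pressure_error_mem : Qh d (PQ d (p t) - ph t).
Proof. exact: (sd_QB sd). Qed.

Lemma ip_Ip q : Qh d q -> ipF (Ip t) (tol2 q) = 0.
Proof.
move=> Qq; have Lq := sd_QL2 sd Qq.
have [_ o] := sd_PQ sd L2_p.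
rewrite /curve_diff -(tol2B L2_p L2_PQ) -(ipE (L2B L2_p L2_PQ) Lq); exact: o.
Qed.

Lemma error_constitutive tau e : Sigmah d tau -> wdiv Om tau e ->
  cA (ds t + J (dp t)) (tol2 tau) + ipF (tol2 (u t) - tol2 (uh t)) (tol2 e)
    + ipF (tol2 (gm t) - tol2 (gmh t)) (tol2 tau) = 0.
Proof.
move=> St we; have Lt := sd_SL2 sd St; have Le := we.1.
have h1 := sol_constitutive sol tT (sd_SHdiv sd St) we.
have h2 := sol_constitutive solh tT St we.
rewrite !(ipE L2_u, ipE L2_gm)// in h1; rewrite !(ipE L2_uh, ipE L2_gmh)// in h2.
have -> : ds t + J (dp t) =
    tol2 (sg t) + J (tol2 (p t)) - (tol2 (sgh t) + J (tol2 (ph t))).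
  by rewrite /curve_diff (couplingB hJ) addrACA -opprD.
rewrite (formBl cA) 2!(formBl ipF).
exact: sub_eq3_0 h1 h2.
Qed.

(** The displacement disappears because the divergence of [tau] is null, and the discrete rotation
    because [tau] is orthogonal to [Gammah d]. What remains is the projection error of the rotation;
    it is skew, so [J q] may be added to [tau], which brings in the argument that the energy norm
    controls. *)
Lemma error_constitutive_kernel (tau : l2 Om n n) (q : l2 Om 1 1) :
  sigma_kernel Om d tau -> cA (ds t + J (dp t)) tau = - ipF (Ig t) (tau + J q).
Proof.
move=> [St [e we ne] gt].
have := error_constitutive St we; rewrite tol2_fun.
have -> : ipF (tol2 (u t) - tol2 (uh t)) (tol2 e) = 0.
  by rewrite formC; apply: fnorm_eq0_form; rewrite -(nrmE we.1).
have Lt := l2_L2 tau.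
have GP : Gammah d (PGamma d (gm t) - gmh t) by exact: (sd_GB sd).
have e1 : ipF (tol2 (gm t) - tol2 (gmh t)) tau = ipF (Ig t) tau.
  have -> : tol2 (gm t) - tol2 (gmh t) = Ig t + tol2 (PGamma d (gm t) - gmh t).
    by rewrite /curve_diff tol2B// addrA subrK.
  rewrite formDl [X in _ + X](_ : _ = 0) ?addr0//.
  rewrite formC -(tol2_fun tau) -(ipE Lt (sd_GL2 sd GP)).
  exact: gt.
have e2 : ipF (Ig t) (J q) = 0.
  have Lq := alL (l2_L2 q).
  have Ld := L2B L2_gm L2_PGamma; rewrite couplingE /curve_diff -(tol2B L2_gm L2_PGamma) -(ipE Ld Lq).
  exact: (ip_skew_mulI (skewL2B skew_gm (sd_Gskew sd Gammah_PGamma)) Lq).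
rewrite e1 formDr e2 !addr0 => /eqP; rewrite addr_eq0 => /eqP; exact.
Qed.

Lemma error_mass q : Qh d (q : l2 Om 1 1) ->
  eB (tol2 (sg' t) - tol2 (sgh' t), tol2 (p' t) - tol2 (ph' t)) (0, q) = ipF (D t) q.
Proof.
move=> Qq; have Lq := sd_QL2 sd Qq.
have h1 := sol_mass sol tT Lq; have h2 := sol_mass solh tT Qq.
rewrite (ipE L2_dz)// tol2_fun in h1; rewrite (ipE L2_dzh)// tol2_fun in h2.
rewrite energy_formE [X in cA X _](_ : _ = tol2 (sg' t) + J (tol2 (p' t)) -
  (tol2 (sgh' t) + J (tol2 (ph' t)))) ?[X in cA _ X](_ : _ = J q); last 2 first.
- exact: add0r.
- by rewrite -[(_, _).1]/(_ - _) -[(_, _).2]/(_ - _) (couplingB hJ) addrACA -opprD.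
rewrite (formBl cA) -[(_, _).2]/(_ - _) (formBl cs) /curve_diff (formBl ipF).
exact: mass_subtract h1 h2.
Qed.

Lemma error_darcy w e : Wh d w -> wdiv Om w e ->
  ck (dw t) (tol2 w) + ipF (dp t) (tol2 e) = 0.
Proof.
move=> Ww we; have Le := we.1.
have h1 := sol_darcy sol tT (sd_WHdiv sd Ww) we.
have h2 := sol_darcy solh tT Ww we.
rewrite (ipE L2_p)// in h1; rewrite (ipE L2_ph)// in h2.
rewrite /curve_diff (formBl ck) (formBl ipF).
exact: sub_eq2_0 h1 h2.
Qed.

Lemma flux_error_mem : (Hnorm Om 1 (z t) < +oo)%E ->
  [/\ Wh d (IW d (z t)), Wh d (IW d (z t) - zh t),
      dw t - Iz t = tol2 (IW d (z t) - zh t) &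
      wdiv Om (IW d (z t) - zh t) (PQ d (dz t) - dzh t)].
Proof.
move=> z1; have [_ /(_ _ z1)[WI wI _ _]] := sd_IW sd.
have LI := sd_WL2 sd WI.
split => //.
- exact: (sd_WB sd).
- by rewrite /curve_diff tol2B// opprB addrC addrA subrK.
- exact: (wdivB LI L2_zh (wI _ (sol_dz sol tT)) (sol_dz solh tT)).
Qed.

Lemma flux_pairing q : Qh d q ->
  ipF (tol2 q) (tol2 (PQ d (dz t) - dzh t)) = ipF (tol2 q) (D t).
Proof.
move=> Qq; have Lq := sd_QL2 sd Qq.
have [QP o] := sd_PQ sd L2_dz; have LP := sd_QL2 sd QP.
have e : ip Om (dz t - PQ d (dz t)) q = 0 by exact: o.
move: e; rewrite (ipE (L2B L2_dz LP) Lq) (tol2B L2_dz LP) (formBl ipF) => /eqP.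
rewrite subr_eq0 => /eqP e.
rewrite (tol2B LP L2_dzh) /curve_diff 2!(formBr ipF) (formC ipF _ (tol2 (PQ d (dz t)))) -e.
by rewrite (formC ipF (tol2 q) (tol2 (dz t))).
Qed.

End at_time.
Lemma fnorm_curve_diff a b (x y : R -> fld a b) t : L2 Om (x t) -> L2 Om (y t) ->
  fnorm ipF (curve_diff x y t) = nrm Om (x t - y t).
Proof. by move=> Lx Ly; rewrite /curve_diff -(tol2B Lx Ly) (nrmE (L2B Lx Ly)). Qed.

Lemma fnorm_curve_diffB a b (x y : R -> fld a b) s t :
  L2 Om (x s) -> L2 Om (y s) -> L2 Om (x t) -> L2 Om (y t) ->
  fnorm ipF (curve_diff x y s - curve_diff x y t) =
  nrm Om (x s - x t - (y s - y t)).
Proof.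
move=> Lxs Lys Lxt Lyt; rewrite (nrmE (L2B (L2B Lxs Lxt) (L2B Lys Lyt))).
rewrite (tol2B (L2B Lxs Lxt) (L2B Lys Lyt)) (tol2B Lxs Lxt) (tol2B Lys Lyt).
by rewrite /curve_diff !opprD addrACA.
Qed.

Section interpolation_increments.
Variables s t : R.
Hypotheses (sT : s \in `[0, T]) (tT : t \in `[0, T]).

Local Notation Bs := (mixed_projB sd (L2_sg sT) (L2_sg tT) (L2_dsg sT) (L2_dsg tT)
  (ISigma_mixed_proj sT) (ISigma_mixed_proj tT)).
Local Notation Bp := (orth_projB (sd_QL2 sd) (sd_QB sd) (L2_p sT) (L2_p tT) (sd_PQ sd (L2_p sT)) (sd_PQ sd (L2_p tT))).
Local Notation Bg := (orth_projB (sd_GL2 sd) (sd_GB sd) (L2_gm sT) (L2_gm tT) (sd_PG sd (L2_gm sT)) (sd_PG sd (L2_gm tT))).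

Lemma sigma_interp_stable : fnorm ipF (Is s - Is t) <=
  (1 + c) * (fnorm ipF (tol2 (sg s) - tol2 (sg t)) + fnorm ipF (tol2 (dsg s) - tol2 (dsg t))).
Proof.
have L1 := L2B (L2_sg sT) (L2_sg tT); have L2 := L2B (L2_dsg sT) (L2_dsg tT).
rewrite (fnorm_curve_diffB (L2_sg sT) (L2_ISigma sT) (L2_sg tT) (L2_ISigma tT)).
rewrite -(tol2B (L2_sg sT) (L2_sg tT)) -(tol2B (L2_dsg sT) (L2_dsg tT)) -(nrmE L1) -(nrmE L2).
exact: (mixed_proj_stable sd L1 L2 Bs).
Qed.

Variables (m : nat) (N : R).
Hypothesis mr : (1 <= m <= r)%N.
Local Notation H := (c * h ^+ m).

Lemma sigma_interp_increment : (Hnorm Om m (sg s - sg t)%R <= N%:E)%E ->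
  fnorm ipF (Is s - Is t) <= (1 + c) * (H * N).
Proof.
move=> hN; rewrite (fnorm_curve_diffB (L2_sg sT) (L2_ISigma sT) (L2_sg tT) (L2_ISigma tT)).
apply: (mixed_proj_error sd mr _ Bs hN).
exact: (wdivB (L2_sg sT) (L2_sg tT) (sol_dsg sol sT) (sol_dsg sol tT)).
Qed.

Lemma pressure_interp_increment : (Hnorm Om m (p s - p t)%R <= N%:E)%E ->
  fnorm ipF (Ip s - Ip t) <= H * N.
Proof.
move=> hN; rewrite (fnorm_curve_diffB (L2_p sT) (L2_PQ sT) (L2_p tT) (L2_PQ tT)).
exact: (projQ_error sd mr Bp hN).
Qed.

Lemma rotation_interp_increment : (Hnorm Om m (gm s - gm t)%R <= N%:E)%E ->
  fnorm ipF (Ig s - Ig t) <= H * N.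
Proof.
move=> hN; rewrite (fnorm_curve_diffB (L2_gm sT) (L2_PGamma sT) (L2_gm tT) (L2_PGamma tT)).
exact: (projG_error sd mr (skewL2B (skew_gm sT) (skew_gm tT)) Bg hN).
Qed.

Lemma flux_interp_increment : (Hnorm Om 1 (z s) < +oo)%E -> (Hnorm Om 1 (z t) < +oo)%E ->
  (Hnorm Om m (z s - z t)%R <= N%:E)%E -> fnorm ipF (Iz s - Iz t) <= H * N.
Proof.
move=> zs zt hN.
have [Ws _ _ _] := flux_error_mem sT zs; have [Wt _ _ _] := flux_error_mem tT zt.
rewrite (fnorm_curve_diffB (L2_z sT) (sd_WL2 sd Ws) (L2_z tT) (sd_WL2 sd Wt)).
rewrite (_ : z s - z t - _ = z s - IW d (z s) - (z t - IW d (z t))).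
  exact: (IW_diff_error sd mr zs zt hN).
by rewrite !opprD addrACA.
Qed.

Lemma sigma_interp_error : (Hnorm Om m (sg t) <= N%:E)%E ->
  fnorm ipF (Is t) <= (1 + c) * (H * N).
Proof.
move=> hN; rewrite (fnorm_curve_diff (L2_sg tT) (L2_ISigma tT)).
exact: (mixed_proj_error sd mr (sol_dsg sol tT) (ISigma_mixed_proj tT) hN).
Qed.

Lemma pressure_interp_error : (Hnorm Om m (p t) <= N%:E)%E ->
  fnorm ipF (Ip t) <= H * N.
Proof.
move=> hN; rewrite (fnorm_curve_diff (L2_p tT) (L2_PQ tT)).
exact: (projQ_error sd mr (sd_PQ sd (L2_p tT)) hN).
Qed.

Lemma rotation_interp_error : (Hnorm Om m (gm t) <= N%:E)%E ->
  fnorm ipF (Ig t) <= H * N.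
Proof.
move=> hN; rewrite (fnorm_curve_diff (L2_gm tT) (L2_PGamma tT)).
exact: (projG_error sd mr (skew_gm tT) (sd_PG sd (L2_gm tT)) hN).
Qed.

Lemma flux_interp_error : (Hnorm Om 1 (z t) < +oo)%E -> (Hnorm Om m (z t) <= N%:E)%E ->
  fnorm ipF (Iz t) <= H * N.
Proof.
move=> zt hN; have [Wt _ _ _] := flux_error_mem tT zt.
rewrite (fnorm_curve_diff (L2_z tT) (sd_WL2 sd Wt)).
exact: (IW_error sd mr hN).
Qed.

End interpolation_increments.


Lemma stress_continuous : form_continuous_on T ipF (fun t => tol2 (sg t)).
Proof. by case: (sol_sg sol) => /C0_form_continuous cf _ _; apply: cf => ? []. Qed.

Lemma discrete_stress_continuous : form_continuous_on T ipF (fun t => tol2 (sgh t)).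
Proof. by case: (sol_sg solh) => /C0_form_continuous cf _ _; apply: cf; exact: (sd_SL2 sd). Qed.

Lemma pressure_continuous : form_continuous_on T ipF (fun t => tol2 (p t)).
Proof. by case: (sol_p sol) => /C0_form_continuous cf _ _; exact: cf. Qed.

Lemma discrete_pressure_continuous : form_continuous_on T ipF (fun t => tol2 (ph t)).
Proof. by case: (sol_p solh) => /C0_form_continuous cf _ _; apply: cf; exact: (sd_QL2 sd). Qed.

Lemma sigma_error_continuous : form_continuous_on T ipF (fun t => ds t - Is t).
Proof.
apply: form_continuousB; first exact: form_continuousB stress_continuous discrete_stress_continuous.
apply: (form_continuous_bound (y := fun t => tol2 (sg t)) (w := fun t => tol2 (dsg t))
  (K := 1 + c)) stress_continuous _.
- by rewrite addr_ge0 ?ler01 ?(sd_c sd).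
- by move=> s t sT tT; exact: sigma_interp_stable.
- exact: (C0_form_continuous (@subset_refl _ _) (sol_cdsg sol)).
Qed.

Lemma pressure_error_continuous : form_continuous_on T ipF (fun t => dp t - Ip t).
Proof.
apply: form_continuousB; first exact: form_continuousB pressure_continuous discrete_pressure_continuous.
exact: (projection_error_continuous (sd_QL2 sd) (sd_QB sd) (sd_PQ sd)
  (@subset_refl _ _) (let: And3 cp _ _ := sol_p sol in cp)).
Qed.

Lemma divergence_error_continuous : form_continuous_on T ipF D.
Proof.
apply: form_continuousB.
- exact: (C0_form_continuous (@subset_refl _ _) (sol_cdz sol)).
- exact: (C0_form_continuous (@subset_refl _ _) (sol_cdz solh)).
Qed.

Lemma energy_error_continuous :
  form_continuous_on T eB (fun t => (ds t - Is t, dp t - Ip t)).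
Proof.
apply: (form_continuous_bound (K := k + k ^+ 2) _ _
  sigma_error_continuous pressure_error_continuous).
  by rewrite addr_ge0// sqr_ge0.
move=> s t sT tT; exact: energy_norm_le.
Qed.

Lemma curve_diff_derivative a b (X Y : set (fld a b)) x x' y y' :
  X `<=` @L2 _ _ Om a b -> Y `<=` @L2 _ _ Om a b ->
  C1 Om T X x x' -> C1 Om T Y y y' -> forall s e, s \in `[0, T] -> 0 < e ->
  exists2 d, 0 < d & forall t, t \in `[0, T] -> `|t - s| < d ->
    fnorm ipF (curve_diff x y s - curve_diff x y t - (s - t) *: curve_diff x' y' s)
      <= e * `|s - t|.
Proof.
move=> XL YL hx hy s e sT e0; have e2 : 0 < e / 2 by rewrite divr_gt0.
have [d1 d10 h1] := C1_derivative XL hx sT e2.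
have [d2 d20 h2] := C1_derivative YL hy sT e2.
exists (Num.min d1 d2); first by rewrite lt_min d10.
move=> t tT; rewrite lt_min => /andP[/(h1 t tT) {}h1 /(h2 t tT) {}h2].
rewrite (_ : _ - _ - _ = tol2 (x s) - tol2 (x t) - (s - t) *: tol2 (x' s) -
  (tol2 (y s) - tol2 (y t) - (s - t) *: tol2 (y' s))).
  rewrite [leRHS](_ : _ = e / 2 * `|s - t| + e / 2 * `|s - t|).
    exact: (le_trans (ler_fnormB _ _ _) (lerD h1 h2)).
  by rewrite -mulrDl -splitr.
rewrite /curve_diff scalerBr (subrACA (tol2 (x s))).
exact: subrACA.
Qed.

Lemma mass_error_balance s : s \in `[0, T] -> exists ds' dp',
  (forall q : l2 Om 1 1, Qh d q -> eB (ds', dp') (0, q) = ipF (D s) q) /\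
  forall e, 0 < e -> exists2 del, 0 < del & forall t, t \in `[0, T] -> `|t - s| < del ->
    fnorm ipF (ds s - ds t - (s - t) *: ds') <= e * `|s - t| /\
    fnorm ipF (dp s - dp t - (s - t) *: dp') <= e * `|s - t|.
Proof.
move=> sT; exists (curve_diff sg' sgh' s), (curve_diff p' ph' s); split.
  by move=> q Qq; exact: error_mass.
move=> e e0.
have SL : @Hdiv _ _ Om n `<=` @L2 _ _ Om n n by move=> ? [].
have [d1 d10 h1] := curve_diff_derivative SL (sd_SL2 sd) (sol_sg sol) (sol_sg solh) sT e0.
have [d2 d20 h2] := curve_diff_derivative (@subset_refl _ _) (sd_QL2 sd) (sol_p sol) (sol_p solh) sT e0.
exists (Num.min d1 d2); first by rewrite lt_min d10.
move=> t tT; rewrite lt_min => /andP[/(h1 t tT) {}h1 /(h2 t tT) {}h2].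
exact: (conj h1 h2).
Qed.

(** Two independent times: the flux error at [s] serves as a fixed test function in the equation at
    [t]. Both projection errors drop out, since the discrete pressure error and the divergence of
    the discrete flux error lie in [Qh d]. *)
Lemma darcy_error t s : t \in `[0, T] -> s \in `[0, T] -> (Hnorm Om 1 (z s) < +oo)%E ->
  ck (dw t) (dw s - Iz s) = - ipF (dp t - Ip t) (D s).
Proof.
move=> tT sT zs; have [WI Ww wE we] := flux_error_mem sT zs.
have Qe := sd_divW sd Ww we.
have h1 := error_darcy tT Ww we.
have h2 := flux_pairing sT (pressure_error_mem tT).
have h3 := ip_Ip tT Qe.
rewrite (pressure_errorE tT) -h2 -(pressure_errorE tT) (formBl ipF) h3 subr0 wE.
by apply/eqP; rewrite -addr_eq0 h1.
Qed.

Lemma sigma_error_mem t : t \in `[0, T] -> sigma_kernel Om d (ds t - Is t : l2 Om n n).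
Proof.
move=> tT; rewrite (sigma_errorE tT) tol2E; first exact: sigma_error_kernel.
exact: L2B (L2_ISigma tT) (L2_sgh tT).
Qed.

Lemma pressure_error_memI t : t \in `[0, T] -> Qh d (dp t - Ip t : l2 Om 1 1).
Proof.
move=> tT; rewrite (pressure_errorE tT) tol2E; first exact: pressure_error_mem.
exact: L2B (L2_PQ tT) (L2_ph tT).
Qed.

Local Notation Zh := (fun x : l2 Om n n => sigma_kernel Om d x).
Local Notation Qhl := (fun x : l2 Om 1 1 => Qh d x).

Lemma sigma_kernel_l2B (x y : l2 Om n n) : Zh x -> Zh y -> Zh (x - y).
Proof. exact: (sigma_kernelB sd). Qed.

Lemma pressure_l2B (x y : l2 Om 1 1) : Qhl x -> Qhl y -> Qhl (x - y).
Proof. exact: (sd_QB sd). Qed.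

(** The test field from (S4) has the displacement error as divergence and the rotation error as its
    moments, so that the constitutive error equation contains the sum of the two squared norms. *)
Lemma displacement_rotation_bound t : t \in `[0, T] ->
  nrm Om (PV d (u t) - uh t) + nrm Om (PGamma d (gm t) - gmh t) <=
  2 * (c * (k * fnorm cA (ds t + J (dp t)) + fnorm ipF (Ig t))).
Proof.
move=> tT; set ev := PV d (u t) - uh t; set eg := PGamma d (gm t) - gmh t.
have Vv : Vh d ev := sd_VB sd (Vh_PV tT) (Vh_uh tT).
have Gg : Gammah d eg := sd_GB sd (Gammah_PGamma tT) (Gammah_gmh tT).
have Lv := sd_VL2 sd Vv; have Lg := sd_GL2 sd Gg.
have [tau [St wt gt nt]] := sd_S4 sd Vv Gg.
have Lt := sd_SL2 sd St.
have E := error_constitutive tT St wt.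
have [_ ov] := sd_PV sd (L2_u tT).
have Ev : ipF (tol2 (u t) - tol2 (uh t)) (tol2 ev) = nrm Om ev ^+ 2.
  have -> : tol2 (u t) - tol2 (uh t) = tol2 (u t - PV d (u t)) + tol2 ev.
    by rewrite (tol2B (L2_u tT) (L2_PV tT)) (tol2B (L2_PV tT) (L2_uh tT)) addrA subrK.
  rewrite (formDl ipF) -(ipE (L2B (L2_u tT) (L2_PV tT)) Lv).
  by rewrite [X in X + _](ov ev Vv) add0r (nrmE Lv) sqr_fnorm.
have Eg : ipF (tol2 (gm t) - tol2 (gmh t)) (tol2 tau) =
    ipF (Ig t) (tol2 tau) + nrm Om eg ^+ 2.
  have -> : tol2 (gm t) - tol2 (gmh t) = Ig t + tol2 eg.
    by rewrite /curve_diff (tol2B (L2_PGamma tT) (L2_gmh tT)) addrA subrK.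
  rewrite (formDl ipF); congr (_ + _).
  by rewrite formC -(ipE Lt Lg) gt// (ipE Lg Lg) (nrmE Lg) sqr_fnorm.
rewrite Ev Eg in E.
have n1 : fnorm ipF (tol2 tau) <= c * (nrm Om ev + nrm Om eg).
  by rewrite -(nrmE Lt); exact: le_trans (nrm_le_nrmdiv Om tau ev) nt.
have i1 := form_geCS cA (ds t + J (dp t)) (tol2 tau).
have i2 := form_geCS ipF (Ig t) (tol2 tau).
have i3 := hA1 (tol2 tau).
have a0 := fnorm_ge0 cA (ds t + J (dp t)); have b0 := fnorm_ge0 ipF (Ig t).
exact: (sum_le_of_sqr (nrm_ge0 Om ev) (nrm_ge0 Om eg) a0 b0 k0 (sd_c sd) n1 i3 E i1 i2).
Qed.

(** (S3) gives a flux whose divergence is the discrete pressure error. The projection error of the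
    pressure is orthogonal to the latter, so Darcy's law turns its squared norm into a pairing of
    [dw t] with this flux. *)
Lemma pressure_bound t : t \in `[0, T] ->
  fnorm ipF (dp t - Ip t) <= k * (c * fnorm ck (dw t)).
Proof.
move=> tT; rewrite (pressure_errorE tT); set q := PQ d (p t) - ph t.
have Qq : Qh d q := pressure_error_mem tT.
have Lq := sd_QL2 sd Qq.
have [w [Ww ww nw]] := sd_S3 sd Qq.
have Lw := sd_WL2 sd Ww.
have E := error_darcy tT Ww ww.
have Ep : ipF (dp t) (tol2 q) = fnorm ipF (tol2 q) ^+ 2.
  rewrite -[dp t](subrK (Ip t)) (formDl ipF) (ip_Ip tT Qq) addr0.
  by rewrite (pressure_errorE tT) sqr_fnorm.
have n1 : fnorm ipF (tol2 w) <= c * fnorm ipF (tol2 q).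
  by rewrite -(nrmE Lw) -(nrmE Lq); exact: le_trans (nrm_le_nrmdiv Om w q) nw.
have i1 := form_geCS ck (dw t) (tol2 w).
have i3 := le_trans (hk1 (tol2 w)) (ler_wpM2l k0 n1).
have i4 := ler_wpM2l (fnorm_ge0 ck (dw t)) i3.
have [q0|] := eqVneq (fnorm ipF (tol2 q)) 0.
  by rewrite q0 !mulr_ge0 ?(sd_c sd)// fnorm_ge0.
move=> q0; have qp : 0 < fnorm ipF (tol2 q) by rewrite lt_def q0 fnorm_ge0.
rewrite -(ler_pM2r qp) -expr2 -Ep.
have -> : ipF (dp t) (tol2 q) = - ck (dw t) (tol2 w).
  by apply/eqP; rewrite -addr_eq0 addrC E.
rewrite lerNl; apply: le_trans i1; rewrite lerN2; apply: le_trans i4 _.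
by rewrite le_eqVlt; apply/orP; left; apply/eqP; ring.
Qed.

Lemma stress_bound t :
  fnorm ipF (ds t - Is t) <= k * fnorm cA (ds t - Is t + J (dp t - Ip t)) +
    k * fnorm ipF (dp t - Ip t).
Proof.
rewrite -[X in fnorm ipF X](addrK (J (dp t - Ip t))).
exact: (le_trans (ler_fnormB _ _ _) (lerD (hA2 _) (hJ1 _))).
Qed.

(** * Estimates in terms of moduli of the exact solution *)

Section estimates.
Variable m : nat.
Hypothesis mr : (1 <= m <= r)%N.
Local Notation H := (c * h ^+ m).

Lemma order_gt0 : (0 < m)%N. Proof. by case/andP: mr. Qed.

Variables Ps Pp Pg : R -> R.
Hypothesis mPs : modulus (@Hnorm _ _ Om m n n) T Ps sg.
Hypothesis mPp : modulus (@Hnorm _ _ Om m 1 1) T Pp p.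
Hypothesis mPg : modulus (@Hnorm _ _ Om m n n) T Pg gm.

Local Notation Phi := (fun t => (1 + c) * H * (Ps t + Pp t + Pg t)).

Lemma interp_const_ge0 : 0 <= (1 + c) * H.
Proof. by rewrite mulr_ge0 ?addr_ge0 ?ler01 ?(sd_c sd)//; exact: (sd_hm sd). Qed.

Lemma interp_modulus_le : nondecreasing_on T Phi.
Proof.
move=> t s t0 ts sT; apply: (ler_wpM2l interp_const_ge0).
have [_ h1 _] := mPs; have [_ h2 _] := mPp; have [_ h3 _] := mPg.
exact: (lerD (lerD (h1 t s t0 ts sT) (h2 t s t0 ts sT)) (h3 t s t0 ts sT)).
Qed.

Lemma interp_increment t s : 0 <= t -> t <= s -> s <= T ->
  fnorm ipF (Is s - Is t) + fnorm ipF (Ip s - Ip t) + fnorm ipF (Ig s - Ig t)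
    <= (1 + c) * H * (Ps s + Pp s + Pg s) - (1 + c) * H * (Ps t + Pp t + Pg t).
Proof.
move=> t0 ts sT.
have tI : t \in `[0, T] by rewrite in_itv/= t0 (le_trans ts).
have sI : s \in `[0, T] by rewrite in_itv/= sT (le_trans t0).
have [_ n1 h1] := mPs; have [_ n2 h2] := mPp; have [_ n3 h3] := mPg.
have {}h1 := sigma_interp_increment sI tI mr (h1 t s t0 ts sT).
have {}h2 := pressure_interp_increment sI tI mr (h2 t s t0 ts sT).
have {}h3 := rotation_interp_increment sI tI mr (h3 t s t0 ts sT).
have H0 : 0 <= H by exact: (sd_hm sd).
have i2 : H * (Pp s - Pp t) <= (1 + c) * (H * (Pp s - Pp t)).
  by rewrite ler_peMl ?lerDl ?(sd_c sd)// mulr_ge0// subr_ge0 n2.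
have i3 : H * (Pg s - Pg t) <= (1 + c) * (H * (Pg s - Pg t)).
  by rewrite ler_peMl ?lerDl ?(sd_c sd)// mulr_ge0// subr_ge0 n3.
apply: le_trans (lerD (lerD h1 (le_trans h2 i2)) (le_trans h3 i3)) _.
by rewrite le_eqVlt; apply/orP; left; apply/eqP; ring.
Qed.

Section first.
Variables (Pz : R -> R).
Hypothesis Pz_ge : forall t s, 0 <= t -> t <= s -> s <= T -> Pz t <= Pz s.
Hypothesis Pz_lower : forall t s X, 0 <= t -> t <= s -> s <= T ->
  (forall x y, x \in `]t, s] -> Hnorm Om m (z x) = y%:E -> X <= y ^+ 2) ->
  X * (s - t) <= Pz s - Pz t.
Local Notation K := ((k * c + 1) * h ^+ m).

(** By Darcy's law the left-hand side is minus the product of [dw x] with [dw x - Iz x]; completing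
    the square leaves the interpolation error of the flux alone. Finiteness of the norm at [x] gives
    access to the interpolation. *)
Lemma flux_dissipation x y : x \in `[0, T] -> Hnorm Om m (z x) = y%:E ->
  ipF (D x) (dp x - Ip x) <= (K * y) ^+ 2.
Proof.
move=> xT zy.
have zoo : (Hnorm Om m (z x) < +oo)%E by rewrite zy ltry.
have z1 := Hnorm1_fin order_gt0 zoo.
have y0 : 0 <= y by rewrite -lee_fin -zy Hnorm_ge0.
have hI : fnorm ipF (Iz x) <= H * y by apply: (flux_interp_error xT mr z1); rewrite zy.
have hd := darcy_error xT xT z1.
have hk : fnorm ck (Iz x) <= K * y.
  apply: le_trans (hk1 _) (le_trans (ler_wpM2l k0 hI) _).
  rewrite mulrA ler_wpM2r// mulrDl mul1r mulrA lerDl exprn_ge0//.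
  exact: ltW (sd_h sd).
have hk' : (fnorm ck (Iz x)) ^+ 2 <= (K * y) ^+ 2.
  by rewrite lerXn2r// nnegrE ?fnorm_ge0// (le_trans (fnorm_ge0 _ _) hk).
apply: le_trans hk'; rewrite sqr_fnorm formC -[leLHS]opprK -hd.
exact: form_completed_square.
Qed.

Hypothesis Pz0 : Pz 0 = 0.

Lemma energy_error_bound t : t \in `[0, T] ->
  fnorm eB (ds t - Is t, dp t - Ip t) <=
  2 * (k + k ^+ 2 + k) * ((1 + c) * H * (Ps T + Pp T + Pg T)) + fnorm eB (ds 0 - Is 0, dp 0 - Ip 0) +
  Num.sqrt (2 * (K ^+ 2 * Pz T)).
Proof.
(* The summand 1 in [K] is there for strict positivity: lower bounds are divided by [K ^+ 2]
   below. *)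
have K0 : 0 < K.
  rewrite mulr_gt0 ?exprn_gt0 ?(sd_h sd)// ltr_wpDl// mulr_ge0// (sd_c sd) //.
have E0 : Phi 0 = 0.
  by have [-> _ _] := mPs; have [-> _ _] := mPp; have [-> _ _] := mPg; rewrite !addr0 mulr0.
suff B x : x \in `[0, T] -> fnorm eB (ds x - Is x, dp x - Ip x) <=
    2 * (k + k ^+ 2 + k) * (Phi T - Phi 0) + fnorm eB (ds 0 - Is 0, dp 0 - Ip 0) +
    Num.sqrt (2 * (K ^+ 2 * Pz T - K ^+ 2 * Pz 0)).
  by move=> /B; rewrite E0 Pz0 mulr0 !subr0.
move: x; clear t.
apply: (@first_energy_estimate _ _ _ ipF cA ipF cs J hJ k k0 hA1 hA2 hs1 hJ1 T (ltW T0)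
  Zh Qhl pressure_l2B ds Is Ig dp Ip D sigma_error_mem pressure_error_memI
  _ _ mass_error_balance Phi interp_modulus_le interp_increment (fun t => K ^+ 2 * Pz t)) => //.
- by move=> x q xT Qq; have := ip_Ip xT Qq; rewrite tol2_fun.
- by move=> x tau q xT Zt Qq; exact: error_constitutive_kernel.
- by move=> x s x0 xs sT; rewrite ler_wpM2l ?sqr_ge0// Pz_ge.
- move=> x s X x0 xs sT hX; rewrite -mulrBr mulrC -ler_pdivrMl ?exprn_gt0//.
  rewrite mulrCA mulrC; apply: Pz_lower => // v y vI zy.
  have vT : v \in `[0, T].
    move: vI; rewrite !in_itv/= => /andP[xv vs].
    by rewrite (le_trans x0 (ltW xv)) (le_trans vs).
  rewrite ler_pdivrMl ?exprn_gt0// -exprMn.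
  exact: le_trans (hX v vI) (flux_dissipation vT zy).
- exact: energy_error_continuous.
- exact: form_continuous_dot divergence_error_continuous pressure_error_continuous.
Qed.

Variables (L ws wp wg wz b : R).
Hypothesis L0 : 0 <= L.
Hypotheses (Psw : Ps T <= ws) (Ppw : Pp T <= wp) (Pgw : Pg T <= wg).
Hypothesis sgN : forall t, t \in `[0, T] -> (Hnorm Om m (sg t) <= (L * ws)%:E)%E.
Hypothesis pN : forall t, t \in `[0, T] -> (Hnorm Om m (p t) <= (L * wp)%:E)%E.
Hypothesis gmN : forall t, t \in `[0, T] -> (Hnorm Om m (gm t) <= (L * wg)%:E)%E.
Hypotheses (wz0 : 0 <= wz) (Pzw : Pz T <= wz ^+ 2).
Hypothesis initb : fnorm ipF (ds 0) + fnorm ipF (dp 0) <= b.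
Local Notation X := (h ^+ m * (ws + wp + wg + wz) + b).

Let inT : 0 \in `[0, T]. Proof. by rewrite in_itv/= lexx ltW. Qed.

Let ws0 : 0 <= ws.
Proof. by have [z0 le _] := mPs; rewrite (le_trans _ Psw)// -z0 le// ltW. Qed.
Let wp0 : 0 <= wp.
Proof. by have [z0 le _] := mPp; rewrite (le_trans _ Ppw)// -z0 le// ltW. Qed.
Let wg0 : 0 <= wg.
Proof. by have [z0 le _] := mPg; rewrite (le_trans _ Pgw)// -z0 le// ltW. Qed.
Let b0 : 0 <= b.
Proof. by apply: le_trans initb; rewrite addr_ge0 ?fnorm_ge0. Qed.
Let hm0 : 0 <= h ^+ m. Proof. by rewrite exprn_ge0// ltW// (sd_h sd). Qed.
Let X0 : 0 <= X.
Proof. by rewrite addr_ge0// mulr_ge0// !addr_ge0. Qed.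

Lemma energy_error_le t : t \in `[0, T] ->
  fnorm eB (ds t - Is t, dp t - Ip t) <= energy_const k c L * X.
Proof.
move=> tT; apply: le_trans (energy_error_bound tT) _.
apply: (energy_const_bound k0 (sd_c sd) L0 hm0) => //.
- exact: (lerD (lerD Psw Ppw) Pgw).
- apply: le_trans (energy_norm_le hJ k0 hA1 hs1 hJ1 _ _) _.
  apply: ler_wpM2l; first by rewrite addr_ge0 ?sqr_ge0.
  apply: le_trans (lerD (ler_fnormB _ _ _) (ler_fnormB _ _ _)) _.
  rewrite [leLHS]addrACA; apply: lerD initb _.
  exact: (lerD (sigma_interp_error inT mr (sgN inT)) (pressure_interp_error inT mr (pN inT))).
have K0 : 0 <= K by rewrite mulr_ge0// addr_ge0// mulr_ge0 ?(sd_c sd).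
have Kw : 0 <= 2 * (K * wz) by rewrite mulr_ge0// mulr_ge0.
rewrite -[leRHS]ger0_norm// -sqrtr_sqr; apply: ler_wsqrtr.
apply: (@le_trans _ _ (2 * (K ^+ 2 * wz ^+ 2))).
  by rewrite !ler_wpM2l ?sqr_ge0.
rewrite [leRHS](_ : _ = 4 * (K ^+ 2 * wz ^+ 2)); last by ring.
apply: ler_wpM2r; last by rewrite ler_nat.
exact: (mulr_ge0 (sqr_ge0 _) (sqr_ge0 _)).
Qed.

Lemma coupled_error_le t : t \in `[0, T] ->
  fnorm cA (ds t - Is t + J (dp t - Ip t)) <= energy_const k c L * X.
Proof.
move=> tT; apply: le_trans (energy_error_le tT).
exact: (energy_norm_ge cA cs hJ (ds t - Is t, dp t - Ip t)).
Qed.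

Lemma displacement_rotation_le t : t \in `[0, T] ->
  nrm Om (PV d (u t) - uh t) + nrm Om (PGamma d (gm t) - gmh t) <=
  rotation_const k c L * X.
Proof.
move=> tT; apply: le_trans (displacement_rotation_bound tT) _.
rewrite /rotation_const -[leRHS]mulrA; apply: ler_wpM2l => //.
rewrite -[leRHS]mulrA; apply: ler_wpM2l; first exact: (sd_c sd).
rewrite [leRHS]mulrDl; apply: lerD.
  rewrite -[leRHS]mulrA; apply: ler_wpM2l => //.
  apply: le_trans (energy_norm_ge cA cs hJ (ds t, dp t)) _.
  rewrite [X in fnorm _ X](_ : _ = (ds t - Is t, dp t - Ip t) + (Is t, Ip t)); last first.
    by rewrite -[RHS]/(_ , _) !subrK.
  rewrite [leRHS]mulrDl.
  apply: le_trans (ler_fnormD _ _ _) (lerD (energy_error_le tT) _).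
  apply: le_trans (energy_norm_le hJ k0 hA1 hs1 hJ1 _ _) _.
  rewrite -[leRHS]mulrA; apply: ler_wpM2l; first by rewrite addr_ge0 ?sqr_ge0.
  apply: (le_trans (lerD (sigma_interp_error tT mr (sgN tT)) (pressure_interp_error tT mr (pN tT)))).
  exact: (interp_total_le (sd_c sd) L0 hm0).
apply: le_trans (rotation_interp_error tT mr (gmN tT)) _.
rewrite [leLHS](_ : _ = c * L * (h ^+ m * wg)); last by ring.
apply: ler_wpM2l; first by rewrite mulr_ge0 ?(sd_c sd).
apply: ler_wpDr => //; apply: ler_wpM2l => //.
by rewrite -addrA addrC -[leLHS]addr0 -addrA lerD2l !addr_ge0.
Qed.

End first.

Section second.
Variables (Pz P2s P2p P2g : R -> R).
Hypothesis mPz : modulus (@Hnorm _ _ Om m 1 n) T Pz z.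
Hypothesis cPz : modulus_continuous T Pz.
Hypothesis zoo : forall t, t \in `[0, T] -> (Hnorm Om m (z t) < +oo)%E.
Hypotheses (s0 : P2s 0 = 0) (p0 : P2p 0 = 0) (g0 : P2g 0 = 0).
Hypotheses (ms : nondecreasing_on T P2s) (mp : nondecreasing_on T P2p)
  (mg : nondecreasing_on T P2g).
Hypothesis hs : forall t s, 0 <= t -> t <= s -> s <= T ->
  (Ps s - Ps t) ^+ 2 <= (s - t) * (P2s s - P2s t).
Hypothesis hp : forall t s, 0 <= t -> t <= s -> s <= T ->
  (Pp s - Pp t) ^+ 2 <= (s - t) * (P2p s - P2p t).
Hypothesis hg : forall t s, 0 <= t -> t <= s -> s <= T ->
  (Pg s - Pg t) ^+ 2 <= (s - t) * (P2g s - P2g t).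
Local Notation Phi2 := (fun t => ((1 + c) * H) ^+ 2 * (3 * (P2s t + P2p t + P2g t))).

Lemma flux_Hnorm1 t : t \in `[0, T] -> (Hnorm Om 1 (z t) < +oo)%E.
Proof. by move=> tT; exact: Hnorm1_fin order_gt0 (zoo tT). Qed.

(** The interpolation is controlled on Sobolev fields only, so continuity in [L^2] of the flux does
    not suffice: the modulus of [z] in [H^m] is used, at every time. *)
Lemma flux_interp_continuous : form_continuous_on T ipF Iz.
Proof.
move=> t e tT e0.
have H0 : 0 <= H by exact: (sd_hm sd).
have e1 : 0 < e / (H + 1) by rewrite divr_gt0// ltr_wpDl.
have [del del0 hdel] := cPz tT e1; exists del => [|s sT st]; first exact: del0.
have hm : (Hnorm Om m (z s - z t)%R <= `|Pz s - Pz t|%:E)%E.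
  have [_ _ hz] := mPz.
  move: (sT) (tT); rewrite !in_itv/= => /andP[s00 sT'] /andP[t00 tT'].
  have [ts|st'] := leP t s.
    by apply: le_trans (hz t s t00 ts sT') _; rewrite lee_fin ler_norm.
  rewrite (eseminormBC (Hnorm_eseminorm Om m 1 n)) distrC.
  by apply: le_trans (hz s t s00 (ltW st') tT') _; rewrite lee_fin ler_norm.
apply: le_lt_trans (flux_interp_increment sT tT mr (flux_Hnorm1 sT) (flux_Hnorm1 tT) hm) _.
have := hdel s sT st; rewrite ltr_pdivlMr ?ltr_wpDl// mulrC; apply: le_lt_trans.
by rewrite ler_wpM2r// lerDl.
Qed.

Lemma flux_error_continuous : form_continuous_on T ck (fun t => dw t - Iz t).
Proof.
apply: (form_continuous_le hk1); apply: form_continuousB flux_interp_continuous.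
apply: form_continuousB.
- by apply: (C0_form_continuous _ (sol_z sol)) => ? [].
- by apply: (C0_form_continuous _ (sol_z solh)); exact: (sd_WL2 sd).
Qed.

Lemma flux_error_bound t : t \in `[0, T] ->
  fnorm ck (dw t - Iz t) <= 2 * k * (H * Pz T) + fnorm ck (dw 0 - Iz 0) +
    Num.sqrt (2 * (k + k ^+ 2 + k) ^+ 2 * Phi2 T).
Proof.
have [z0 zle hz] := mPz.
have H0 : 0 <= H by exact: (sd_hm sd).
have E0 : Phi2 0 = 0 by rewrite s0 p0 g0 !addr0 !mulr0.
suff B x : x \in `[0, T] -> fnorm ck (dw x - Iz x) <=
    2 * k * (H * Pz T - H * Pz 0) + fnorm ck (dw 0 - Iz 0) +
    Num.sqrt (2 * (k + k ^+ 2 + k) ^+ 2 * (Phi2 T - Phi2 0)).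
  by move=> /B; rewrite E0 z0 mulr0 !subr0.
move: x; clear t.
apply: (@second_energy_estimate _ _ _ _ ipF cA ipF cs ipF ck J hJ k k0 hA1 hA2 hs1 hk1 hJ1 T
  (ltW T0) Zh Qhl sigma_kernel_l2B pressure_l2B ds Is Ig dp Ip D sigma_error_mem
  pressure_error_memI _ _ mass_error_balance Phi interp_increment
  dw Iz Phi2 (fun t => H * Pz t)) => //.
- by move=> x q xT Qq; have := ip_Ip xT Qq; rewrite tol2_fun.
- by move=> x tau q xT Zt Qq; exact: error_constitutive_kernel.
- move=> x s x0 xs sT; apply: ler_wpM2l; first exact: sqr_ge0.
  apply: ler_wpM2l => //.
  exact: (lerD (lerD (ms x0 xs sT) (mp x0 xs sT)) (mg x0 xs sT)).
- move=> x s x0 xs sT; rewrite -(mulrBr ((1 + c) * H)) -(mulrBr (((1 + c) * H) ^+ 2)).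
  rewrite [leLHS]exprMn [leRHS]mulrCA; apply: ler_wpM2l; first exact: sqr_ge0.
  exact: sqr_sum3_le (hs x0 xs sT) (hp x0 xs sT) (hg x0 xs sT).
- by move=> x s x0 xs sT; rewrite ler_wpM2l// zle.
- move=> x s x0 xs sT.
  have xI : x \in `[0, T] by rewrite in_itv/= x0 (le_trans xs).
  have sI : s \in `[0, T] by rewrite in_itv/= sT (le_trans x0).
  rewrite -mulrBr.
  exact: (flux_interp_increment sI xI mr (flux_Hnorm1 sI) (flux_Hnorm1 xI) (hz x s x0 xs sT)).
- exact: flux_error_continuous.
- by move=> x s xT sT; exact: darcy_error xT sT (flux_Hnorm1 sT).
Qed.

Variables (L ws wp wg wz b : R).
Hypothesis L0 : 0 <= L.
Hypotheses (ws0 : 0 <= ws) (wp0 : 0 <= wp) (wg0 : 0 <= wg).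
Hypotheses (Psw : P2s T <= ws ^+ 2) (Ppw : P2p T <= wp ^+ 2) (Pgw : P2g T <= wg ^+ 2).
Hypothesis Pzw : Pz T <= wz.
Hypothesis zN : forall t, t \in `[0, T] -> (Hnorm Om m (z t) <= (L * wz)%:E)%E.
Hypothesis initb : fnorm ipF (dw 0) <= b.
Local Notation Y := (h ^+ m * (ws + wp + wg + wz) + b).

Let inT : 0 \in `[0, T]. Proof. by rewrite in_itv/= lexx ltW. Qed.

Let wz0 : 0 <= wz.
Proof. by have [z0 le _] := mPz; rewrite (le_trans _ Pzw)// -z0 le// ltW. Qed.
Let b0 : 0 <= b. Proof. exact: le_trans (fnorm_ge0 _ _) initb. Qed.
Let hm0 : 0 <= h ^+ m. Proof. by rewrite exprn_ge0// ltW// (sd_h sd). Qed.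
Let Y0 : 0 <= Y.
Proof. by rewrite addr_ge0// mulr_ge0// !addr_ge0. Qed.

Lemma flux_error_le t : t \in `[0, T] ->
  fnorm ck (dw t - Iz t) <= flux_const k c L * Y.
Proof.
move=> tT; apply: le_trans (flux_error_bound tT) _.
apply: (flux_const_bound k0 (sd_c sd) L0 hm0) => //.
- apply: le_trans (hk1 _) _; apply: ler_wpM2l => //.
  apply: le_trans (ler_fnormB _ _ _) _; apply: lerD initb _.
  exact: (flux_interp_error inT mr (flux_Hnorm1 inT) (zN inT)).
have Q0 : 0 <= (k + k ^+ 2 + k) * ((1 + c) * H).
  by rewrite mulr_ge0 ?interp_const_ge0// !addr_ge0 ?sqr_ge0.
set Q := _ * ((1 + c) * H) in Q0.
rewrite [leRHS](_ : _ = 3 * (Q * (ws + wp + wg))); last by rewrite /Q; ring.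
have Qw : 0 <= 3 * (Q * (ws + wp + wg)).
  by apply: mulr_ge0 => //; apply: mulr_ge0 => //; rewrite !addr_ge0.
rewrite -[leRHS]ger0_norm// -sqrtr_sqr; apply: ler_wsqrtr.
rewrite [leLHS](_ : _ = 6 * (Q ^+ 2 * (P2s T + P2p T + P2g T))); last by rewrite /Q; ring.
rewrite [leRHS](_ : _ = 9 * (Q ^+ 2 * (ws + wp + wg) ^+ 2)); last by ring.
have h1 : P2s T + P2p T + P2g T <= (ws + wp + wg) ^+ 2.
  apply: le_trans (lerD (lerD Psw Ppw) Pgw) _.
  exact: sqr3_le.
apply: ler_pM => //; last 2 first.
- by rewrite ler_nat.
- by apply: ler_wpM2l; first exact: sqr_ge0.
rewrite mulr_ge0 ?sqr_ge0// !addr_ge0//.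
- by rewrite -s0 ms// ltW.
- by rewrite -p0 mp// ltW.
- by rewrite -g0 mg// ltW.
Qed.

Lemma pressure_error_le t : t \in `[0, T] ->
  fnorm ipF (dp t - Ip t) <= pressure_const k c L * Y.
Proof.
move=> tT; apply: le_trans (pressure_bound tT) _.
rewrite /pressure_const -[leRHS]mulrA; apply: ler_wpM2l => //.
rewrite -[leRHS]mulrA; apply: ler_wpM2l; first exact: (sd_c sd).
rewrite [leRHS]mulrDl -[dw t](subrK (Iz t)).
apply: le_trans (ler_fnormD _ _ _) (lerD (flux_error_le tT) _).
apply: le_trans (hk1 _) _; rewrite -[leRHS]mulrA; apply: ler_wpM2l => //.
apply: le_trans (flux_interp_error tT mr (flux_Hnorm1 tT) (zN tT)) _.
rewrite [leLHS](_ : _ = c * L * (h ^+ m * wz)); last by ring.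
apply: ler_wpM2l; first by rewrite mulr_ge0 ?(sd_c sd).
apply: ler_wpDr => //; apply: ler_wpM2l => //.
by rewrite lerDr !addr_ge0.
Qed.

End second.
End estimates.

Lemma coupled_error_continuous :
  form_continuous_on T cA (fun t => ds t - Is t + J (dp t - Ip t)).
Proof.
move=> t e tT e0; have [del del0 hdel] := energy_error_continuous tT e0.
exists del => [|s sT st]; first exact: del0.
apply: le_lt_trans (hdel s sT st).
rewrite [X in fnorm cA X](_ : _ = ds s - Is s - (ds t - Is t) +
    J (dp s - Ip s - (dp t - Ip t))).
  exact: (energy_norm_ge cA cs hJ (ds s - Is s - (ds t - Is t), dp s - Ip s - (dp t - Ip t))).
by rewrite (couplingB hJ (dp s - Ip s)) (opprD (ds t - Is t)) (addrACA (ds s - Is s)).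
Qed.

Lemma coupled_errorE t : t \in `[0, T] ->
  tol2 (ISigma d (sg t) - sgh t + mulI al (PQ d (p t) - ph t)) =
  ds t - Is t + J (dp t - Ip t).
Proof.
move=> tT; have L1 := L2B (L2_ISigma tT) (L2_sgh tT); have L2 := L2B (L2_PQ tT) (L2_ph tT).
rewrite (tol2D L1 (alL L2)) (coupling_tol2 _ L2).
by rewrite (sigma_errorE tT) (pressure_errorE tT).
Qed.

Lemma displacement_error_continuous :
  form_continuous_on T ipF (fun t => tol2 (PV d (u t) - uh t)).
Proof.
have cI := projection_error_continuous (sd_VL2 sd) (sd_VB sd) (sd_PV sd)
  (@subset_refl _ _) (sol_u sol).
have cu := C0_form_continuous (@subset_refl _ _) (sol_u sol).
have cuh := C0_form_continuous (sd_VL2 sd) (sol_u solh).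
move=> t e tT e0.
have [del del0 hdel] := form_continuousB (form_continuousB cu cuh) cI tT e0.
exists del => [|s sT st]; first exact: del0.
have := hdel s sT st.
by rewrite /= (subKr_error (tol2 (u s))) (subKr_error (tol2 (u t)))
  -(tol2B (L2_PV sT) (L2_uh sT)) -(tol2B (L2_PV tT) (L2_uh tT)).
Qed.

Lemma rotation_error_continuous :
  form_continuous_on T ipF (fun t => tol2 (PGamma d (gm t) - gmh t)).
Proof.
have SL : skewL2 Om `<=` @L2 _ _ Om n n by move=> ? [].
have cI := projection_error_continuous (sd_GL2 sd) (sd_GB sd) (sd_PG sd) SL (sol_gm sol).
have cg := C0_form_continuous SL (sol_gm sol).
have cgh := C0_form_continuous (sd_GL2 sd) (sol_gm solh).
move=> t e tT e0.
have [del del0 hdel] := form_continuousB (form_continuousB cg cgh) cI tT e0.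
exists del => [|s sT st]; first exact: del0.
have := hdel s sT st.
by rewrite /= (subKr_error (tol2 (gm s))) (subKr_error (tol2 (gm t)))
  -(tol2B (L2_PGamma sT) (L2_gmh sT)) -(tol2B (L2_PGamma tT) (L2_gmh tT)).
Qed.

(** * Estimates in terms of the right-hand sides *)

Section estimates_in_the_data.
Variables (m : nat) (b0 : R).
Hypothesis mr : (1 <= m <= r)%N.
Local Notation L := (T^-1 + 1).
Local Notation HN a b := (@Hnorm _ _ Om m a b).

(** The maximum dominates each of its two entries, and their sum is needed: hence the 2 in [2 + b0],
    the other summand being the initial error. *)
Lemma bound_max_estimates be : bound_max Om T m sg p gm z = be%:E ->
  fnorm ipF (ds 0) + fnorm ipF (dp 0) <= b0 * h ^+ m * be ->
  forall t, t \in `[0, T] ->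
  fnorm cA (ds t - Is t + J (dp t - Ip t)) <=
    energy_const k c L * ((2 + b0) * h ^+ m * be) /\
  nrm Om (PV d (u t) - uh t) + nrm Om (PGamma d (gm t) - gmh t) <=
    rotation_const k c L * ((2 + b0) * h ^+ m * be).
Proof.
move=> EB ib t tT.
have L0 : 0 <= L by rewrite addr_ge0// invr_ge0 ltW.
have hm0 : 0 <= h ^+ m by rewrite exprn_ge0// ltW// (sd_h sd).
have sN a b := Hnorm_eseminorm Om m a b.
have : (W1r_norm3 Om T m 1 sg p gm <= be%:E)%E by rewrite -EB /bound_max le_max lexx.
have zle : (Lr_norm T (HN 1 n) 2%:E z <= be%:E)%E.
  by rewrite -EB /bound_max le_max lexx orbT.
have [yz yz0 Ez] := fine_of_le (Lr_norm_ge0 _ _ _) zle.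
rewrite /W1r_norm3 => /(fine_sum3 (W1r_norm_ge0 T 1 sg) (W1r_norm_ge0 T 1 p)
  (W1r_norm_ge0 T 1 gm))[ys [yp [yg [Es Ep Eg ybe]]]].
have zfin : (Lr_norm T (HN 1 n) 2%:E z < +oo)%E by rewrite Ez ltry.
have [Pz [wz [Pz0 Pzm Pzl [wz0 Pzw wzE]]]] := L2_data (sN 1%N n) T0 zfin.
have wzb : wz <= be by rewrite -lee_fin wzE.
have sfin : (W1r_norm T (HN n n) 1 sg < +oo)%E by rewrite Es ltry.
have pfin : (W1r_norm T (HN 1%N 1%N) 1 p < +oo)%E by rewrite Ep ltry.
have gfin : (W1r_norm T (HN n n) 1 gm < +oo)%E by rewrite Eg ltry.
have key e : 0 < e -> exists2 w, w <= 2 * be + e &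
    fnorm cA (ds t - Is t + J (dp t - Ip t)) <=
      energy_const k c L * (h ^+ m * w + b0 * h ^+ m * be) /\
    nrm Om (PV d (u t) - uh t) + nrm Om (PGamma d (gm t) - gmh t) <=
      rotation_const k c L * (h ^+ m * w + b0 * h ^+ m * be).
  move=> e0; have e3 : 0 < e / 3 by rewrite divr_gt0.
  have [Ps [ws [mPs _ [Psw hws] sgN]]] := W11_data (sN n n) T0 sfin e3.
  have [Pp [wp [mPp _ [Ppw hwp] pN]]] := W11_data (sN 1%N 1%N) T0 pfin e3.
  have [Pg [wg [mPg _ [Pgw hwg] gN]]] := W11_data (sN n n) T0 gfin e3.
  exists (ws + wp + wg + wz).
    move: hws hwp hwg; rewrite Es Ep Eg -!EFinD !lee_fin.
    exact: (perturbed_sum ybe wzb).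
  split.
    exact: (coupled_error_le mr mPs mPp mPg Pzm Pzl Pz0 L0 Psw Ppw Pgw sgN pN wz0 Pzw ib tT).
  exact: (displacement_rotation_le mr mPs mPp mPg Pzm Pzl Pz0 L0 Psw Ppw Pgw sgN pN gN wz0 Pzw ib tT).
split.
- apply: le_of_perturbation => //; first exact: energy_const_ge0 k0 (sd_c sd) L0.
  by move=> e /key[w hw [h1 _]]; exists w.
- apply: le_of_perturbation => //; first exact: rotation_const_ge0 k0 (sd_c sd) L0.
  by move=> e /key[w hw [_ h1]]; exists w.
Qed.

Lemma bound_sum_estimates be : bound_sum Om T m sg p gm z = be%:E ->
  fnorm ipF (dw 0) <= b0 * h ^+ m * be ->
  [/\ form_continuous_on T ck (fun t => dw t - Iz t),
      forall t, t \in `[0, T] -> (Hnorm Om 1 (z t) < +oo)%E,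
      forall t, t \in `[0, T] -> fnorm ck (dw t - Iz t) <=
        flux_const k c L * ((1 + b0) * h ^+ m * be) &
      forall t, t \in `[0, T] -> fnorm ipF (dp t - Ip t) <=
        pressure_const k c L * ((1 + b0) * h ^+ m * be)].
Proof.
move=> EB ib.
have L0 : 0 <= L by rewrite addr_ge0// invr_ge0 ltW.
have hm0 : 0 <= h ^+ m by rewrite exprn_ge0// ltW// (sd_h sd).
have sN a b := Hnorm_eseminorm Om m a b.
have W30 : (0 <= W1r_norm3 Om T m 2%:E sg p gm)%E.
  rewrite /W1r_norm3; apply: adde_ge0; last exact: (W1r_norm_ge0 T 2%:E gm).
  apply: adde_ge0; first exact: (W1r_norm_ge0 T 2%:E sg).
  exact: (W1r_norm_ge0 T 2%:E p).
have Wz0 : (0 <= W1r_norm T (HN 1%N n) 1 z)%E by exact: W1r_norm_ge0.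
have [y3 _ E3] : exists2 y, 0 <= y & W1r_norm3 Om T m 2%:E sg p gm = y%:E.
  by apply: (@fine_of_le _ _ be) => //; rewrite -EB /bound_sum leeDl.
have [yz _ Ez] : exists2 y, 0 <= y & W1r_norm T (HN 1%N n) 1 z = y%:E.
  by apply: (@fine_of_le _ _ be) => //; rewrite -EB /bound_sum leeDr.
have y3z : y3 + yz = be by apply: EFin_inj; rewrite EFinD -E3 -Ez -EB.
have : (W1r_norm3 Om T m 2%:E sg p gm <= y3%:E)%E by rewrite E3.
rewrite {1}/W1r_norm3 => /(fine_sum3 (W1r_norm_ge0 T 2%:E sg) (W1r_norm_ge0 T 2%:E p)
  (W1r_norm_ge0 T 2%:E gm))[ys [yp [yg [Es Ep Eg ybe]]]].
have zfin : (W1r_norm T (HN 1%N n) 1 z < +oo)%E by rewrite Ez ltry.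
have sfin : (W1r_norm T (HN n n) 2%:E sg < +oo)%E by rewrite Es ltry.
have pfin : (W1r_norm T (HN 1%N 1%N) 2%:E p < +oo)%E by rewrite Ep ltry.
have gfin : (W1r_norm T (HN n n) 2%:E gm < +oo)%E by rewrite Eg ltry.
have key e : 0 < e -> exists2 w, w <= 1 * be + e &
    [/\ form_continuous_on T ck (fun t => dw t - Iz t),
      forall t, t \in `[0, T] -> (Hnorm Om 1 (z t) < +oo)%E,
      forall t, t \in `[0, T] -> fnorm ck (dw t - Iz t) <=
        flux_const k c L * (h ^+ m * w + b0 * h ^+ m * be) &
      forall t, t \in `[0, T] -> fnorm ipF (dp t - Ip t) <=
        pressure_const k c L * (h ^+ m * w + b0 * h ^+ m * be)].
  move=> e0; have e4 : 0 < e / 4 by rewrite divr_gt0.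
  have [Ps [P2s [ws [mPs _ [s20 s2m] hs [ws0 Psw hws]]]]] := W12_data (sN n n) T0 sfin e4.
  have [Pp [P2p [wp [mPp _ [p20 p2m] hp [wp0 Ppw hwp]]]]] := W12_data (sN 1%N 1%N) T0 pfin e4.
  have [Pg [P2g [wg [mPg _ [g20 g2m] hg [wg0 Pgw hwg]]]]] := W12_data (sN n n) T0 gfin e4.
  have [Pz [wz [mPz cPz [Pzw hwz] zN]]] := W11_data (sN 1%N n) T0 zfin e4.
  have zoo t : t \in `[0, T] -> (Hnorm Om m (z t) < +oo)%E.
    by move=> tT; apply: le_lt_trans (zN t tT) (ltry _).
  exists (ws + wp + wg + wz).
    move: hws hwp hwg hwz; rewrite Es Ep Eg Ez -!EFinD !lee_fin -y3z.
    exact: (perturbed_sum4 ybe).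
  split.
  - exact: (flux_error_continuous mr mPz cPz zoo).
  - exact: (flux_Hnorm1 mr zoo).
  - move=> t tT; exact: (flux_error_le mr mPs mPp mPg mPz cPz zoo s20 p20 g20 s2m p2m g2m
      hs hp hg L0 ws0 wp0 wg0 Psw Ppw Pgw Pzw zN ib tT).
  - move=> t tT; exact: (pressure_error_le mr mPs mPp mPg mPz cPz zoo s20 p20 g20 s2m p2m g2m
      hs hp hg L0 ws0 wp0 wg0 Psw Ppw Pgw Pzw zN ib tT).
have [_ _ [cz z1 _ _]] := key _ ltr01.
split => // t tT.
- apply: le_of_perturbation => //; first exact: flux_const_ge0 k0 (sd_c sd) L0.
  by move=> e /key[w hw [_ _ /(_ t tT) h1 _]]; exists w.
- apply: le_of_perturbation => //; first exact: pressure_const_ge0 k0 (sd_c sd) L0.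
  by move=> e /key[w hw [_ _ _ /(_ t tT) h1]]; exists w.
Qed.

Lemma Lr_bound_max_estimates be : bound_max Om T m sg p gm z = be%:E ->
  fnorm ipF (ds 0) + fnorm ipF (dp 0) <= b0 * h ^+ m * be ->
  (Lr_norm T (L2Anorm Om A) +oo
     (fun t => (ISigma d (sg t) - sgh t + mulI al (PQ d (p t) - ph t))%R) <=
    (energy_const k c L * ((2 + b0) * h ^+ m * be))%:E)%E /\
  (Lr_norm T (@L2norm _ _ Om n 1) +oo (fun t => (PV d (u t) - uh t)%R) +
   Lr_norm T (@L2norm _ _ Om n n) +oo (fun t => (PGamma d (gm t) - gmh t)%R) <=
    (2 * rotation_const k c L * ((2 + b0) * h ^+ m * be))%:E)%E.
Proof.
move=> EB ib; have H := bound_max_estimates EB ib.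
split.
  rewrite L2Anorm_form; apply: (Lr_norm_form_le T0).
  - move=> t tT; have L1 := L2B (L2_ISigma tT) (L2_sgh tT).
    by have := L2_linear 1 L1 (alL (L2B (L2_PQ tT) (L2_ph tT))); rewrite scale1r.
  - move=> t e tT e0; have [del del0 hdel] := coupled_error_continuous tT e0.
    exists del => [|s sT st]; first exact: del0.
    by rewrite (coupled_errorE tT) (coupled_errorE sT); exact: hdel.
  - by move=> t tT; rewrite (coupled_errorE tT); case: (H t tT).
(* Each supremum over time is bounded by the bound on the pointwise sum, which accounts for the
   factor 2. *)
rewrite !L2norm_form -mulrA mulrDl mul1r EFinD; apply: leeD.
  apply: (Lr_norm_form_le T0); first by move=> t tT; exact: L2B (L2_PV tT) (L2_uh tT).
    exact: displacement_error_continuous.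
  move=> t tT; rewrite -(nrmE (L2B (L2_PV tT) (L2_uh tT))).
  have [_ hle] := H t tT; apply: le_trans hle.
  by rewrite lerDl nrm_ge0.
apply: (Lr_norm_form_le T0); first by move=> t tT; exact: L2B (L2_PGamma tT) (L2_gmh tT).
  exact: rotation_error_continuous.
move=> t tT; rewrite -(nrmE (L2B (L2_PGamma tT) (L2_gmh tT))).
have [_ hle] := H t tT; apply: le_trans hle.
by rewrite lerDr nrm_ge0.
Qed.

Lemma Lr_bound_sum_estimates be be1 : bound_sum Om T m sg p gm z = be%:E ->
  bound_max Om T m sg p gm z = be1%:E ->
  fnorm ipF (ds 0) + fnorm ipF (dp 0) <= b0 * h ^+ m * be1 ->
  fnorm ipF (dw 0) <= b0 * h ^+ m * be ->
  [/\ (Lr_norm T (@L2norm _ _ Om n n) +oo (fun t => (ISigma d (sg t) - sgh t)%R) <=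
        (k * (energy_const k c L * ((2 + b0) * h ^+ m * be1)) +
         k * (pressure_const k c L * ((1 + b0) * h ^+ m * be)))%:E)%E,
      (Lr_norm T (@L2norm _ _ Om 1 n) +oo (fun t => (IW d (z t) - zh t)%R) <=
        (k * (flux_const k c L * ((1 + b0) * h ^+ m * be)))%:E)%E &
      (Lr_norm T (@L2norm _ _ Om 1 1) +oo (fun t => (PQ d (p t) - ph t)%R) <=
        (pressure_const k c L * ((1 + b0) * h ^+ m * be))%:E)%E].
Proof.
move=> EB EB1 ib1 ib; have H1 := bound_max_estimates EB1 ib1.
have [cz z1 Hz Hp] := bound_sum_estimates EB ib.
rewrite !L2norm_form; split; apply: (Lr_norm_form_le T0).
- by move=> t tT; exact: L2B (L2_ISigma tT) (L2_sgh tT).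
- move=> t e tT e0; have [del del0 hdel] := sigma_error_continuous tT e0.
  exists del => [|s sT st]; first exact: del0.
  by rewrite -(sigma_errorE tT) -(sigma_errorE sT); exact: hdel.
- move=> t tT; rewrite -(sigma_errorE tT).
  have [h1 _] := H1 t tT; apply: le_trans (stress_bound t) _.
  exact: (lerD (ler_wpM2l k0 h1) (ler_wpM2l k0 (Hp t tT))).
- move=> t tT; have [WI _ _ _] := flux_error_mem tT (z1 t tT).
  exact: L2B (sd_WL2 sd WI) (L2_zh tT).
- move=> t e tT e0; have [del del0 hdel] := form_continuous_le hk2 cz tT e0.
  exists del => [|s sT st]; first exact: del0.
  have [_ _ <- _] := flux_error_mem tT (z1 t tT).
  have [_ _ <- _] := flux_error_mem sT (z1 s sT).
  exact: hdel.
- move=> t tT; have [_ _ <- _] := flux_error_mem tT (z1 t tT).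
  exact: le_trans (hk2 _) (ler_wpM2l k0 (Hz t tT)).
- by move=> t tT; exact: L2B (L2_PQ tT) (L2_ph tT).
- move=> t e tT e0; have [del del0 hdel] := pressure_error_continuous tT e0.
  exists del => [|s sT st]; first exact: del0.
  by rewrite -(pressure_errorE tT) -(pressure_errorE sT); exact: hdel.
- by move=> t tT; rewrite -(pressure_errorE tT); exact: Hp.
Qed.

End estimates_in_the_data.

End error_equations.

Transparent ipF coefF coupling tol2 energy_form fnorm.

(** * Comparison of the right-hand sides and norm equivalences *)

Section theorem.
Context {R : realType} {n : nat} (Om : @domain R n) (T : R).
Hypothesis T0 : 0 < T.
Local Notation fld a b := ('rV[R]_n -> 'M[R]_(a, b)).

Lemma bound_max_ge0 m sg p gm z : (0 <= bound_max Om T m sg p gm z)%E.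
Proof. by rewrite /bound_max le_max Lr_norm_ge0 orbT. Qed.

Lemma W1r_norm3_ge0 m (q : \bar R) sg p gm : (0 <= W1r_norm3 Om T m q sg p gm)%E.
Proof.
exact: (adde_ge0 (adde_ge0 (W1r_norm_ge0 T q sg) (W1r_norm_ge0 T q p)) (W1r_norm_ge0 T q gm)).
Qed.

Lemma bound_sum_ge0 m sg p gm z : (0 <= bound_sum Om T m sg p gm z)%E.
Proof. exact: (adde_ge0 (W1r_norm3_ge0 m 2%:E sg p gm) (W1r_norm_ge0 T 1 z)). Qed.

(** The stress error is the coupled error, bounded by [bound_max], minus the pressure part, bounded
    by [bound_sum]; this comparison puts both under the second bound. *)
Lemma bound_max_le_sum m sg p gm z :
  (bound_max Om T m sg p gm z <=
   (Num.sqrt T * (T^-1 + 1))%:E * bound_sum Om T m sg p gm z)%E.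
Proof.
have sN a b := Hnorm_eseminorm Om m a b.
have s0 : 0 <= Num.sqrt T by exact: sqrtr_ge0.
have t1 : 0 <= T^-1 by rewrite invr_ge0 ltW.
have C0 : 0 <= Num.sqrt T * (T^-1 + 1) by rewrite mulr_ge0// addr_ge0.
have sC : Num.sqrt T <= Num.sqrt T * (T^-1 + 1) by rewrite ler_peMr// lerDr.
have le1 a b (f : R -> fld a b) : (W1r_norm T (@Hnorm _ _ Om m a b) 1 f <=
    (Num.sqrt T * (T^-1 + 1))%:E * W1r_norm T (@Hnorm _ _ Om m a b) 2%:E f)%E.
  apply: le_trans (W1r_norm12 (sN a b) T0 f) _.
  by rewrite lee_wpmul2r// ?W1r_norm_ge0 ?lee_fin.
have W0 a b (q : \bar R) (f : R -> fld a b) : (0 <= W1r_norm T (@Hnorm _ _ Om m a b) q f)%E.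
  exact: (W1r_norm_ge0 T q f).
have W30 := W1r_norm3_ge0 m 2%:E sg p gm.
have z0 : (0 <= W1r_norm T (@Hnorm _ _ Om m 1 n) 1 z)%E by exact: W0.
have Kz0 : (0 <= (Num.sqrt T * (T^-1 + 1))%:E * W1r_norm T (@Hnorm _ _ Om m 1 n) 1 z)%E.
  by apply: mule_ge0 => //; rewrite lee_fin.
have K30 : (0 <= (Num.sqrt T * (T^-1 + 1))%:E * W1r_norm3 Om T m 2%:E sg p gm)%E.
  by apply: mule_ge0 => //; rewrite lee_fin.
rewrite /bound_max /bound_sum ge_max (ge0_muleDr _ W30 z0); apply/andP; split.
  apply: le_trans (leeDl _ Kz0).
  apply: le_trans (leeD (leeD (le1 _ _ sg) (le1 _ _ p)) (le1 _ _ gm)) _.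
  rewrite -(ge0_muleDr _ (W0 _ _ 2%:E sg) (W0 _ _ 2%:E p)).
  by rewrite -(ge0_muleDr _ (adde_ge0 (W0 _ _ 2%:E sg) (W0 _ _ 2%:E p)) (W0 _ _ 2%:E gm)).
apply: le_trans (leeDr _ K30); exact: (Lr_norm2_W11 (sN _ _) T0 z).
Qed.

Lemma coercive_norms a b (A : coefficient Om a b) : coercive A -> exists k, [/\ 0 <= k,
  forall f, fnorm (coefF A) f <= k * fnorm ipF f &
  forall f, fnorm ipF f <= k * fnorm (coefF A) f].
Proof.
move=> [lo lo0 hlo]; set hi := coef_hi A.
have hi0 : 0 <= hi by exact: coef_hi0.
have li : 0 <= lo^-1 by rewrite invr_ge0 ltW.
exists (Num.sqrt hi + Num.sqrt lo^-1); split.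
- by rewrite addr_ge0 ?sqrtr_ge0.
- move=> f; rewrite mulrDl; apply: ler_wpDr; first by rewrite mulr_ge0 ?sqrtr_ge0.
  rewrite /fnorm -sqrtrM//; apply: ler_wsqrtr; exact: coefF_le.
- move=> f; rewrite mulrDl; apply: ler_wpDl; first by rewrite mulr_ge0 ?sqrtr_ge0.
  rewrite /fnorm -sqrtrM//; apply: ler_wsqrtr.
  rewrite mulrC ler_pdivlMr// mulrC; exact: coefF_ge.
Qed.

Lemma coef_norm_le a b (A : coefficient Om a b) f :
  fnorm (coefF A) f <= Num.sqrt (coef_hi A) * fnorm ipF f.
Proof.
rewrite /fnorm -sqrtrM; last exact: coef_hi0.
by apply: ler_wsqrtr; exact: coefF_le.
Qed.

End theorem.

Fact sum5_ge {R : realFieldType} (a b c d e : R) :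
  0 <= a -> 0 <= b -> 0 <= c -> 0 <= d -> 0 <= e ->
  [/\ a <= 1 + a + b + c + d + e, b <= 1 + a + b + c + d + e,
      c <= 1 + a + b + c + d + e, d <= 1 + a + b + c + d + e &
      e <= 1 + a + b + c + d + e].
Proof. by move=> *; split; lra. Qed.

(** * A common constant for the five estimates *)

Section uniform_estimates.
Context {R : realType} {n : nat} (Om : @domain R n) (T : R).
Hypothesis T0 : 0 < T.
Local Notation fld a b := ('rV[R]_n -> 'M[R]_(a, b)).
Variables (A : coefficient Om n n) (s0c : coefficient Om 1 1) (ka : coefficient Om 1 n).
Variable al : 'rV[R]_n -> R.
Hypothesis alL : forall p : fld 1 1, L2 Om p -> L2 Om (mulI (n := n) al p).
Variables k c c0 : R.
Hypotheses (k0 : 0 <= k) (c_ge0 : 0 <= c) (c00 : 0 < c0).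
Hypothesis hA1 : forall f, fnorm (coefF A) f <= k * fnorm ipF f.
Hypothesis hA2 : forall f, fnorm ipF f <= k * fnorm (coefF A) f.
Hypothesis hs1 : forall q, fnorm (coefF s0c) q <= k * fnorm ipF q.
Hypothesis hk1 : forall w, fnorm (coefF ka) w <= k * fnorm ipF w.
Hypothesis hk2 : forall w, fnorm ipF w <= k * fnorm (coefF ka) w.
Hypothesis hJ1 : forall q, fnorm ipF (@coupling R n Om al q) <= k * fnorm ipF q.

Local Notation L := (T^-1 + 1).
Local Notation EC := (energy_const k c L * (2 + c0)).
Local Notation RC := (2 * rotation_const k c L * (2 + c0)).
Local Notation FC := (k * (flux_const k c L * (1 + c0))).
Local Notation PC := (pressure_const k c L * (1 + c0)).
Local Notation SC := (k * EC * (Num.sqrt T * L) + k * PC).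

(** The summand 1 makes the constant positive, so that its product with an infinite right-hand side
    is [+oo] and not [0 * +oo = 0]. *)
Definition estimate_const : R := 1 + EC + RC + FC + PC + SC.

Let L0 : 0 <= L. Proof. by rewrite addr_ge0// invr_ge0 ltW. Qed.
Let EC0 : 0 <= EC.
Proof. by apply: mulr_ge0; [exact: energy_const_ge0|rewrite addr_ge0// ltW]. Qed.
Let RC0 : 0 <= RC.
Proof.
apply: mulr_ge0; last by rewrite addr_ge0// ltW.
by apply: mulr_ge0 => //; exact: rotation_const_ge0.
Qed.
Let FC0 : 0 <= FC.
Proof.
by apply: mulr_ge0 => //; apply: mulr_ge0; [exact: flux_const_ge0|rewrite addr_ge0// ltW].
Qed.
Let PC0 : 0 <= PC.
Proof. by apply: mulr_ge0; [exact: pressure_const_ge0|rewrite addr_ge0// ltW]. Qed.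
Let SC0 : 0 <= SC.
Proof.
apply: addr_ge0; last exact: mulr_ge0.
by apply: mulr_ge0; [exact: mulr_ge0|rewrite mulr_ge0 ?sqrtr_ge0].
Qed.

Lemma estimate_const_gt0 : 0 < estimate_const.
Proof. by do 5?[apply: ltr_wpDr => //]. Qed.

Lemma estimate_const_ge :
  [/\ EC <= estimate_const, RC <= estimate_const, FC <= estimate_const,
      PC <= estimate_const & SC <= estimate_const].
Proof. exact: (sum5_ge EC0 RC0 FC0 PC0 SC0). Qed.

Lemma uniform_error_estimates r h d f g sg u gm z p sg' p' dsg dz
    sgh uh gmh zh ph sgh' ph' dsgh dzh m :
  stable_discretization Om r c h d ->
  solution T A s0c ka al (@Hdiv _ _ Om n) (@L2 _ _ Om n 1)
    (skewL2 Om) (@Hdiv _ _ Om 1) (@L2 _ _ Om 1 1) f g sg u gm z p sg' p' dsg dz ->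
  solution T A s0c ka al (Sigmah d) (Vh d) (Gammah d) (Wh d)
    (Qh d) f g sgh uh gmh zh ph sgh' ph' dsgh dzh ->
  (1 <= m <= r)%N ->
  let B1 := bound_max Om T m sg p gm z in
  let B2 := bound_sum Om T m sg p gm z in
  let CK := (estimate_const * h ^+ m)%:E in
  ((nrm Om (sg 0 - sgh 0) + nrm Om (p 0 - ph 0))%R%:E <= (c0 * h ^+ m)%:E * B1)%E ->
  ((nrm Om (z 0 - zh 0)%R)%:E <= (c0 * h ^+ m)%:E * B2)%E ->
  [/\ (Lr_norm T (L2Anorm Om A) +oo
         (fun t => (ISigma d (sg t) - sgh t + mulI al (PQ d (p t) - ph t))%R) <= CK * B1)%E,
      (Lr_norm T (@L2norm _ _ Om n n) +oo (fun t => (ISigma d (sg t) - sgh t)%R)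
         <= CK * B2)%E,
      (Lr_norm T (@L2norm _ _ Om n 1) +oo (fun t => (PV d (u t) - uh t)%R) +
       Lr_norm T (@L2norm _ _ Om n n) +oo (fun t => (PGamma d (gm t) - gmh t)%R)
         <= CK * B1)%E,
      (Lr_norm T (@L2norm _ _ Om 1 n) +oo (fun t => (IW d (z t) - zh t)%R) <= CK * B2)%E &
      (Lr_norm T (@L2norm _ _ Om 1 1) +oo (fun t => (PQ d (p t) - ph t)%R) <= CK * B2)%E].
Proof.
move=> sd sol solh mr B1 B2 CK ib1 ib2.
have h0 : 0 < h ^+ m by rewrite exprn_gt0// (sd_h sd).
have [EK RK FK PK SK] := estimate_const_ge.
have CK0 : 0 < estimate_const * h ^+ m by rewrite mulr_gt0// estimate_const_gt0.
have inT : 0 \in `[0, T] by rewrite in_itv/= lexx ltW.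
have CKy : (CK * +oo = +oo)%E by rewrite /CK gt0_muley ?lte_fin.
have B10 : (0 <= B1)%E by exact: bound_max_ge0.
have B20 : (0 <= B2)%E by exact: bound_sum_ge0.
have i1 b1 : B1 = b1%:E ->
    fnorm ipF (curve_diff Om sg sgh 0) + fnorm ipF (curve_diff Om p ph 0) <= c0 * h ^+ m * b1.
  rewrite (fnorm_curve_diff (L2_sg sol inT) (L2_sgh sd solh inT)).
  rewrite (fnorm_curve_diff (L2_p sol inT) (L2_ph sd solh inT)).
  by move=> E1; move: ib1; rewrite E1 -EFinM lee_fin.
have [e1 e2] : (Lr_norm T (L2Anorm Om A) +oo
      (fun t => (ISigma d (sg t) - sgh t + mulI al (PQ d (p t) - ph t))%R) <= CK * B1)%E /\
    (Lr_norm T (@L2norm _ _ Om n 1) +oo (fun t => (PV d (u t) - uh t)%R) +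
     Lr_norm T (@L2norm _ _ Om n n) +oo (fun t => (PGamma d (gm t) - gmh t)%R) <= CK * B1)%E.
  have [/eqP ->|/eqP B1oo] := boolP (B1 == +oo%E); first by rewrite CKy !leey.
  have [b1 b10 E1] : exists2 y, 0 <= y & B1 = y%:E.
    apply: (@fine_of_le _ _ (fine B1)) => //; rewrite fineK//.
    by rewrite ge0_fin_numE// lt_neqAle leey andbT; exact/eqP.
  have [r1 r2] := Lr_bound_max_estimates T0 alL k0 hA1 hA2 hs1 hk1 hJ1 sd sol solh mr E1 (i1 _ E1).
  have hb1 : 0 <= h ^+ m * b1 by rewrite mulr_ge0// ltW.
  rewrite E1 /CK -EFinM; split.
    apply: le_trans r1 _; rewrite lee_fin -[leRHS]mulrA.
    rewrite [leLHS](_ : _ = EC * (h ^+ m * b1)); last by ring.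
    exact: ler_wpM2r.
  apply: le_trans r2 _; rewrite lee_fin -[leRHS]mulrA.
  rewrite [leLHS](_ : _ = RC * (h ^+ m * b1)); last by ring.
  exact: ler_wpM2r.
have [B2oo|/eqP B2oo] := eqVneq B2 +oo%E; first by rewrite B2oo CKy !leey.
have [b2 b20 E2] : exists2 y, 0 <= y & B2 = y%:E.
  apply: (@fine_of_le _ _ (fine B2)) => //; rewrite fineK//.
  by rewrite ge0_fin_numE// lt_neqAle leey andbT; exact/eqP.
(* Finiteness of the second right-hand side entails that of the first, as the estimate of the stress
   requires. *)
have B12 : (B1 <= (Num.sqrt T * L * b2)%:E)%E.
  by rewrite EFinM -E2; exact: bound_max_le_sum.
have [b1 b10 E1] := fine_of_le B10 B12.
have b12 : b1 <= Num.sqrt T * L * b2 by move: B12; rewrite E1 lee_fin.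
have i2 : fnorm ipF (curve_diff Om z zh 0) <= c0 * h ^+ m * b2.
  rewrite (fnorm_curve_diff (L2_z sol inT) (L2_zh sd solh inT)).
  by move: ib2; rewrite E2 -EFinM lee_fin.
have [s1 s2 s3] := Lr_bound_sum_estimates T0 alL k0 hA1 hA2 hs1 hk1 hk2 hJ1 sd sol solh mr
  E2 E1 (i1 _ E1) i2.
have hb2 : 0 <= h ^+ m * b2 by rewrite mulr_ge0// ltW.
split; [exact: e1| |exact: e2| |]; rewrite E2 /CK -EFinM.
- apply: le_trans s1 _; rewrite lee_fin -[leRHS]mulrA.
  apply: le_trans (ler_wpM2r hb2 SK).
  rewrite [leRHS]mulrDl; apply: lerD.
    rewrite [leLHS](_ : _ = k * EC * (h ^+ m * b1)); last by ring.
    rewrite -[leRHS]mulrA; apply: ler_wpM2l; first exact: mulr_ge0.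
    rewrite [leRHS](_ : _ = h ^+ m * (Num.sqrt T * L * b2)); last by ring.
    by apply: ler_wpM2l => //; exact: ltW.
  by rewrite le_eqVlt; apply/orP; left; apply/eqP; ring.
- apply: le_trans s2 _; rewrite lee_fin -[leRHS]mulrA.
  rewrite [leLHS](_ : _ = FC * (h ^+ m * b2)); last by ring.
  exact: ler_wpM2r.
- apply: le_trans s3 _; rewrite lee_fin -[leRHS]mulrA.
  rewrite [leLHS](_ : _ = PC * (h ^+ m * b2)); last by ring.
  exact: ler_wpM2r.
Qed.

End uniform_estimates.

Theorem theorem3p2 (R : realType) (n : nat) (hn : n = 2%N \/ n = 3%N)
    (Om : set 'rV[R]_n) (hOm : lipschitz_domain Om)
    (T : R) (hT : 0 < T)
    (C A : 'rV[R]_n -> 'M[R]_n -> 'M[R]_n) (hA : compliance Om C A)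
    (al : 'rV[R]_n -> R) (hal : bounded_coef Om al)
    (hal0 : forall x, Om x -> 0 < al x)
    (s0 : 'rV[R]_n -> R) (hs0 : bounded_coef Om s0)
    (hs00 : forall x, Om x -> 0 <= s0 x)
    (kappa : 'rV[R]_n -> 'M[R]_n) (hkappa : conductivity Om kappa)
    (r r' : nat) (hr : (1 <= r)%N) (hr' : (1 <= r')%N)
    (hrr' : r' = r \/ r' = r.-1)
    (I : Type) (D : I -> @discretization R n)
    (hD : finite_elements Om D r r')
    (hS1 : S1 Om D) (hS2 : S2 Om D r) (hS3 : S3 Om D) (hS4 : S4 Om D)
    (hP : interpolations Om D r)
    (c0 : R) (hc0 : 0 < c0) :
  exists2 c : R, 0 < c &
  forall (i : I)
    (f : R -> 'rV[R]_n -> 'cV[R]_n) (g : R -> 'rV[R]_n -> 'M[R]_1)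
    (sg : R -> 'rV[R]_n -> 'M[R]_n) (u : R -> 'rV[R]_n -> 'cV[R]_n)
    (gm : R -> 'rV[R]_n -> 'M[R]_n) (z : R -> 'rV[R]_n -> 'rV[R]_n)
    (p : R -> 'rV[R]_n -> 'M[R]_1)
    (sgh : R -> 'rV[R]_n -> 'M[R]_n) (uh : R -> 'rV[R]_n -> 'cV[R]_n)
    (gmh : R -> 'rV[R]_n -> 'M[R]_n) (zh : R -> 'rV[R]_n -> 'rV[R]_n)
    (ph : R -> 'rV[R]_n -> 'M[R]_1) (m : nat),
  (forall t, t \in `[0, T] -> L2 Om (f t) /\ L2 Om (g t)) ->
  biot_solution Om T A al s0 kappa
    (@Hdiv _ _ Om n) (@L2 _ _ Om n 1) (skewL2 Om) (@Hdiv _ _ Om 1)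
    (@L2 _ _ Om 1 1) f g sg u gm z p ->
  biot_solution Om T A al s0 kappa
    (Sigmah (D i)) (Vh (D i)) (Gammah (D i)) (Wh (D i)) (Qh (D i))
    f g sgh uh gmh zh ph ->
  (1 <= m <= r)%N ->
  let hm := meshwidth (D i) ^+ m in
  let B1 := bound_max Om T m sg p gm z in
  let B2 := bound_sum Om T m sg p gm z in
  ((nrm Om (fun x => sg 0 x - sgh 0 x) + nrm Om (fun x => p 0 x - ph 0 x))%R%:E
     <= (c0 * hm)%:E * B1)%E ->
  ((nrm Om (fun x => z 0 x - zh 0 x)%R)%:E <= (c0 * hm)%:E * B2)%E ->
  let e_sg := fun t x => ISigma (D i) (sg t) x - sgh t x in
  let e_u := fun t x => PV (D i) (u t) x - uh t x in
  let e_gm := fun t x => PGamma (D i) (gm t) x - gmh t x in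
  let e_z := fun t x => IW (D i) (z t) x - zh t x in
  let e_p := fun t x => PQ (D i) (p t) x - ph t x in
  [/\ (Lr_norm T (L2Anorm Om A) +oo (fun t x => e_sg t x + mulI al (e_p t) x)%R
         <= (c * hm)%:E * B1)%E,
      (Lr_norm T (@L2norm _ _ Om n n) +oo e_sg <= (c * hm)%:E * B2)%E,
      (Lr_norm T (@L2norm _ _ Om n 1) +oo e_u
         + Lr_norm T (@L2norm _ _ Om n n) +oo e_gm <= (c * hm)%:E * B1)%E,
      (Lr_norm T (@L2norm _ _ Om 1 n) +oo e_z <= (c * hm)%:E * B2)%E &
      (Lr_norm T (@L2norm _ _ Om 1 1) +oo e_p <= (c * hm)%:E * B2)%E].
Proof.
have n0 : (0 < n)%N by case: hn => ->.
have [oOm Om0 _ bOm _] := hOm.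
have mOm := open_measurable_rV oOm.
pose X : domain n := Domain mOm (leb_bounded mOm bOm) bOm.
have [cA EA /coercive_norms[kA [kA0 hA1 hA2]]] := @compliance_coef R n X C A hA.
have [ck Ek /coercive_norms[kk [kk0 hk1 hk2]]] := @conductivity_coef R n X kappa n0 hkappa.
have [cs Es] := @scalar_coef R n X s0 1%N 1%N hs0 hs00.
have [kJ kJ0 hJ] := @mulI_bound R n X al hal.
pose ks := Num.sqrt (coef_hi cs).
pose k := kA + kk + ks + kJ.
have ks0 : 0 <= ks by exact: sqrtr_ge0.
have [gA gk gs gJ] : [/\ kA <= k, kk <= k, ks <= k & kJ <= k].
  by rewrite /k; split; lra.
have k0 : 0 <= k by exact: le_trans kA0 gA.
have grow (x y z w : R) : x <= y * z -> 0 <= z -> y <= w -> x <= w * z.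
  by move=> h1 h2 h3; apply: le_trans h1 _; exact: ler_wpM2r.
have alL (p : 'rV[R]_n -> 'M[R]_1) : L2 X p -> L2 X (mulI (n := n) al p).
  by move=> /hJ[].
have hJ1 q : fnorm ipF (@coupling R n X al q) <= k * fnorm ipF q.
  have [LJ nJ] := hJ _ (l2_L2 q).
  apply: grow (fnorm_ge0 _ _) gJ.
  by rewrite couplingE -(nrmE LJ) -nrm_fun.
have [c c_ge0 sd] := @family_stable R n X I D r r' n0 Om0 hD hS1 hS2 hS3 hS4 hP.
(* The constant is fixed before the discretization, the solutions and [m]; it depends on [T], the
   coefficients, the stability constants and [c0]. *)
exists (estimate_const T k c c0).
  exact: estimate_const_gt0.
move=> i f g sg u gm z p sgh uh gmh zh ph m _ hsol hsolh mr hm B1 B2 ib1 ib2 /=.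
have W a : @Hdiv _ _ X a `<=` @L2 _ _ X a n by move=> ? [].
have [sg' [p' [dsg [dz sol]]]] : exists sg' p' dsg dz, solution T cA cs ck al (@Hdiv _ _ X n)
    (@L2 _ _ X n 1) (skewL2 X) (@Hdiv _ _ X 1) (@L2 _ _ X 1 1) f g sg u gm z p sg' p' dsg dz.
  apply: (biot_solutionP Es Ek alL (W n) (W 1%N) (@subset_refl _ _)).
  by rewrite EA.
have [sgh' [ph' [dsgh [dzh solh]]]] : exists sgh' ph' dsgh dzh, solution T cA cs ck al
    (Sigmah (D i)) (Vh (D i)) (Gammah (D i)) (Wh (D i)) (Qh (D i)) f g sgh uh gmh zh ph
    sgh' ph' dsgh dzh.
  apply: (biot_solutionP Es Ek alL (sd_SL2 (sd i)) (sd_WL2 (sd i)) (sd_QL2 (sd i))).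
  by rewrite EA.
have := @uniform_error_estimates R n X T hT cA cs ck al alL k c c0 k0 c_ge0 hc0
  (fun q => grow _ _ _ _ (hA1 q) (fnorm_ge0 _ _) gA)
  (fun q => grow _ _ _ _ (hA2 q) (fnorm_ge0 _ _) gA)
  (fun q => grow _ _ _ _ (coef_norm_le cs q) (fnorm_ge0 _ _) gs)
  (fun q => grow _ _ _ _ (hk1 q) (fnorm_ge0 _ _) gk)
  (fun q => grow _ _ _ _ (hk2 q) (fnorm_ge0 _ _) gk) hJ1 _ _ _ _ _ _ _ _ _ _ _ _ _ _
  _ _ _ _ _ _ _ _ _ _ (sd i) sol solh mr ib1 ib2.
by rewrite EA.
Qed.
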